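(* Let $0<\alpha<n$, $b\in BMO(\mathbb{R}^n)$ with $b^{-}\in L^{\infty}(\mathbb{R}^n)$, and let $\Phi,\Psi$ be Young functions such that $\Phi\in\Delta_2\cap\nabla_2$ and $\Psi\in\Delta_2\cap\nabla_2$. If there is a constant $C>0$ such that $$r^{-\frac{\alpha}{n}}\,\Phi^{-1}(r)\le C\,\Psi^{-1}(r)\qquad\text{for all } r>0,$$ then the commutator $[b,M_\alpha]$ is bounded from $L^{\Phi}(\mathbb{R}^n)$ to $L^{\Psi}(\mathbb{R}^n)$.
   Context: A function $\Phi:[0,\infty)\to[0,\infty]$ is a Young function if it is convex, left-continuous, $\lim_{r\to+0}\Phi(r)=\Phi(0)=0$ and $\lim_{r\to\infty}\Phi(r)=\infty$. For $0\le s\le\infty$, $\Phi^{-1}(s)=\inf\{r\ge 0:\Phi(r)>s\}$. $\Phi\in\Delta_2$ means that there is $C>1$ with $\Phi(2r)\le C\Phi(r)$ for all $r>0$. $\Phi\in\nabla_2$ means that there is $C>1$ with $\Phi(r)\le\frac{1}{2C}\Phi(Cr)$ for all $r\ge 0$. The Orlicz space $L^{\Phi}(\mathbb{R}^n)$ is the set of measurable $f$ with $\int_{\mathbb{R}^n}\Phi(k|f(x)|)\,dx<\infty$ for some $k>0$, with norm $\|f\|_{L^\Phi}=\inf\{\lambda>0:\int_{\mathbb{R}^n}\Phi(|f(x)|/\lambda)\,dx\le 1\}$. $B(x,r)$ is the ball of radius $r$ centered at $x$ and $|B(x,r)|$ its Lebesgue measure. $BMO(\mathbb{R}^n)$ is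 the set of $b\in L^1_{\rm loc}(\mathbb{R}^n)$ with $\|b\|_*=\sup_{x\in\mathbb{R}^n,r>0}\frac{1}{|B(x,r)|}\int_{B(x,r)}|b(y)-b_{B(x,r)}|\,dy<\infty$, where $b_{B(x,r)}$ is the average of $b$ over $B(x,r)$. $b^{-}=-\min\{b,0\}$ is the negative part of $b$. The fractional maximal operator is $M_\alpha f(x)=\sup_{t>0}|B(x,t)|^{-1+\frac{\alpha}{n}}\int_{B(x,t)}|f(y)|\,dy$, and $[b,M_\alpha]$ is formally defined by $[b,M_\alpha]f=b\,M_\alpha f-M_\alpha(bf)$. Boundedness of an operator $T$ from $X$ to $Y$ means that there is a constant $C>0$ with $\|Tf\|_Y\le C\|f\|_X$ for all $f\in X$. *)

(* Defs.v *)
From HB Require Import structures.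
From mathcomp Require Import all_boot all_order all_algebra.
From mathcomp Require Import all_classical all_reals all_analysis.
From mathcomp Require Import measurable_realfun.

Set Implicit Arguments.
Unset Strict Implicit.
Unset Printing Implicit Defensive.

Import Order.TTheory GRing.Theory Num.Theory.
Import numFieldNormedType.Exports.

Local Open Scope classical_set_scope.
Local Open Scope ring_scope.
Local Open Scope ereal_scope.

Section cons_measure.
Context (R : realType) (n : nat).
Variable mu : {sigma_finite_measure set (n.-tuple (measurableTypeR R)) -> \bar R}.

Let cons_tup (x : measurableTypeR R * n.-tuple (measurableTypeR R)) :
  n.+1.-tuple (measurableTypeR R) := [the n.+1.-tuple _ of x.1 :: x.2].

Let measurable_cons_tup : measurable_fun setT cons_tup.
Proof. exact: measurable_cons. Qed.

Let uncons_tup (t : n.+1.-tuple (measurableTypeR R)) :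
  measurableTypeR R * n.-tuple (measurableTypeR R) :=
  (thead t, [tuple of behead t]).

Let measurable_uncons_tup : measurable_fun setT uncons_tup.
Proof.
by apply/measurable_fun_pairP; split;
  [exact: measurable_tnth|exact: measurable_behead].
Qed.

Let cons_tupK : cancel cons_tup uncons_tup.
Proof. by case=> x t; congr pair; apply: val_inj. Qed.

Definition cons_measure : set (n.+1.-tuple (measurableTypeR R)) -> \bar R :=
  pushforward (lebesgue_measure \x mu) cons_tup.

Let cons_measure0 : cons_measure set0 = 0.
Proof. by rewrite /cons_measure /pushforward preimage_set0 measure0. Qed.

Let cons_measure_ge0 A : 0 <= cons_measure A.
Proof. exact: measure_ge0. Qed.

Let cons_measure_sigma_additive : semi_sigma_additive cons_measure.
Proof.
move=> F mF tF mUF; rewrite /cons_measure /pushforward preimage_bigcup.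
apply: measure_semi_sigma_additive.
- by move=> k; rewrite -[X in measurable X]setTI; exact: measurable_cons_tup.
- apply/trivIsetP => /= i j _ _ ij; rewrite -preimage_setI.
  by move/trivIsetP : tF => /(_ _ _ _ _ ij) ->//; rewrite preimage_set0.
- by rewrite -preimage_bigcup -[X in measurable X]setTI;
    exact: measurable_cons_tup.
Qed.

HB.instance Definition _ := isMeasure.Build _ _ _
  cons_measure cons_measure0 cons_measure_ge0 cons_measure_sigma_additive.

Let cons_measure_sigma_finite : sigma_finite setT cons_measure.
Proof.
have /sigma_finiteP[F [TF ndF Foo]] := sigma_finiteT (@lebesgue_measure R).
have /sigma_finiteP[G [TG ndG Goo]] := sigma_finiteT mu.
have mFG k : measurable (F k `*` G k).
  by apply: measurableX; [exact: (Foo k).1|exact: (Goo k).1].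
exists (fun k => uncons_tup @^-1` (F k `*` G k)).
  rewrite -preimage_bigcup (_ : \bigcup_k _ = setT) ?preimage_setT//.
  rewrite -subTset => -[x y] _.
  have [k _ Fkx] : (\bigcup_k F k) x by rewrite -TF.
  have [l _ Gly] : (\bigcup_k G k) y by rewrite -TG.
  exists (maxn k l) => //; split.
  - by move: x Fkx; exact/subsetPset/ndF/leq_maxl.
  - by move: y Gly; exact/subsetPset/ndG/leq_maxr.
move=> k; split.
  by rewrite -[X in measurable X]setTI; exact: measurable_uncons_tup.
rewrite /cons_measure /pushforward -comp_preimage.
rewrite (_ : _ \o _ = id); last by apply/funext => x /=; rewrite cons_tupK.
have [mF Fk] := Foo k; have [mG Gk] := Goo k.
by rewrite preimage_id product_measure1E// lte_mul_pinfty// ge0_fin_numE.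
Qed.

HB.instance Definition _ := Measure_isSigmaFinite.Build _ _ _
  cons_measure cons_measure_sigma_finite.

End cons_measure.

(* The n-fold product of the one-dimensional Lebesgue measure, on the product
   (i.e. Borel) sigma-algebra of R^n. *)
Fixpoint borel_lebesgue (R : realType) (n : nat) :
    {sigma_finite_measure set (n.-tuple (measurableTypeR R)) -> \bar R} :=
  if n is m.+1 then cons_measure (borel_lebesgue R m) else \d_ [tuple].

(* R^n with the sigma-algebra of Lebesgue-measurable sets. *)
Definition euclid (R : realType) (n : nat) :=
  caratheodory_type (mu_ext (borel_lebesgue R n)).

HB.instance Definition _ (R : realType) (n : nat) :=
  Measurable.on (euclid R n).

Definition lebesgue (R : realType) (n : nat) :
    {measure set (euclid R n) -> \bar R} :=
  @completed_measure_extension _ _ R (borel_lebesgue R n).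

Section operators.
Context (R : realType) (n : nat).
Local Notation Rn := (euclid R n).
Local Notation leb := (lebesgue R n).

Definition edist (x y : Rn) : R :=
  Num.sqrt (\sum_(i < n) ((tnth x i : R) - (tnth y i : R)) ^+ 2)%R.

Definition eball (x : Rn) (r : R) : set Rn := [set y | (edist x y < r)%R].

Definition vol (x : Rn) (r : R) : R := fine (leb (eball x r)).

(* Every compact set lies in a ball, and closed balls are compact. *)
Definition L1loc (b : Rn -> R) : Prop :=
  measurable_fun setT b /\
  forall (x : Rn) (r : R), (0 < r)%R -> leb.-integrable (eball x r) (EFin \o b).

Definition avg (b : Rn -> R) (x : Rn) (r : R) : R :=
  ((vol x r)^-1 * \int[leb]_(y in eball x r) b y)%R.

Definition bmo_norm (b : Rn -> R) : \bar R :=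
  ereal_sup [set z | exists (x : Rn) (r : R), (0 < r)%R /\
    z = (vol x r)^-1%:E *
        \int[leb]_(y in eball x r) `|(b y - avg b x r)%R|%:E].

Definition BMO (b : Rn -> R) : Prop := L1loc b /\ bmo_norm b < +oo.

(* Only the values of Phi on [0, +oo[ matter. *)
Record young_function (Phi : R -> \bar R) : Prop := YoungFunction {
  young_ge0 : forall r : R, (0 <= r)%R -> 0 <= Phi r ;
  young_convex : forall r s t : R, (0 <= r)%R -> (0 <= s)%R -> (0 <= t <= 1)%R ->
    Phi (t * r + (1 - t) * s)%R <= t%:E * Phi r + (1 - t)%R%:E * Phi s ;
  young_left_continuous : forall r : R, (0 < r)%R -> Phi @ r^'- --> Phi r ;
  young0 : Phi 0%R = 0 ;
  young_right0 : Phi @ 0%R^'+ --> 0 ;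
  young_pinfty : Phi r @[r --> +oo%R] --> +oo }.

Definition young_inv (Phi : R -> \bar R) (s : \bar R) : \bar R :=
  ereal_inf [set r%:E | r in [set r : R | (0 <= r)%R /\ s < Phi r]].

Definition Delta2 (Phi : R -> \bar R) : Prop :=
  exists2 C : R, (1 < C)%R &
    forall r : R, (0 < r)%R -> Phi (2 * r)%R <= C%:E * Phi r.

Definition nabla2 (Phi : R -> \bar R) : Prop :=
  exists2 C : R, (1 < C)%R &
    forall r : R, (0 <= r)%R -> Phi r <= (2 * C)^-1%:E * Phi (C * r)%R.

(* Phi extended by Phi(+oo) = +oo; it is applied to nonnegative arguments. *)
Definition young_ext (Phi : R -> \bar R) (y : \bar R) : \bar R :=
  if y is r%:E then Phi r else +oo.

(* Functions are extended-real valued, so that maximal functions are total;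
   members of an Orlicz space are finite almost everywhere. *)
Definition Orlicz (Phi : R -> \bar R) (f : Rn -> \bar R) : Prop :=
  measurable_fun setT f /\
  exists2 k : R, (0 < k)%R & \int[leb]_x young_ext Phi (k%:E * `|f x|) < +oo.

Definition orlicz_norm (Phi : R -> \bar R) (f : Rn -> \bar R) : \bar R :=
  ereal_inf [set l%:E | l in [set l : R | (0 < l)%R /\
    \int[leb]_x young_ext Phi (`|f x| * l^-1%:E) <= 1]].

Definition Orlicz_bounded (Phi Psi : R -> \bar R)
    (T : (Rn -> \bar R) -> (Rn -> \bar R)) : Prop :=
  exists2 C : R, (0 < C)%R &
    forall f, Orlicz Phi f ->
      Orlicz Psi (T f) /\ orlicz_norm Psi (T f) <= C%:E * orlicz_norm Phi f.

Definition frac_max (alpha : R) (f : Rn -> \bar R) (x : Rn) : \bar R :=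
  ereal_sup [set (vol x t `^ (-1 + alpha / n%:R))%:E *
                 \int[leb]_(y in eball x t) `|f y| | t in [set t : R | (0 < t)%R]].

(* The difference reads -oo where both terms are +oo. This convention does not
   weaken boundedness: a function in an Orlicz space is infinite only on a
   null set. *)
Definition commutator_max (b : Rn -> R) (alpha : R) (f : Rn -> \bar R)
    (x : Rn) : \bar R :=
  (b x)%:E * frac_max alpha f x - frac_max alpha (fun y => (b y)%:E * f y) x.

End operators.

(* Main.v *)
From mathcomp Require Import all_boot all_order all_algebra.
From mathcomp Require Import all_classical all_reals all_analysis.
From mathcomp Require Import measurable_realfun.
From mathcomp Require Import ess_sup_inf.
From mathcomp Require Import ring lra.
Require Import Defs.

Set Implicit Arguments.
Unset Strict Implicit.
Unset Printing Implicit Defensive.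

Import Order.TTheory GRing.Theory Num.Theory.
Import numFieldNormedType.Exports.

Local Open Scope classical_set_scope.
Local Open Scope ring_scope.
Local Open Scope ereal_scope.

(** Since b = |b| - 2 b^-, the value of the commutator at x is at most
    S(x) + 2 b^-(x) M_alpha f(x) in absolute value, where S(x) is the supremum
    over the balls B about x of |B|^(-1 + alpha/n) times the integral over B of
    |b(x) - b(y)| |f(y)| dy: replacing b(y) by b(x) under the integral costs at
    most S(x) in either direction ([commutator_sup_bound]). So it suffices to
    find, for f of small modular, one function V of bounded integral which
    dominates Psi(M_alpha f / c) and Psi(S / c) almost everywhere
    ([ball_commutator]); scaling then gives the norm inequality.

    Balls are replaced by dyadic cubes. A ball of radius r lies in a cube of
    comparable volume belonging to one of 2^n grids, obtained from each other by
    shifting coordinates by thirds ([eball_sub_grid_cell]). The grids start with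
    cubes of side 2^N; the functions V found for the 2^n shifts are added, and V
    is the lower limit of these sums as N grows, whose integral is controlled by
    Fatou's lemma.

    Along one grid only the nesting of the cells, their volumes and their
    regularity matter, and everything rests on one principle ([stopping_le]): an
    inequality between integrals over the cells at which a stopping rule first
    applies adds up to the inequality over the union of these cells. Let E_k be
    the average over the cell of generation k, M the maximal function of these
    averages, b_k = E_k b, v_k the volume of a cell, and a = alpha/n.

    - Hedberg's argument ([hedberg]) compares F_k = v_k^a E_k g with M g: the
      bound E_k g <= M g is good on small cells, the bound coming from the
      modular of g is good on large ones, and the hypothesis on Phi and Psi says
      that they balance. Hence Psi(F_k / c) <= Phi(M g), and the right-hand side
      is integrable because Phi is nabla_2 ([maximal_modular]).
    - Write b(x) - b(y) = (b(x) - b_k) - (b(y) - b_k). For the second part the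
      John-Nirenberg inequality bounds the integral of |b - b_k| g over a cell
      by that of M g ([integral_osc_mul]), and Hedberg's argument applies to M g
      in place of g.
    - The first part is |b(x) - b_k(x)| F_k(x), an unbounded factor times one
      that is only controlled through its supremum over k. For each l stop at
      the first generation where F_k exceeds e 2^l. In the cell reached there,
      the set where b deviates by j steps occupies a fraction of at most
      (2K)^-j, whereas Psi(j e 2^l) is at most K^j Psi(e 2^l), K being the
      doubling constant of Psi. So the sum over j converges, and the sum over l
      is geometric ([integral_principal_bound], [le_principal_bound]).

    The Young functions enter as real functions that are nondecreasing, star
    shaped and positive on positive numbers ([growth]), Phi satisfying in addition
    a nabla_2 condition and Psi a doubling condition. *)
(** * Growth functions *)

Section growth.
Context (R : realType).

(** Star-shapedness, [phi (t * x) <= t * phi x] for [t] in [[0, 1]], stands in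
    for convexity. The value 0 is prescribed on
    negative numbers so that [phi] is total and monotone. *)
Record growth (phi : R -> R) : Prop := Growth {
  gr_nd : {homo phi : x y / (x <= y)%R} ;
  gr_star : forall t x : R, (0 <= t <= 1)%R -> (0 <= x)%R ->
    (phi (t * x) <= t * phi x)%R ;
  gr_gt0 : forall x : R, (0 < x)%R -> (0 < phi x)%R ;
  gr_le0 : forall x : R, (x <= 0)%R -> phi x = 0%R }.

(** The value at [+oo] is [+oo], so that a bound on the integral of [ext phi g]
    controls the points where [g] is infinite. *)
Definition ext (phi : R -> R) (y : \bar R) : \bar R :=
  if y == +oo then +oo else (phi (fine y))%:E.

Lemma ext_EFin phi (r : R) : ext phi r%:E = (phi r)%:E.
Proof. by []. Qed.

Lemma ext_pinfty phi : ext phi +oo = +oo.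
Proof. by []. Qed.

Variable phi : R -> R.
Hypothesis phiG : growth phi.

Lemma growth_ge0 x : (0 <= phi x)%R.
Proof.
by have [x0|x0] := leP x 0%R; [rewrite (gr_le0 phiG)|rewrite ltW// (gr_gt0 phiG)].
Qed.

Lemma growth0 : phi 0 = 0%R.
Proof. exact: (gr_le0 phiG). Qed.

Lemma growth_ge1 (t x : R) : (1 <= t)%R -> (0 <= x)%R ->
  (t * phi x <= phi (t * x))%R.
Proof.
move=> t1 x0; have t0 : (0 < t)%R by exact: lt_le_trans t1.
rewrite -ler_pdivlMl//; rewrite -{1}(mulKf (lt0r_neq0 t0) x).
apply: (gr_star phiG); last by rewrite mulr_ge0// ltW.
by rewrite invr_ge0 ltW//= invf_le1.
Qed.

Lemma growth_ratio (x y : R) : (0 < x)%R -> (x <= y)%R ->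
  (phi x / x <= phi y / y)%R.
Proof.
move=> x0 xy; have y0 : (0 < y)%R by exact: lt_le_trans xy.
rewrite ler_pdivrMr// mulrAC -mulrA mulrC.
have -> : phi x = phi (x / y * y)%R by rewrite divfK// gt_eqF.
apply: (gr_star phiG); last exact: ltW.
apply/andP; split; first by rewrite divr_ge0 ?ltW.
by rewrite ler_pdivrMr// mul1r.
Qed.

Lemma ext_ge0 y : 0 <= ext phi y.
Proof. by rewrite /ext; case: ifP => // _; rewrite lee_fin growth_ge0. Qed.

Lemma le_ext (x y : \bar R) : x <= y -> ext phi x <= ext phi y.
Proof.
move: x y => [x| |] [y| |] //=; rewrite ?leey// /ext/= ?leey//.
- by rewrite !lee_fin => /(gr_nd phiG).
- by move=> _; rewrite growth0 lee_fin growth_ge0.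
Qed.

Lemma ext_scale (t : R) (y : \bar R) : (0 <= t <= 1)%R -> 0 <= y ->
  ext phi (t%:E * y) <= t%:E * ext phi y.
Proof.
move=> t01; case: y => [y| |] //.
  by rewrite !lee_fin => y0; exact: (gr_star phiG).
move=> _; move: t01 => /andP[]; rewrite le_eqVlt => /predU1P[<-|t0] _.
  by rewrite !mul0e /ext/= growth0.
by rewrite !gt0_muley// lte_fin.
Qed.

Lemma measurable_ext : measurable_fun setT (ext phi).
Proof.
apply: measurable_fun_ifT.
- apply: (@measurable_fun_bool _ _ _ _ true).
  rewrite (_ : _ @^-1` _ = [set +oo]) ?setTI//; last first.
    by apply/seteqP; split => x /=; [move/eqP|move=> ->; exact/eqP].
- exact: measurable_cst.
- apply/measurable_EFinP; apply: measurableT_comp => //.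
  exact: nondecreasing_measurable (gr_nd phiG).
Qed.

Lemma growth_unbounded (M : R) : exists2 x : R, (0 < x)%R & (M <= phi x)%R.
Proof.
pose t := (Num.max 1 (M / phi 1))%R.
have p1 : (0 < phi 1)%R by exact: (gr_gt0 phiG).
have t1 : (1 <= t)%R by rewrite /t le_max lexx.
exists t; first exact: lt_le_trans t1.
rewrite -[t]mulr1; apply: le_trans (growth_ge1 _ _) => //.
by rewrite -ler_pdivrMr// /t le_max lexx orbT.
Qed.

End growth.

Section geometric.
Context (R : realType).

(** When the weights at least double from one level to the next, the levels below
    [z] contribute no more than twice the weight of the highest of them. *)
Lemma geometric_levels (c s : nat -> R) (z : \bar R) (B : R) :
  (forall i, 0 <= c i)%R -> (forall i, 2 * c i <= c i.+1)%R -> (0 <= B)%R ->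
  (forall i, (s i)%:E < z -> (2 * c i <= B)%R) ->
  \sum_(i <oo) (if ((s i)%:E < z)%E then c i else 0%R)%:E <= B%:E.
Proof.
move=> c0 cc B0 cB.
apply: lime_le; first by apply: is_cvg_nneseries => n _ _; case: ifP; rewrite lee_fin.
apply: nearW => n; rewrite sumEFin lee_fin.
have cS m : (\sum_(0 <= i < m) c i <= c m)%R.
  elim: m => [|m IH]; first by rewrite big_geq.
  by rewrite big_nat_recr//=; have := cc m; lra.
elim: n => [|n IH]; first by rewrite big_geq.
rewrite big_nat_recr//=; case: ifPn => [/cB sz|_]; last by rewrite addr0.
have : (\sum_(0 <= i < n) (if ((s i)%:E < z)%E then c i else 0) <=
        \sum_(0 <= i < n) c i)%R by apply: ler_sum => i _; case: ifP.
by have := cS n; lra.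
Qed.

End geometric.

(** * Nested partitions, conditional averages and their maximal function *)

Section cells.
Context d (T : measurableType d) (J : countType) (q : nat -> T -> J).

(** A nested sequence of partitions is encoded by labels: [q k x] names the block
    of generation [k] containing [x]. Labels in a countable type make every union
    of blocks a countable one. *)
Definition cell k (x : T) : set T := [set y | q k y = q k x].

Definition adapted k (A : set T) := forall x y, q k x = q k y -> A x -> A y.

Definition first (P : nat -> set T) k : set T :=
  [set x | P k x /\ forall i, (i < k)%N -> ~ P i x].

Lemma first_bigcup (P : nat -> set T) :
  \bigcup_k first P k = \bigcup_k P k.
Proof.
apply/seteqP; split => x [k _ Pk]; first by exists k => //; exact: Pk.1.
have exP : exists k, `[<P k x>] by exists k; exact/asboolP.
exists (ex_minn exP) => //; case: ex_minnP => m /asboolP Pm mP; split => // i im.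
by move=> /asboolP/mP; rewrite leqNgt im.
Qed.

Lemma first_inj (P : nat -> set T) k l x : first P k x -> first P l x -> k = l.
Proof.
move=> [Pk nk] [Pl nl]; by case: (ltngtP k l) => // [/nl|/nk].
Qed.

Lemma adaptedI k A B : adapted k A -> adapted k B -> adapted k (A `&` B).
Proof. by move=> a b x y xy [/(a _ _ xy) ? /(b _ _ xy)]. Qed.

Lemma adapted_cell k x : adapted k (cell k x).
Proof. by move=> y z yz; rewrite /cell/= => <-. Qed.

End cells.

(** The last clause is outer regularity by unions of cells, which is what Lebesgue
    differentiation needs; it is asked inside one cell of generation 0 so that only
    sets of finite measure occur. *)
Record filtration d (T : measurableType d) (R : realType)
    (mu : {measure set T -> \bar R}) (J : countType) (q : nat -> T -> J)
    (v : nat -> R) (D : R) : Prop := Filtration {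
  fil_nest : forall k x y, q k.+1 x = q k.+1 y -> q k x = q k y ;
  fil_meas : forall k x, measurable (cell q k x) ;
  fil_vol : forall k x, mu (cell q k x) = (v k)%:E ;
  fil_v : forall k, (0 < v k)%R ;
  fil_doubling : forall k, (v k <= D * v k.+1)%R ;
  fil_regular : forall A x, measurable A -> A `<=` cell q 0 x ->
    forall e : R, (0 < e)%R -> exists U : set T,
      [/\ A `<=` U, mu U <= mu A + e%:E &
          forall x, U x -> exists k, cell q k x `<=` U] }.

Section filtration.
Context d (T : measurableType d) (R : realType).
Context (mu : {measure set T -> \bar R}) (J : countType) (q : nat -> T -> J).
Context (v : nat -> R) (D : R).
Hypothesis qF : filtration mu q v D.
Local Notation Q := (cell q).
Implicit Types (f g : T -> \bar R) (P : nat -> set T) (A B : set T).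

Definition cond_exp k g x : \bar R :=
  (v k)^-1%:E * \int[mu]_(y in Q k x) g y.
Local Notation E := cond_exp.

Lemma q_le k l x y : (k <= l)%N -> q l x = q l y -> q k x = q k y.
Proof.
move=> /subnK <-; elim: (l - k)%N => // m IH; rewrite addSn.
by move=> /(fil_nest qF)/IH.
Qed.

Lemma adapted_le k l A : (k <= l)%N -> adapted q k A -> adapted q l A.
Proof. by move=> kl kA x y /(q_le kl)/kA. Qed.

Lemma adapted_first P k : (forall k, adapted q k (P k)) -> adapted q k (first P k).
Proof.
move=> aP x y xy [Pk nP]; split; first exact: aP Pk.
move=> i ik Pi; apply: (nP _ ik); apply: aP Pi.
by apply: (q_le (ltnW ik)); rewrite xy.
Qed.

(** The blocks at which the rule P first applies, numbered by their generation and
   label: they partition the union of the sets P k. *)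
Let piece P i : set T :=
  [set x | exists2 k, first P k x & pickle (k, q k x) = i].

Let pieceE P i : (forall k, adapted q k (P k)) ->
  piece P i = set0 \/ exists k x, first P k x /\ piece P i = Q k x.
Proof.
move=> aP; have [|/set0P[x [k xk <-]]] := eqVneq (piece P i) set0; [by left|right].
exists k, x; split => //; apply/seteqP; split => y.
  by move=> [l yl] /(pcan_inj pickleK)[lk]; rewrite lk /cell/= => ->.
move=> yx; exists k; last by rewrite /piece /= yx.
by apply: adapted_first xk => //; rewrite yx.
Qed.

Let bigcup_piece P : \bigcup_i piece P i = \bigcup_k P k.
Proof.
rewrite -(first_bigcup P); apply/seteqP; split => x [k _].
  by move=> [l xl _]; exists l.
by move=> xk; exists (pickle (k, q k x)) => //; exists k.
Qed.

Let trivIset_piece P : trivIset setT (piece P).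
Proof.
move=> i j _ _ [x [[k xk <-] [l xl <-]]].
by rewrite (first_inj xk xl).
Qed.

Let piece_meas P : (forall k, adapted q k (P k)) ->
  forall i, measurable (piece P i).
Proof.
move=> aP i; have [->//|[k [x [_ ->]]]] := pieceE i aP.
exact: (fil_meas qF).
Qed.

Lemma measurable_bigcup_adapted P : (forall k, adapted q k (P k)) ->
  measurable (\bigcup_k P k).
Proof.
by move=> aP; rewrite -bigcup_piece; apply: bigcupT_measurable; exact: piece_meas.
Qed.

(** The blocks at which the rule [P] first applies form a countable partition of
    the union of the [P k], so inequalities between block integrals add up. *)
Lemma stopping_le P f g : (forall k, adapted q k (P k)) ->
  measurable_fun setT f -> measurable_fun setT g ->
  (forall x, 0 <= f x) -> (forall x, 0 <= g x) ->
  (forall k x, first P k x ->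
    \int[mu]_(y in Q k x) f y <= \int[mu]_(y in Q k x) g y) ->
  \int[mu]_(y in \bigcup_k P k) f y <= \int[mu]_(y in \bigcup_k P k) g y.
Proof.
move=> aP mf mg f0 g0 fg; rewrite -bigcup_piece !ge0_integral_bigcup//; last 4 first.
- exact: piece_meas.
- exact: measurable_funTS.
- exact: piece_meas.
- exact: measurable_funTS.
apply: lee_nneseries => [i _ _|i _]; first exact: integral_ge0.
have [->|[k [x [xk ->]]]] := pieceE i aP; first by rewrite !integral_set0.
exact: fg.
Qed.

Lemma adapted_measurable k A : adapted q k A -> measurable A.
Proof.
move=> kA; rewrite (_ : A = \bigcup_i (if i == k then A else set0)).
  apply: measurable_bigcup_adapted => i; case: eqP => [->//|_] x y _ [].
apply/seteqP; split => x; first by exists k => //; rewrite eqxx.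
by move=> [i _]; case: eqP.
Qed.

Lemma adapted_measurable_fun k d' (T' : measurableType d') (F : T -> T') :
  (forall x y, q k x = q k y -> F x = F y) -> measurable_fun setT F.
Proof.
move=> aF _ Y mY; rewrite setTI; apply: (@adapted_measurable k).
by move=> x y /aF; rewrite /preimage/= => ->.
Qed.

Lemma cell_refl k x : Q k x x. Proof. by []. Qed.

Lemma measurable_cell k x : measurable (Q k x).
Proof. exact: (fil_meas qF). Qed.

Lemma v_gt0 k : (0 < v k)%R. Proof. exact: (fil_v qF). Qed.

Lemma cond_exp_cell k g x y : q k x = q k y -> E k g x = E k g y.
Proof. by move=> xy; rewrite /E /cell xy. Qed.

Lemma measurable_cond_exp k g : measurable_fun setT (E k g).
Proof. by apply: (@adapted_measurable_fun k) => x y /cond_exp_cell ->. Qed.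

Lemma cond_exp_ge0 k g x : (forall x, 0 <= g x) -> 0 <= E k g x.
Proof.
move=> g0; rewrite mule_ge0 ?integral_ge0// lee_fin invr_ge0 ltW//.
exact: v_gt0.
Qed.

Lemma cond_expK k g x : (v k)%:E * E k g x = \int[mu]_(y in Q k x) g y.
Proof. by rewrite muleA -EFinM mulfV ?mul1e// gt_eqF// v_gt0. Qed.

Lemma integral_cell_cst k x (c : \bar R) :
  \int[mu]_(y in Q k x) c = c * (v k)%:E.
Proof. by rewrite integral_cst ?(fil_vol qF)//; exact: measurable_cell. Qed.

Lemma le_cond_exp k g h x :
  measurable_fun setT g -> measurable_fun setT h -> (forall x, 0 <= g x) ->
  (forall y, Q k x y -> g y <= h y) -> E k g x <= E k h x.
Proof.
move=> mg mh g0 gh; rewrite lee_wpmul2l ?lee_fin ?invr_ge0 ?(ltW (v_gt0 _))//.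
apply: ge0_le_integral => //; try exact: measurable_funTS.
exact: measurable_cell.
Qed.

Definition maximal p g x : \bar R := ereal_sup [set E k g x | k in [set k | (p <= k)%N]].
Local Notation M := maximal.

Lemma maximal_gt p g x s :
  s < M p g x <-> exists2 k, (p <= k)%N & s < E k g x.
Proof.
split; first by move=> /ereal_sup_gt[_ [k pk <-] sE]; exists k.
by move=> [k pk] /lt_le_trans; apply; apply: ereal_sup_ubound; exists k.
Qed.

Lemma cond_exp_le_maximal p k g x : (p <= k)%N -> E k g x <= M p g x.
Proof. by move=> pk; apply: ereal_sup_ubound; exists k. Qed.

Lemma measurable_maximal p g : measurable_fun setT (M p g).
Proof.
rewrite (_ : M p g = fun x => esups (fun k => E k g x) p).
  by apply: measurable_fun_esups => k; exact: measurable_cond_exp.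
by apply/funext => x; rewrite /esups /sdrop /M.
Qed.

Lemma maximal_ge0 p g x : (forall x, 0 <= g x) -> 0 <= M p g x.
Proof.
by move=> g0; rewrite (le_trans _ (cond_exp_le_maximal _ _ (leqnn p)))// cond_exp_ge0.
Qed.

Lemma maximal_le p k g x : (p <= k)%N -> M k g x <= M p g x.
Proof.
by move=> pk; apply: ereal_sup_le => _ [l kl <-]; exists l => //=; exact: leq_trans kl.
Qed.

Lemma adapted_cond_exp_gt k g s : adapted q k [set x | s < E k g x].
Proof. by move=> x y /= xy; rewrite (cond_exp_cell _ xy). Qed.

(** Stop at the first generation at which the average exceeds [s]. The set [B] is a
    union of blocks of generation [p], so the estimate is local to it. *)
Lemma maximal_weak p B g (s : R) : adapted q p B -> (0 <= s)%R ->
  measurable_fun setT g -> (forall x, 0 <= g x) ->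
  s%:E * mu (B `&` [set x | s%:E < M p g x]) <=
  \int[mu]_(x in B `&` [set x | s%:E < M p g x]) g x.
Proof.
move=> pB s0 mg g0.
pose P k := if (p <= k)%N then B `&` [set x | s%:E < E k g x] else set0.
have aP k : adapted q k (P k).
  rewrite /P; case: ifPn => [pk|_]; last by move=> x y _ [].
  by apply: adaptedI; [exact: adapted_le pB|exact: adapted_cond_exp_gt].
have -> : B `&` [set x | s%:E < M p g x] = \bigcup_k P k.
  apply/seteqP; split => [x [Bx /maximal_gt[k pk sE]]|x [k _]].
    by exists k => //; rewrite /P pk.
  rewrite /P; case: ifPn => // pk [Bx sE]; split => //.
  by apply/maximal_gt; exists k.
rewrite -integral_cst; last exact: measurable_bigcup_adapted.
apply: stopping_le => // k x [+ _]; rewrite /P; case: ifPn => // pk [Bx /= sE].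
by rewrite integral_cell_cst -cond_expK muleC lee_pmul2l// ?ltW// lte_fin v_gt0.
Qed.

End filtration.

(** * Differentiation and the truncated weak-type bound *)

Section maximal_theorem.
Context d (T : measurableType d) (R : realType).
Context (mu : {measure set T -> \bar R}) (J : countType) (q : nat -> T -> J).
Context (v : nat -> R) (D : R).
Hypothesis qF : filtration mu q v D.
Local Notation Q := (cell q).
Local Notation E := (cond_exp mu q v).
Local Notation M := (maximal mu q v).
Implicit Types (f g : T -> \bar R) (P : nat -> set T) (A B : set T).

Let mQ k x : measurable (Q k x). Proof. exact: (measurable_cell qF). Qed.
Let v0 k : (0 < v k)%R. Proof. exact: (v_gt0 qF). Qed.

Lemma cond_expD k f g x : measurable_fun setT f -> measurable_fun setT g ->
  (forall x, 0 <= f x) -> (forall x, 0 <= g x) ->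
  E k (fun y => f y + g y) x = E k f x + E k g x.
Proof.
move=> mf mg f0 g0; rewrite /cond_exp ge0_integralD//; try exact: measurable_funTS.
by rewrite ge0_muleDr// integral_ge0.
Qed.

Lemma cond_expZ k (a : R) g x : measurable_fun setT g -> (forall x, 0 <= g x) ->
  (0 <= a)%R -> E k (fun y => a%:E * g y) x = a%:E * E k g x.
Proof.
move=> mg g0 a0; rewrite /cond_exp ge0_integralZl//; last exact: measurable_funTS.
by rewrite muleCA.
Qed.

Lemma cond_exp_cst k (a : \bar R) x : E k (cst a) x = a.
Proof.
rewrite /cond_exp (integral_cell_cst qF) muleCA -EFinM mulVf ?mule1//.
by rewrite gt_eqF.
Qed.

Lemma le_maximalZ p (a : R) g x : measurable_fun setT g -> (forall x, 0 <= g x) ->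
  (0 < a)%R -> a%:E * M p g x <= M p (fun y => a%:E * g y) x.
Proof.
move=> mg g0 a0; rewrite -lee_pdivlMl//; apply: ge_ereal_sup => _ [k pk <-].
rewrite lee_pdivlMl// -cond_expZ ?(ltW a0)//; exact: cond_exp_le_maximal.
Qed.

(** The cells of an almost optimal cover of [A] by cells each meet [A], where the
    averages are at most [r]; hence [g] has mass at most [r] times the measure of
    the cover, while its mass on [A] is at least [s] times that of [A]. *)
Lemma density_null p g (r s : R) A x0 : (0 <= r)%R -> (r < s)%R ->
  measurable_fun setT g -> (forall x, 0 <= g x) ->
  measurable A -> A `<=` Q 0 x0 ->
  (forall x, A x -> M p g x <= r%:E /\ s%:E < g x) -> mu A = 0.
Proof.
move=> r0 rs mg g0 mA AQ Ag.
have s0 : (0 <= s)%R by exact: le_trans (ltW rs).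
have Afin : mu A \is a fin_num.
  rewrite ge0_fin_numE//; apply: (@le_lt_trans _ _ (mu (Q 0 x0))).
    by apply: le_measure; rewrite ?inE.
  by rewrite (fil_vol qF) ltry.
suff H e : (0 < e)%R -> s%:E * mu A <= r%:E * (mu A + e%:E).
  rewrite -(fineK Afin); congr EFin; apply/eqP; rewrite eq_le fine_ge0// andbT.
  rewrite leNgt; apply/negP => A0.
  (* Were A of positive measure, this e would violate the estimate (s - r) * mu A <= r * e. *)
  have e0 : (0 < (s - r) * fine (mu A) / (2 * (r + 1)))%R.
    by rewrite divr_gt0 ?mulr_gt0 ?subr_gt0//; lra.
  have := H _ e0; rewrite -(fineK Afin) -!EFinM lee_fin => H'.
  have : (r * ((s - r) * fine (mu A) / (2 * (r + 1))) <
          (s - r) * fine (mu A))%R.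
    rewrite mulrA ltr_pdivrMr; last lra.
    by rewrite mulrC ltr_pM2l ?mulr_gt0 ?subr_gt0//; lra.
  lra.
move=> e0; have [U [AU UA opU]] := fil_regular qF mA AQ e0.
(* C k is the union of the cells of generation k inside U, and P k that of those among
   them that meet A. *)
pose C k := [set x | Q k x `<=` U].
have aC k : adapted q k (C k).
  by move=> x y xy; rewrite /C/= /cell xy.
have UE : U = \bigcup_k C k.
  apply/seteqP; split => [x /opU[k kU]|x [k _]]; first by exists k.
  by apply; exact: cell_refl.
have mU : measurable U by rewrite UE; exact: (measurable_bigcup_adapted qF).
pose P k := if (p <= k)%N then C k `&` [set x | Q k x `&` A !=set0] else set0.
have aP k : adapted q k (P k).
  rewrite /P; case: ifPn => [pk|_]; last by move=> x y _ [].
  by apply: adaptedI => // x y xy; rewrite /= /cell xy.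
have mP : measurable (\bigcup_k P k) by exact: (measurable_bigcup_adapted qF).
have PU : \bigcup_k P k `<=` U.
  by rewrite UE => x [k _]; rewrite /P; case: ifPn => // _ [? _]; exists k.
have AP : A `<=` \bigcup_k P k.
  move=> x Ax; have [k kU] := opU _ (AU _ Ax); exists (maxn p k) => //.
  rewrite /P leq_maxl; split; last by exists x.
  by move=> y /(q_le qF (leq_maxr p k)) /kU.
apply: (@le_trans _ _ (\int[mu]_(x in \bigcup_k P k) (s%:E * (\1_A x)%:E))).
  rewrite ge0_integralZl ?lee_fin//; last exact/measurable_EFinP.
  by rewrite integral_indic// setIidl.
apply: (@le_trans _ _ (\int[mu]_(x in \bigcup_k P k) r%:E)); last first.
  rewrite integral_cst//; apply: lee_wpmul2l; first by rewrite lee_fin.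
  by apply: le_trans UA; apply: le_measure; rewrite ?inE.
apply: (stopping_le qF) => //.
- apply: measurable_funeM; exact/measurable_EFinP.
- by move=> x; rewrite mule_ge0 ?lee_fin.
move=> k x [+ _]; rewrite /P; case: ifPn => // pk [_ [y [/= yx Ay]]].
apply: (@le_trans _ _ (\int[mu]_(y in Q k x) g y)).
  apply: ge0_le_integral => //.
  - by move=> z _; rewrite mule_ge0 ?lee_fin.
  - by apply: measurable_funTS; apply: measurable_funeM; exact/measurable_EFinP.
  - exact: measurable_funTS.
  - move=> z _; rewrite indicE; case: (boolP (z \in A)) => [/set_mem zA|_].
      by rewrite mule1 ltW// (Ag _ zA).2.
    by rewrite mule0.
rewrite -(cond_expK qF) -(cond_exp_cell mu v g yx) (integral_cell_cst qF) muleC.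
apply: lee_wpmul2r; first by rewrite lee_fin ltW.
by apply: le_trans (Ag _ Ay).1; exact: cond_exp_le_maximal.
Qed.

(** The exceptional set is a countable union, over rational numbers [r < s] and
    blocks of generation [p], of the sets on which [M p g <= r < s < g]. *)
Lemma le_maximal_ae p g : measurable_fun setT g -> (forall x, 0 <= g x) ->
  {ae mu, forall x, g x <= M p g x}.
Proof.
move=> mg g0.
have mM : measurable_fun setT (M p g) by exact: (measurable_maximal qF).
pose N (t : rat * rat * J) : set T :=
  [set x | q p x = t.2 /\
    (M p g x <= (ratr t.1.1)%:E /\ (ratr t.1.2)%:E < g x)].
have NE t x0 : N t x0 -> N t = Q p x0 `&` ([set x | M p g x <= (ratr t.1.1)%:E] `&`
                             [set x | (ratr t.1.2)%:E < g x]).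
  by move=> [x0t _]; rewrite /N -x0t.
have mN t : measurable (N t).
  have [->//|/set0P[x0 /NE ->]] := eqVneq (N t) set0.
  apply: measurableI => //; apply: measurableI.
    by rewrite -[X in measurable X]setTI; exact: emeasurable_fun_infty_c.
  by rewrite -[X in measurable X]setTI; exact: emeasurable_fun_o_infty.
have N0 t : (t.1.1 < t.1.2)%R -> mu (N t) = 0.
  move=> rs; have [->|/set0P[x0 tx0]] := eqVneq (N t) set0; first exact: measure0.
  have r0 : (0 <= ratr t.1.1 :> R)%R.
    by rewrite -lee_fin; apply: le_trans tx0.2.1; exact: (maximal_ge0 qF).
  apply: (@density_null p g (ratr t.1.1) (ratr t.1.2) _ x0) => //.
  - by rewrite ltr_rat.
  - by rewrite (NE _ _ tx0) => y [/(q_le qF (leq0n p))].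
  - by move=> x [].
pose F (n : nat) := if (unpickle n : option (rat * rat * J)) is Some t then
   (if (t.1.1 < t.1.2)%R then N t else set0) else set0.
suff : mu.-negligible (\bigcup_n F n).
  apply: negligibleS => x /= /negP; rewrite -ltNge => Mg.
  have Mfin : M p g x \is a fin_num.
    by rewrite ge0_fin_numE ?(maximal_ge0 qF)// (lt_le_trans Mg)// leey.
  have [s] : exists s : R, M p g x < s%:E /\ s%:E < g x.
    move: Mg; rewrite -(fineK Mfin); case: (g x) => [y| |]//.
      rewrite lte_fin => yM; exists ((fine (M p g x) + y) / 2)%R.
      by rewrite !lte_fin; split; lra.
    by move=> _; exists (fine (M p g x) + 1)%R; rewrite ltry lte_fin; split => //; lra.
  rewrite -(fineK Mfin) lte_fin => -[Ms sg].
  have [s1] := rat_in_itvoo Ms; rewrite in_itv/= => /andP[Ms1 s1s].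
  have [r] := rat_in_itvoo Ms1; rewrite in_itv/= => /andP[Mr rs1].
  have [n nE] : exists n, unpickle n = Some (r, s1, q p x).
    by exists (pickle (r, s1, q p x)); exact: pickleK.
  exists n; first exact: I.
  rewrite /F nE /= -(ltr_rat R) rs1 /N /=; split => //; split.
    by rewrite -(fineK Mfin) lee_fin ltW.
  by apply: lt_trans sg; rewrite lte_fin.
apply: negligible_bigcup => n; rewrite /F; case: unpickle => [t|]; last exact: negligible_set0.
case: ifPn => [rs|_]; last exact: negligible_set0.
by apply/negligibleP; [exact: mN|exact: N0].
Qed.

(** The part of [g] below [s / 2] has averages at most [s / 2], so the weak-type
    bound may be applied to the part above. *)
Lemma maximal_weak_trunc p g (s : R) : (0 < s)%R ->
  measurable_fun setT g -> (forall x, 0 <= g x) ->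
  mu [set x | s%:E < M p g x] <=
  \int[mu]_x ((if (s%:E < 2%:E * g x)%E then s^-1 else 0%R)%:E * (2%:E * g x)).
Proof.
move=> s0 mg g0; pose h x := if s%:E < 2%:E * g x then 2%:E * g x else 0.
have mg2 : measurable_fun setT (fun x => 2%:E * g x) by exact: measurable_funeM.
have mb : measurable_fun setT (fun x => s%:E < 2%:E * g x).
  apply: (@measurable_fun_bool _ _ _ _ true).
  rewrite (_ : _ @^-1` _ = [set x | s%:E < 2%:E * g x])//.
  exact: emeasurable_fun_o_infty.
have mh : measurable_fun setT h by apply: measurable_fun_ifT.
have h0 x : 0 <= h x by rewrite /h; case: ifPn => // _; rewrite mule_ge0.
have sub : [set x | s%:E < M p g x] `<=` [set x | s%:E < M p h x].
  move=> x /= /maximal_gt[k pk sE]; apply/maximal_gt; exists k => //.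
  have : E k (fun y => 2%:E * g y) x <= E k (fun y => h y + cst s%:E y) x.
    apply: (le_cond_exp qF) => //.
    - exact: emeasurable_funD.
    - by move=> y; rewrite mule_ge0.
    - move=> y _; rewrite /h; case: ifPn => /= [_|]; last by rewrite -leNgt add0e.
      by rewrite leeDl// lee_fin ltW.
  rewrite cond_expZ// cond_expD//; last by move=> y; rewrite lee_fin ltW.
  rewrite cond_exp_cst => H.
  have : 2%:E * s%:E < E k h x + s%:E.
    by apply: lt_le_trans H; rewrite lte_pmul2l.
  case: (E k h x) => [y| |]; [|move=> _; exact: ltry|by rewrite addNye ltNge leNye].
  by rewrite -EFinM -EFinD !lte_fin; lra.
have mMh : measurable [set x | s%:E < M p h x].
  rewrite -[X in measurable X]setTI; apply: emeasurable_fun_o_infty => //.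
  exact: (measurable_maximal qF).
apply: (@le_trans _ _ (mu [set x | s%:E < M p h x])).
  apply: le_measure; rewrite ?inE// -[X in measurable X]setTI.
  by apply: emeasurable_fun_o_infty => //; exact: (measurable_maximal qF).
have := @maximal_weak _ _ _ _ _ _ _ _ qF p setT h s (fun x y _ => id) (ltW s0) mh h0.
rewrite !setTI => W.
rewrite (_ : (fun x => _) = (fun x => (s^-1)%:E * h x)); last first.
  by apply/funext => x; rewrite /h; case: ifPn; rewrite ?mul0e ?mule0.
rewrite ge0_integralZl//; last by rewrite lee_fin invr_ge0 ltW.
rewrite lee_pdivlMl//; apply: le_trans W _.
exact: ge0_subset_integral.
Qed.

End maximal_theorem.

(** * The maximal function in modular form *)

Lemma le_nneseries_term (R : realType) (u : nat -> \bar R) i :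
  (forall k, 0 <= u k) -> u i <= \sum_(k <oo) u k.
Proof.
move=> u0; apply: le_trans (nneseries_lim_ge i.+1 _) => //.
by rewrite big_mkord big_ord_recr/= leeDr// sume_ge0.
Qed.

Lemma geometric_unbounded (R : realType) (a A x : R) :
  (0 < a)%R -> (2 <= A)%R -> exists i, (x <= a * A ^+ i)%R.
Proof.
move=> a0 A2; exists (Num.bound (x / a)).
rewrite mulrC -ler_pdivrMr//; apply: le_trans (ltW (upper_nthrootP (leqnn _))) _.
by rewrite lerXn2r ?nnegrE//; lra.
Qed.

Lemma geometric_level (R : realType) (a A y : R) :
  (0 < a)%R -> (2 <= A)%R -> (a < y)%R ->
  exists i, (a * A ^+ i < y <= a * A ^+ i.+1)%R.
Proof.
move=> a0 A2 ay; have exn := geometric_unbounded y a0 A2.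
case: (ex_minnP exn) => -[|m] ym mmin.
  by move: ym; rewrite expr0 mulr1 leNgt ay.
by exists m; rewrite ym ltNge andbT; apply/negP => /mmin; rewrite ltnn.
Qed.

Lemma arithmetic_level (R : realType) (a y : R) : (0 < a)%R -> (0 < y)%R ->
  exists j : nat, (j%:R * a < y <= j.+1%:R * a)%R.
Proof.
move=> a0 y0; have exn : exists n : nat, (y <= n%:R * a)%R.
  exists (Num.bound (y / a)); rewrite -ler_pdivrMr//.
  by apply: ltW; apply: archi_boundP; rewrite divr_ge0 ?ltW.
case: (ex_minnP exn) => -[|m] ym mmin; first by move: ym; rewrite mul0r leNgt y0.
by exists m; rewrite ym ltNge andbT; apply/negP => /mmin; rewrite ltnn.
Qed.

Lemma measurable_fun_above d (T : measurableType d) (R : realType)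
    (F : T -> \bar R) (s c : R) : measurable_fun setT F ->
  measurable_fun setT (fun x => (if (s%:E < F x)%E then c else 0%R)%:E).
Proof.
move=> mF; apply/measurable_EFinP; apply: measurable_fun_ifT => //.
apply: (@measurable_fun_bool _ _ _ _ true).
rewrite (_ : _ @^-1` _ = [set x | s%:E < F x])//.
exact: emeasurable_fun_o_infty.
Qed.

(** The sets [1 / n.+1 < h] exhaust the set where [h] is positive. This reduces a
    bound to points where [h] exceeds some [a > 0], from which geometric levels can
    be started. *)
Lemma integral_positive_part d (T : measurableType d) (R : realType)
    (mu : {measure set T -> \bar R}) (h F : T -> \bar R) (K : \bar R) :
  measurable_fun setT h -> measurable_fun setT F -> (forall x, 0 <= F x) ->
  (forall x, h x <= 0 -> F x = 0) ->
  (forall a : R, (0 < a)%R -> \int[mu]_(x in [set x | a%:E < h x]) F x <= K) ->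
  \int[mu]_x F x <= K.
Proof.
move=> mh mF F0 hF HK.
pose S (n : nat) := [set x | (n.+1%:R^-1)%:E < h x].
have mS n : measurable (S n).
  by rewrite /S -[X in measurable X]setTI; exact: emeasurable_fun_o_infty.
have SE : \bigcup_n S n = [set x | 0 < h x].
  apply/seteqP; split => x /=.
    by move=> [n _]; apply: lt_trans; rewrite lte_fin invr_gt0.
  move=> hx; suff [n nh] : exists n : nat, (n.+1%:R^-1)%:E < h x by exists n.
  case: (h x) hx => [r|_|//]; last by exists 0%N; exact: ltry.
  rewrite lte_fin => r0; exists (Num.bound r^-1).
  rewrite lte_fin invf_plt ?posrE//.
  apply: lt_trans (archi_boundP _) _; first by rewrite invr_ge0 ltW.
  by rewrite ltr_nat.
have -> : \int[mu]_x F x = \int[mu]_(x in \bigcup_n S n) F x.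
  rewrite [RHS]integral_mkcond SE; apply: eq_integral => x _.
  rewrite patchE; case: ifPn => // /negP hx; apply: hF.
  by rewrite leNgt; apply/negP => h0; apply: hx; exact: mem_set.
have ndS : nondecreasing_seq S.
  apply/nondecreasing_seqP => n; rewrite subsetEset => x; rewrite /S/=.
  by apply: le_lt_trans; rewrite lee_fin lef_pV2 ?posrE// ler_nat.
have C := @ge0_nondecreasing_set_cvg_integral _ _ _ S F mu ndS mS
  (fun i => measurable_funTS mF) (fun i x _ => F0 x).
apply: (closed_cvg (fun y => y <= K)) C => //; first exact: closed_ereal_ge_ereal.
by apply: nearW => n; apply: HK; rewrite invr_gt0.
Qed.

Section modular.
Context d (T : measurableType d) (R : realType).
Context (mu : {measure set T -> \bar R}) (J : countType) (q : nat -> T -> J).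
Context (v : nat -> R) (D : R).
Hypothesis qF : filtration mu q v D.
Local Notation Q := (cell q).
Local Notation E := (cond_exp mu q v).
Local Notation M := (maximal mu q v).
Implicit Types (f g : T -> \bar R) (P : nat -> set T) (A B : set T).

Section levels.
Variables (phi : R -> R) (A a : R).
Hypotheses (phiG : growth phi) (A2 : (2 <= A)%R) (a0 : (0 < a)%R).
Hypothesis phiA : forall r : R, (0 <= r)%R -> (2 * A * phi r <= phi (A * r))%R.

Let s i := (a * A ^+ i)%R.
Let s0 i : (0 < s i)%R. Proof. by rewrite mulr_gt0// exprn_gt0// (lt_le_trans _ A2). Qed.
Let sS i : s i.+1 = (A * s i)%R. Proof. by rewrite /s exprS mulrCA. Qed.

(** The level next above y already carries the value phi y. *)
Lemma le_sum_levels (y : \bar R) : a%:E < y ->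
  ext phi y <= \sum_(i <oo) (if ((s i)%:E < y)%E then phi (s i.+1) else 0%R)%:E.
Proof.
move=> ay.
have term i : (s i)%:E < y -> (phi (s i.+1))%:E <=
    \sum_(i <oo) (if ((s i)%:E < y)%E then phi (s i.+1) else 0%R)%:E.
  move=> iy; apply: le_trans (@le_nneseries_term _ _ i _); first by rewrite iy.
  by move=> k; case: ifP; rewrite lee_fin// (growth_ge0 phiG).
case: y ay term => [y ay term|_ term|//].
  move: ay; rewrite lte_fin => ay.
  have [m /andP[sy ys]] := geometric_level a0 A2 ay.
  apply: le_trans (term m _); last by rewrite lte_fin.
  by rewrite lee_fin (gr_nd phiG).
rewrite ext_pinfty; set S := \sum_(i <oo) _ in term *.
have S0 : 0 <= S.
  by apply: nneseries_ge0 => k _ _; case: ifP; rewrite lee_fin// (growth_ge0 phiG).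
rewrite leye_eq; apply/eqP; case: S S0 term => [r| |]// r0 term.
have [x x0 xr] := growth_unbounded phiG (r + 1).
have [n xn] := geometric_unbounded x a0 A2.
have := term n (ltry _); rewrite lee_fin.
have : (phi x <= phi (s n.+1))%R.
  apply: (gr_nd phiG); apply: (le_trans xn); rewrite sS.
  by rewrite ler_peMl// ?(ltW (s0 _))// (le_trans _ A2)// ler1n.
by move=> {r0 term} ? ?; exfalso; lra.
Qed.

(** The hypothesis [phiA] makes the weights [phi (s i.+1) / s i] at least double with
    [i], so their sum over the levels below [2 * y] is comparable with the last one. *)
Lemma sum_levels_le (y : \bar R) : 0 <= y ->
  \sum_(i <oo) (if ((s i)%:E < 2%:E * y)%E then phi (s i.+1) / s i else 0%R)%:E
     * (2%:E * y) <= 2%:E * ext phi ((2 * A)%:E * y).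
Proof.
case: y => [y|_|//]; last first.
  rewrite [X in ext _ X]gt0_muley ?ext_pinfty.
    by rewrite [leRHS]gt0_muley ?leey.
  by rewrite lte_fin mulr_gt0// (lt_le_trans _ A2).
rewrite lee_fin -EFinM => y0; set z := (2 * y)%R.
have z0 : (0 <= z)%R by rewrite /z; lra.
move: z0; rewrite le_eqVlt => /predU1P[<-|z0].
  rewrite eseries0; last by move=> i _ _; rewrite mule0.
  by rewrite mule_ge0// (ext_ge0 phiG).
under eq_eseriesr do rewrite muleC.
rewrite nneseriesZl; last first.
  by move=> i _; case: ifP; rewrite lee_fin// divr_ge0 ?(growth_ge0 phiG)// ltW.
have -> : (2 * A)%:E * y%:E = (A * z)%:E by rewrite -EFinM /z; congr EFin; ring.
rewrite ext_EFin -lee_pdivlMl//.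
rewrite -!EFinM; apply: geometric_levels.
- by move=> i; rewrite divr_ge0 ?(growth_ge0 phiG)// ltW.
- move=> i; rewrite ler_pdivlMr// (sS i.+1).
  apply: le_trans (phiA (ltW (s0 i.+1))).
  set p := phi _; rewrite le_eqVlt sS; apply/orP; left; apply/eqP.
  by field; rewrite gt_eqF.
- by rewrite mulr_ge0 ?invr_ge0 ?mulr_ge0 ?(growth_ge0 phiG)// ltW.
- move=> i; rewrite lte_fin => sz.
  have A0 : (0 < A)%R by rewrite (lt_le_trans _ A2).
  have : (A * (phi (A * s i) / (A * s i)) <= A * (phi (A * z) / (A * z)))%R.
    rewrite ler_pM2l//; apply: growth_ratio => //; first by rewrite mulr_gt0.
    by rewrite ler_pM2l// ltW.
  have key (y1 x1 : R) : (x1 != 0)%R -> (A * (y1 / (A * x1)) = y1 / x1)%R.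
    by move=> x10; field; rewrite x10 gt_eqF.
  rewrite !key ?gt_eqF// -sS => H.
  by rewrite [leRHS]mulrCA ler_pM2l// [leRHS]mulrC.
Qed.

End levels.

(** Marcinkiewicz interpolation between the weak-type bound and boundedness: cut
    [M p g] at the levels [a * A ^+ i] and use at each of them the weak-type bound
    that only sees the part of [g] above half the level. *)
Theorem maximal_modular (phi : R -> R) (A : R) p g :
  growth phi -> (2 <= A)%R ->
  (forall r : R, (0 <= r)%R -> (2 * A * phi r <= phi (A * r))%R) ->
  measurable_fun setT g -> (forall x, 0 <= g x) ->
  \int[mu]_x ext phi (M p g x) <= 2%:E * \int[mu]_x ext phi ((2 * A)%:E * g x).
Proof.
move=> phiG A2 phiA mg g0.
have mM : measurable_fun setT (M p g) by exact: (measurable_maximal qF).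
have mphiM : measurable_fun setT (fun x => ext phi (M p g x)).
  by apply: (measurableT_comp (measurable_ext phiG)).
apply: (integral_positive_part (h := M p g)) => //.
- by move=> x; exact: (ext_ge0 phiG).
- move=> x M0; rewrite (_ : M p g x = 0) ?ext_EFin ?(growth0 phiG)//.
  by apply/eqP; rewrite eq_le M0 (maximal_ge0 qF).
move=> a a0; pose s i := (a * A ^+ i)%R.
have s0 i : (0 < s i)%R by rewrite mulr_gt0// exprn_gt0// (lt_le_trans _ A2).
have mMs i : measurable [set x | (s i)%:E < M p g x].
  by rewrite -[X in measurable X]setTI; exact: emeasurable_fun_o_infty.
have m2g : measurable_fun setT (fun x => 2%:E * g x) by exact: measurable_funeM.
have mif (F : T -> \bar R) i c := @measurable_fun_above _ T R F (s i) c.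
pose L x := \sum_(i <oo) (if ((s i)%:E < M p g x)%E then phi (s i.+1) else 0%R)%:E.
have L0 i x : 0 <= (if ((s i)%:E < M p g x)%E then phi (s i.+1) else 0%R)%:E.
  by case: ifP; rewrite lee_fin// (growth_ge0 phiG).
have mL : measurable_fun setT L.
  by apply: ge0_emeasurable_sum => // i _; exact: mif.
apply: (@le_trans _ _ (\int[mu]_x L x)).
  apply: (@le_trans _ _ (\int[mu]_(x in [set x | a%:E < M p g x]) L x)).
    apply: ge0_le_integral => //.
    + have := mMs 0%N; rewrite /s expr0 mulr1; exact.
    + by move=> x _; exact: (ext_ge0 phiG).
    + exact: measurable_funTS.
    + exact: measurable_funTS.
    + by move=> x; exact: le_sum_levels.
  apply: ge0_subset_integral => //.
    by have := mMs 0%N; rewrite /s expr0 mulr1; exact.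
  by move=> x _; exact: nneseries_ge0.
rewrite /L integral_nneseries//; last by move=> i; exact: mif.
pose G i x := (if ((s i)%:E < 2%:E * g x)%E then phi (s i.+1) / s i else 0%R)%:E * (2%:E * g x).
have G0 i x : 0 <= G i x.
  by rewrite /G mule_ge0 ?mule_ge0//; case: ifP; rewrite lee_fin// divr_ge0 ?(growth_ge0 phiG) ?ltW.
have mG i : measurable_fun setT (G i).
  by apply: emeasurable_funM => //; exact: mif.
apply: (@le_trans _ _ (\sum_(i <oo) \int[mu]_x G i x)).
  apply: lee_nneseries => [i _ _|i _]; first by apply: integral_ge0.
  have -> : \int[mu]_x (if ((s i)%:E < M p g x)%E then phi (s i.+1) else 0%R)%:E =
      (phi (s i.+1))%:E * mu [set x | (s i)%:E < M p g x].
    rewrite -[in RHS]integral_cst// [RHS]integral_mkcond.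
    apply: eq_integral => x _; rewrite patchE; case: ifPn => sM.
      by rewrite mem_set.
    by rewrite memNset//; exact/negP.
  have := maximal_weak_trunc qF p (s0 i) mg g0.
  move=> /(lee_wpmul2l (_ : 0 <= (phi (s i.+1))%:E)) W.
  apply: (le_trans (W _)); first by rewrite lee_fin (growth_ge0 phiG).
  rewrite -ge0_integralZl//.
  - apply: ge0_le_integral => //.
    + move=> x _; rewrite mule_ge0 ?lee_fin ?(growth_ge0 phiG)// mule_ge0 ?mule_ge0//.
      by case: ifP; rewrite lee_fin// invr_ge0 ltW.
    + by apply: measurable_funeM; apply: emeasurable_funM => //; exact: mif.
    + move=> x _; rewrite /G muleA -EFinM; case: ifP => // _.
      by rewrite mulr0.
  - by apply: emeasurable_funM => //; exact: mif.
  - by move=> x _; rewrite mule_ge0 ?mule_ge0//; case: ifP; rewrite lee_fin// invr_ge0 ltW.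
  - by rewrite lee_fin (growth_ge0 phiG).
rewrite -integral_nneseries//.
have mphig : measurable_fun setT (fun x => ext phi ((2 * A)%:E * g x)).
  by apply: (measurableT_comp (measurable_ext phiG)); exact: measurable_funeM.
rewrite -ge0_integralZl//; last by move=> x _; exact: (ext_ge0 phiG).
apply: ge0_le_integral => //.
- by move=> x _; exact: nneseries_ge0.
- by apply: ge0_emeasurable_sum.
- exact: measurable_funeM.
- by move=> x _; exact: sum_levels_le.
Qed.

End modular.

(** * Oscillation and exponential integrability *)

Lemma measurable_normB d (T : measurableType d) (R : realType) (u : R) (b : T -> R) :
  measurable_fun setT b -> measurable_fun setT (fun y => `|u - b y|%R).
Proof. by move=> mb; apply: measurableT_comp => //; exact: measurable_funB. Qed.
Lemma measurable_dist d (T : measurableType d) (R : realType) (b : T -> R) (c : R) :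
  measurable_fun setT b -> measurable_fun setT (fun y => `|(b y - c)%R|%:E).
Proof.
move=> mb; apply/measurable_EFinP; apply: measurableT_comp => //.
exact: measurable_funB.
Qed.

Section oscillation.
Context d (T : measurableType d) (R : realType).
Context (mu : {measure set T -> \bar R}) (J : countType) (q : nat -> T -> J).
Context (v : nat -> R) (D : R).
Hypothesis qF : filtration mu q v D.
Local Notation Q := (cell q).
Local Notation E := (cond_exp mu q v).
Local Notation M := (maximal mu q v).
Implicit Types (f g : T -> \bar R) (P : nat -> set T) (A B : set T).

Variable b : T -> R.

Definition cell_avg k x : R := ((v k)^-1 * \int[mu]_(y in Q k x) b y)%R.
Local Notation bavg := cell_avg.

Definition cell_osc k y : \bar R := `|(b y - bavg k y)%R|%:E.
Local Notation osc := cell_osc.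

Hypothesis mb : measurable_fun setT b.
Hypothesis ib : forall k x, mu.-integrable (Q k x) (EFin \o b).

Let mQ k x : measurable (Q k x). Proof. exact: (measurable_cell qF). Qed.
Let v0 k : (0 < v k)%R. Proof. exact: (v_gt0 qF). Qed.

Lemma cell_avg_cell k x y : q k x = q k y -> bavg k x = bavg k y.
Proof. by move=> xy; rewrite /bavg /cell xy. Qed.

Lemma osc_ge0 k y : 0 <= osc k y. Proof. by rewrite lee_fin. Qed.

Lemma measurable_osc k : measurable_fun setT (osc k).
Proof.
apply/measurable_EFinP; apply: measurableT_comp => //.
apply: measurable_funB => //; apply: (adapted_measurable_fun qF (k := k)).
by move=> x y /cell_avg_cell.
Qed.

Lemma measurable_max_osc p k : measurable_fun setT (M p (osc k)).
Proof. exact: (measurable_maximal qF). Qed.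

Lemma measurable_cell_max_osc p k x (s : R) :
  measurable (Q p x `&` [set y | s%:E < M p (osc k) y]).
Proof.
apply: measurableI => //; rewrite -[X in measurable X]setTI.
by apply: emeasurable_fun_o_infty => //; exact: measurable_max_osc.
Qed.

Lemma cell_avg_cst_dist k x (c : R) :
  `|(bavg k x - c)%R|%:E <= E k (fun y => `|(b y - c)%R|%:E) x.
Proof.
have ic : mu.-integrable (Q k x) (EFin \o cst c).
  apply/integrableP; split; first exact/measurable_EFinP.
  by rewrite (eq_integral (cst `|c|%:E))// (integral_cell_cst qF) -EFinM ltry.
have ibc : mu.-integrable (Q k x) (EFin \o (fun y => b y - c)%R).
  by rewrite (_ : _ \o _ = (EFin \o b) \- (EFin \o cst c)) //; exact: integrableB.
have -> : (bavg k x - c = (v k)^-1 * \int[mu]_(y in Q k x) (b y - c))%R.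
  rewrite (RintegralB (f2 := cst c))// Rintegral_cst// (fil_vol qF)/= mulrBr.
  by congr (_ - _)%R; rewrite mulrC -mulrA mulfV ?mulr1// gt_eqF.
rewrite normrM gtr0_norm ?invr_gt0// EFinM lee_wpmul2l ?lee_fin ?invr_ge0 ?(ltW (v0 _))//.
apply: (@le_trans _ _ (\int[mu]_(y in Q k x) `|(b y - c)%R|)%:E).
  by rewrite lee_fin; apply: le_normr_Rintegral.
by rewrite /Rintegral fineK//; apply: integrable_fin_num => //; exact: (integrable_abse ibc).
Qed.

Lemma cell_avg_dist p k x : (p <= k)%N ->
  `|(bavg k x - bavg p x)%R|%:E <= E k (osc p) x.
Proof.
move=> pk; apply: le_trans (cell_avg_cst_dist k x (bavg p x)) _.
rewrite le_eqVlt; apply/orP; left; apply/eqP; rewrite /cond_exp; congr (_ * _).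
apply: eq_integral => y /set_mem yx; rewrite /cell_osc.
by rewrite (cell_avg_cell (q_le qF pk yx)).
Qed.

(** The mean oscillation is a seminorm of [b] that a constant does not affect, and the
    mean is within the mean distance of any constant. This allows the mean over a
    ball to be used for a cell inside it. *)
Lemma cond_exp_osc_le k x (c : R) :
  E k (osc k) x <= 2%:E * E k (fun y => `|(b y - c)%R|%:E) x.
Proof.
set h := fun y => `|(b y - c)%R|%:E.
have mh : measurable_fun setT h.
  exact: measurable_dist.
have h0 y : 0 <= h y by rewrite lee_fin.
have -> : 2%:E * E k h x = E k h x + E k h x.
  by rewrite (_ : 2%:E = 1 + 1)// ge0_muleDl// mul1e.
apply: (@le_trans _ _ (E k h x + `|(bavg k x - c)%R|%:E)); last first.
  exact: leeD2l (cell_avg_cst_dist k x c).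
set s := `|_|%:E; have s0 : 0 <= s by rewrite lee_fin.
rewrite -(cond_exp_cst qF k s x) -(cond_expD qF)//.
apply: (le_cond_exp qF).
- exact: measurable_osc.
- exact: emeasurable_funD.
- by move=> y; exact: osc_ge0.
move=> y yx; rewrite /cell_osc /h /s/= -EFinD lee_fin (cell_avg_cell yx).
have -> : (b y - bavg k x = (b y - c) - (bavg k x - c))%R by ring.
exact: ler_normB.
Qed.

Lemma cond_exp_osc p k i x : (p <= k)%N -> (k <= i)%N ->
  E i (osc p) x <= E i (osc k) x + `|(bavg k x - bavg p x)%R|%:E.
Proof.
move=> pk ki; set c := `|_|%:E.
rewrite -(cond_exp_cst qF i c x).
rewrite -(cond_expD qF); last 4 first.
- exact: measurable_osc.
- exact: measurable_cst.
- by move=> y; exact: osc_ge0.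
- by move=> y; rewrite lee_fin.
apply: (le_cond_exp qF).
- exact: measurable_osc.
- by apply: emeasurable_funD => //; exact: measurable_osc.
- by move=> y; exact: osc_ge0.
move=> y yx; rewrite /cell_osc /c/= -EFinD lee_fin.
have kyx : q k y = q k x by apply: (q_le qF ki); rewrite yx.
rewrite (cell_avg_cell kyx) (cell_avg_cell (q_le qF pk kyx)).
have -> : (b y - bavg p x = (b y - bavg k x) + (bavg k x - bavg p x))%R by ring.
exact: ler_normD.
Qed.

Variable beta : R.
Hypothesis beta0 : (0 < beta)%R.
Hypothesis bmo : forall k x, E k (osc k) x <= beta%:E.

Let D0 : (0 < D)%R.
Proof.
have := lt_le_trans (v0 0) (fil_doubling qF 0).
by rewrite pmulr_lgt0.
Qed.

(** Passing to the next generation multiplies means by at most the doubling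
    constant [D]. *)
Lemma cell_avg_distS k x : (`|bavg k.+1 x - bavg k x| <= D * beta)%R.
Proof.
rewrite -lee_fin; apply: le_trans (cell_avg_dist _ (leqnSn k)) _.
apply: (@le_trans _ _ (D%:E * E k (osc k) x)); last first.
  by rewrite EFinM lee_wpmul2l// lee_fin ltW.
rewrite /cond_exp muleA -EFinM.
apply: (@le_trans _ _ ((D / v k)%:E * \int[mu]_(y in Q k.+1 x) osc k y)).
  apply: lee_wpmul2r; first by apply: integral_ge0 => y _; exact: osc_ge0.
  rewrite lee_fin ler_pdivlMr// mulrC ler_pdivrMr//.
  exact: (fil_doubling qF).
apply: lee_wpmul2l.
  by rewrite lee_fin divr_ge0 ?(ltW (v0 _))// ltW.
apply: ge0_subset_integral => //.
- by apply: measurable_funTS; exact: measurable_osc.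
- by move=> y _; exact: osc_ge0.
- by move=> y /(q_le qF (leqnSn k)).
Qed.

Variables (L : R).
Hypothesis L2 : (2 <= L)%R.

(** The step [D * beta] absorbs the jump of the average of [b] in one generation, and
    [L * beta] is the height at which the weak-type bound leaves a fraction [1 / L]
    of the cell. *)
Definition osc_step : R := ((D + L) * beta)%R.
Local Notation lam := osc_step.

Lemma osc_step_gt0 : (0 < lam)%R.
Proof. by rewrite mulr_gt0// addr_gt0// (lt_le_trans _ L2). Qed.
Local Notation lam0 := osc_step_gt0.

Let level p (j : nat) := [set x | (j%:R * lam)%:E < M p (osc p) x].

Let mlevel p j : measurable (level p j).
Proof.
rewrite -[X in measurable X]setTI; apply: emeasurable_fun_o_infty => //.
exact: measurable_max_osc.
Qed.

Let levelS p i j : (i <= j)%N -> level p j `<=` level p i.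
Proof.
move=> ij x; apply: le_lt_trans.
by rewrite lee_fin ler_pM2r ?lam0// ler_nat.
Qed.

Let stop p B j k :=
  if (p <= k)%N then B `&` [set x | (j%:R * lam)%:E < E k (osc p) x] else set0.

Let stopE p B j : \bigcup_k stop p B j k = B `&` level p j.
Proof.
apply/seteqP; split => [x [k _]|x [Bx /maximal_gt[k pk sE]]].
  rewrite /stop; case: ifPn => // pk [Bx sE]; split => //.
  by apply/maximal_gt; exists k.
by exists k => //; rewrite /stop pk.
Qed.

Let stop_adapted p B j : adapted q p B -> forall k, adapted q k (stop p B j k).
Proof.
move=> pB k; rewrite /stop; case: ifPn => [pk|_]; last by move=> x y _ [].
by apply: adaptedI; [exact: (adapted_le qF pk)|exact: adapted_cond_exp_gt].
Qed.

(** Where the averages of the oscillation first pass the level j they pass it by at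
   most one doubling step. So the next level is reached in that cell only where the
   oscillation about the new average has averages above L times its mean. *)
Let sparse p B j k x : first (stop p B j) k x ->
  adapted q p B ->
  mu (Q k x `&` level p j.+1) <= (L^-1 * v k)%:E.
Proof.
move=> [+ before] pB; rewrite /stop; case: ifPn => // pk [Bx _].
have Ei i : (p <= i)%N -> (i < k)%N -> E i (osc p) x <= (j%:R * lam)%:E.
  move=> pi ik; rewrite leNgt; apply/negP => sE; apply: (before _ ik).
  by rewrite /stop pi.
have dist : (`|bavg k x - bavg p x| <= j%:R * lam + D * beta)%R.
  move: pk; rewrite leq_eqVlt => /predU1P[<-|pk].
    rewrite subrr normr0 addr_ge0// mulr_ge0// ?(ltW lam0) ?ltW//.
  case: k pk before Ei => // k pk before Ei.
  have -> : (bavg k.+1 x - bavg p x =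
      (bavg k x - bavg p x) + (bavg k.+1 x - bavg k x))%R by ring.
  rewrite (le_trans (ler_normD _ _))// lerD//; last exact: cell_avg_distS.
  by rewrite -lee_fin (le_trans (@cell_avg_dist p k x pk))//; exact: Ei.
have sub : Q k x `&` level p j.+1 `<=`
    Q k x `&` [set y | (L * beta)%:E < M k (osc k) y].
  move=> y [yx /maximal_gt[i pi]] sE; split => //; apply/maximal_gt.
  have ki : (k <= i)%N.
    rewrite leqNgt; apply/negP => ik.
    have := Ei _ pi ik; rewrite leNgt => /negP; apply.
    rewrite -(cond_exp_cell mu v _ (q_le qF (ltnW ik) yx)).
    by apply: le_lt_trans sE; rewrite lee_fin ler_pM2r ?lam0// ler_nat.
  exists i; first exact: ki.
  have := lt_le_trans sE (cond_exp_osc y pk ki).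
  rewrite (cell_avg_cell yx) (cell_avg_cell (q_le qF pk yx)).
  case: (E i (osc k) y) => [r| |]; [|by move=> _; exact: ltry|by rewrite addNye ltNge leNye].
  rewrite -EFinD !lte_fin -natr1 mulrDl mul1r {2}/lam => H.
  by have : (L * beta + D * beta = (D + L) * beta)%R by [ring]; lra.
apply: (@le_trans _ _ (mu (Q k x `&` [set y | (L * beta)%:E < M k (osc k) y]))).
  apply: le_measure => //; rewrite inE; last exact: measurable_cell_max_osc.
  exact: measurableI.
have Lb : (0 < L * beta)%R by rewrite mulr_gt0// (lt_le_trans _ L2).
have aQ : adapted q k (Q k x) by exact: adapted_cell.
have W := maximal_weak qF aQ (ltW Lb) (measurable_osc k) (osc_ge0 k).
have -> : (L^-1 * v k = (L * beta)^-1 * (v k * beta))%R.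
  by field; rewrite !gt_eqF// (lt_le_trans _ L2).
rewrite [leRHS]EFinM lee_pdivlMl//; apply: le_trans W _.
apply: (@le_trans _ _ (\int[mu]_(y in Q k x) osc k y)).
  apply: ge0_subset_integral; [exact: measurable_cell_max_osc|exact: mQ| | |].
  - by apply: measurable_funTS; exact: measurable_osc.
  - by move=> y _; exact: osc_ge0.
  - exact: subIsetl.
by rewrite -(cond_expK qF) EFinM lee_wpmul2l// lee_fin ltW.
Qed.

Lemma osc_level_decay p B j : adapted q p B ->
  mu (B `&` level p j.+1) <= (L^-1)%:E * mu (B `&` level p j).
Proof.
move=> pB; have mB := adapted_measurable qF pB.
have Li : (0 <= L^-1)%R by rewrite invr_ge0 (le_trans _ L2).
have mS : measurable (B `&` level p j) by exact: measurableI.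
rewrite -integral_cst// -(stopE p B j).
have -> : mu (B `&` level p j.+1) =
    \int[mu]_(x in \bigcup_k stop p B j k) (\1_(level p j.+1) x)%:E.
  rewrite stopE integral_indic//; congr (mu _).
  apply/seteqP; split => [x [Bx xl]|x [xl [Bx _]]] //.
  by split => //; split => //; exact: levelS xl.
apply: (stopping_le qF) => //.
- exact: stop_adapted.
- exact/measurable_EFinP.
move=> k x xk; rewrite integral_indic// setIC.
rewrite (integral_cell_cst qF) -EFinM.
exact: (sparse xk pB).
Qed.

(** Iterating the decay from one level to the next gives the John-Nirenberg
    inequality, here for the maximal function of the oscillation. *)
Lemma john_nirenberg p B j : adapted q p B ->
  mu (B `&` [set x | (j%:R * lam)%:E < M p (osc p) x]) <= (L^-1 ^+ j)%:E * mu B.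
Proof.
move=> pB; have mB := adapted_measurable qF pB.
have Li : (0 <= L^-1)%R by rewrite invr_ge0 (le_trans _ L2).
elim: j => [|j IH].
  rewrite expr0 mul1e; apply: le_measure; rewrite ?inE //.
  by apply: measurableI => //; exact: (mlevel p 0).
apply: (le_trans (osc_level_decay j pB)).
by rewrite exprS EFinM -muleA lee_wpmul2l.
Qed.

(** In each stopped cell at least half of the measure lies outside the next level,
   and there M p g is at least the average of g over the cell. So the mass of g on
   a level set is moved to the shell below the next level. *)
Let sub_level_mass p B j g : adapted q p B ->
  measurable_fun setT g -> (forall x, 0 <= g x) ->
  \int[mu]_(x in B `&` level p j) g x <=
  2%:E * \int[mu]_(x in B `&` level p j `\` level p j.+1) M p g x.
Proof.
move=> pB mg g0; have mB := adapted_measurable qF pB.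
have mM : measurable_fun setT (M p g) by exact: (measurable_maximal qF).
have M0 x : 0 <= M p g x by exact: (maximal_ge0 qF).
have mS : measurable (B `&` level p j) by exact: measurableI.
pose F x := 2%:E * ((M p g) \_ (~` level p j.+1)) x.
have mF : measurable_fun setT ((M p g) \_ (~` level p j.+1)).
  apply/(measurable_restrictT _ _).1 => //; first exact: measurableC.
  exact: measurable_funTS.
have F0 x : 0 <= ((M p g) \_ (~` level p j.+1)) x by rewrite patchE; case: ifP.
have -> : 2%:E * \int[mu]_(x in B `&` level p j `\` level p j.+1) M p g x =
    \int[mu]_(x in B `&` level p j) F x.
  rewrite ge0_integralZl//; last exact: measurable_funTS.
  by rewrite setDE integral_mkcondr.
rewrite -stopE; apply: (stopping_le qF) => //.
- exact: stop_adapted.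
- exact: measurable_funeM.
- by move=> x; rewrite mule_ge0.
move=> k x xk; have pk : (p <= k)%N by case: xk; rewrite /stop; case: ifP.
rewrite ge0_integralZl//; last exact: measurable_funTS.
rewrite -integral_mkcondr -setDE.
apply: (@le_trans _ _ (2%:E * \int[mu]_(y in Q k x `\` level p j.+1) E k g x)).
  rewrite integral_cst; last exact: measurableD.
  rewrite -[leLHS](cond_expK qF) [leLHS]muleC [leRHS]muleCA.
  apply: lee_wpmul2l; first exact: (cond_exp_ge0 qF).
  have -> : mu (Q k x `\` level p j.+1) = (v k)%:E - mu (Q k x `&` level p j.+1).
    rewrite measureD//; first by congr (_ - _); exact: (fil_vol qF).
    by apply: le_lt_trans (ltry (v k)); rewrite le_eqVlt; apply/orP; left;
      apply/eqP; exact: (fil_vol qF).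
  have := sparse xk pB.
  have : 0 <= mu (Q k x `&` level p j.+1) by [].
  case: (mu (Q k x `&` level p j.+1)) => [r| |]//.
  move=> r0 rL; rewrite -EFinB -EFinM lee_fin; move: r0 rL; rewrite 2!lee_fin => r0 rL.
  have : (L^-1 * v k <= 2^-1 * v k)%R.
    by rewrite ler_pM2r ?v0// lef_pV2 ?posrE// (lt_le_trans _ L2).
  move=> H; have : (r <= 2^-1 * v k)%R by exact: le_trans H.
  lra.
apply: lee_wpmul2l => //; apply: ge0_le_integral => //.
- exact: measurableD.
- by move=> y _; rewrite (cond_exp_ge0 qF).
- exact: measurable_funTS.
- by move=> y [yx _]; rewrite -(cond_exp_cell mu v g yx); exact: cond_exp_le_maximal.
Qed.

Lemma le_sum_osc_levels p x (c : R) : c%:E <= M p (osc p) x ->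
  c%:E <= \sum_(j <oo) (if ((j%:R * lam)%:E < M p (osc p) x)%E then lam else 0%R)%:E.
Proof.
move=> cM; have exn : exists n, (c <= n%:R * lam)%R.
  exists (Num.bound (`|c| / lam)); rewrite -ler_pdivrMr ?lam0//.
  apply: le_trans (ltW (archi_boundP _)); last by rewrite divr_ge0 ?(ltW lam0).
  by rewrite ler_pM2r ?invr_gt0 ?lam0// ler_norm.
case: (ex_minnP exn) => n cn nmin.
apply: (@le_trans _ _ (\sum_(0 <= j < n) (if ((j%:R * lam)%:E < M p (osc p) x)%E then lam else 0%R)%:E)).
  rewrite (@eq_big_nat _ _ _ _ _ _ (fun=> lam%:E)).
    by rewrite sumEFin lee_fin sumr_const_nat subn0 -mulr_natl.
  move=> j /andP[_ jn]; rewrite (lt_le_trans _ cM)// lte_fin ltNge.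
  by apply/negP => /nmin; rewrite leqNgt jn.
apply: nneseries_lim_ge => j _; case: ifP => _; rewrite lee_fin// ltW//.
exact: lam0.
Qed.

(** The oscillation at [x] is at most [lam] times the number of levels that its
    maximal function passes at [x]. The masses of [g] on the levels are moved to the
    successive shells, which are disjoint. *)
Lemma integral_osc_mul p B g : adapted q p B ->
  measurable_fun setT g -> (forall x, 0 <= g x) ->
  \int[mu]_(x in B) (osc p x * g x) <=
  (2 * lam)%:E * \int[mu]_(x in B) M p g x.
Proof.
move=> pB mg g0; have mB := adapted_measurable qF pB.
have mM : measurable_fun setT (M p g) by exact: (measurable_maximal qF).
have M0 x : 0 <= M p g x by exact: (maximal_ge0 qF).
pose u j x := (if ((j%:R * lam)%:E < M p (osc p) x)%E then lam else 0%R)%:E.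
have mu_ j : measurable_fun setT (u j).
  by apply: measurable_fun_above; exact: measurable_max_osc.
have u0 j x : 0 <= u j x.
  by rewrite /u; case: ifP => _; rewrite lee_fin// ltW// lam0.
have ug0 j x : 0 <= g x * u j x by rewrite mule_ge0.
have mug j : measurable_fun setT (fun x => g x * u j x) by exact: emeasurable_funM.
apply: (@le_trans _ _ (\int[mu]_(x in B) \sum_(j <oo) (g x * u j x))).
  apply: ae_ge0_le_integral => //.
  - by move=> x _; rewrite mule_ge0 ?osc_ge0.
  - by apply: measurable_funTS; apply: emeasurable_funM => //; exact: measurable_osc.
  - by move=> x _; exact: nneseries_ge0.
  - by apply: measurable_funTS; apply: ge0_emeasurable_sum.
  have := le_maximal_ae qF p (measurable_osc p) (osc_ge0 p).
  apply: filterS => x xM _.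
  move: (g0 x); rewrite le_eqVlt => /predU1P[<-|gx].
    by rewrite mule0; apply: nneseries_ge0 => j _ _; rewrite mul0e.
  case: (g x) gx => [r| |]// r0; last first.
    have := le_sum_osc_levels xM; rewrite /cell_osc.
    have [->|c0] := eqVneq `|b x - bavg p x|%R 0%R.
      by rewrite mul0e => _; apply: nneseries_ge0 => j _ _; rewrite mule_ge0.
    move=> _; rewrite (_ : \sum_(j <oo) _ = +oo) ?leey//.
    apply: (@nneseries_pinfty _ _ xpredT 0%N) => //=.
      by move=> j _; rewrite mule_ge0.
    rewrite /u mul0r (lt_le_trans _ xM) ?gt0_mulye ?lte_fin ?lam0//.
    by rewrite lt_neqAle eq_sym c0 /=.
  rewrite nneseriesZl// muleC lee_pmul2l//.
  exact: le_sum_osc_levels.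
rewrite integral_nneseries//; last by move=> j; exact: measurable_funTS.
have mS j : measurable (B `&` level p j `\` level p j.+1).
  by apply: measurableD => //; exact: measurableI.
apply: (@le_trans _ _ (\sum_(j <oo) ((2 * lam)%:E *
    \int[mu]_(x in B `&` level p j `\` level p j.+1) M p g x))).
  apply: lee_nneseries => [j _ _|j _]; first exact: integral_ge0.
  have -> : \int[mu]_(x in B) (g x * u j x) =
      lam%:E * \int[mu]_(x in B `&` level p j) g x.
    rewrite integral_mkcondr -ge0_integralZl//; last 3 first.
    - apply: measurable_funTS; apply/(measurable_restrictT _ _).1 => //.
      exact: measurable_funTS.
    - by move=> x _; rewrite patchE; case: ifP.
    - by rewrite lee_fin ltW ?lam0.
    apply: eq_integral => x _; rewrite /u patchE muleC; case: ifPn => sM.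
      by rewrite mem_set.
    by rewrite memNset ?mul0e ?mule0//; exact/negP.
  have -> : (2 * lam)%:E = lam%:E * 2%:E by rewrite -EFinM mulrC.
  rewrite -muleA; apply: lee_wpmul2l; first by rewrite lee_fin (ltW lam0).
  exact: sub_level_mass.
rewrite nneseriesZl; last by move=> j _; exact: integral_ge0.
apply: lee_wpmul2l; first by rewrite lee_fin mulr_ge0 ?(ltW lam0).
rewrite -ge0_integral_bigcup//.
- apply: ge0_subset_integral => //; first exact: bigcupT_measurable.
    exact: measurable_funTS.
  by move=> x [j _ [[]]].
- exact: measurable_funTS.
- move=> i j _ _ [x [[[_ xi] nxi] [[_ xj] nxj]]].
  apply/eqP; rewrite eqn_leq; apply/andP; split; rewrite leqNgt; apply/negP => ij.
    by apply: nxj; exact: levelS xi.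
  by apply: nxi; exact: levelS xj.
Qed.

End oscillation.

(** * Fractional averages and the oscillation at a point *)

Section hedberg.
Context d (T : measurableType d) (R : realType).
Context (mu : {measure set T -> \bar R}) (J : countType) (q : nat -> T -> J).
Context (v : nat -> R) (D : R).
Hypothesis qF : filtration mu q v D.
Local Notation Q := (cell q).
Local Notation E := (cond_exp mu q v).
Local Notation M := (maximal mu q v).
Variables (phi psi : R -> R).
Hypotheses (phiG : growth phi) (psiG : growth psi).
Implicit Types (g : T -> \bar R).

Let v0 k : (0 < v k)%R. Proof. exact: (v_gt0 qF). Qed.

(** Split [g] at the height [r]: above it, [g <= (r / phi r) * phi g] because
    [phi t / t] is nondecreasing. *)
Lemma cond_exp_growth_lt k g x (r : R) :
  measurable_fun setT g -> (forall x, 0 <= g x) ->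
  \int[mu]_x ext phi (g x) <= 1 ->
  (0 < r)%R -> ((v k)^-1 < phi r)%R -> E k g x < (2 * r)%:E.
Proof.
move=> mg g0 g1 r0 vr; have p0 := gr_gt0 phiG r0.
have mpg : measurable_fun setT (fun x => ext phi (g x)).
  by apply: (measurableT_comp (measurable_ext phiG)).
have pg0 x' : 0 <= ext phi (g x') by exact: (ext_ge0 phiG).
have c0 : (0 < r / phi r)%R by rewrite divr_gt0.
apply: (@le_lt_trans _ _ (E k (fun y => cst r%:E y + (r / phi r)%:E * ext phi (g y)) x)).
  apply: (le_cond_exp qF) => //.
    by apply: emeasurable_funD => //; exact: measurable_funeM.
  move=> y _; move: (g0 y); case: (g y) => [z|_|//]; last first.
    by rewrite ext_pinfty gt0_muley ?lte_fin// addey ?leey.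
  rewrite !lee_fin => z0; have [zr|rz] := leP z r.
    by rewrite (le_trans zr)// lerDl mulr_ge0 ?(ltW c0)//; exact: (growth_ge0 phiG).
  have z0' : (0 < z)%R by exact: lt_trans rz.
  have := growth_ratio phiG r0 (ltW rz).
  rewrite ler_pdivlMr// mulrAC ler_pdivrMr// => H.
  rewrite (@le_trans _ _ (r / phi r * phi z))%R ?lerDr ?(ltW r0)//.
  by rewrite mulrAC ler_pdivlMr// mulrC [leRHS]mulrC.
rewrite (cond_expD qF); last 4 first.
- exact: measurable_cst.
- exact: measurable_funeM.
- by move=> y; rewrite lee_fin ltW.
- by move=> y; rewrite mule_ge0// lee_fin ltW.
rewrite (cond_exp_cst qF) (cond_expZ qF) ?(ltW c0)//.
have Ev : E k (fun y => ext phi (g y)) x <= (v k)^-1%:E.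
  rewrite -[leRHS]mule1 lee_wpmul2l ?lee_fin ?invr_ge0 ?(ltW (v0 _))//.
  apply: le_trans g1; apply: ge0_subset_integral => //.
  exact: (measurable_cell qF).
apply: (@le_lt_trans _ _ (r%:E + (r / phi r)%:E * (v k)^-1%:E)).
  by rewrite leeD2l// lee_wpmul2l// lee_fin ltW.
rewrite -EFinM -EFinD lte_fin mulr_natl mulr2n ltrD2l.
by rewrite -mulrA gtr_pMr// ltr_pdivrMl// mulr1.
Qed.

Lemma cond_exp_growth_fin k g x :
  measurable_fun setT g -> (forall x, 0 <= g x) ->
  \int[mu]_x ext phi (g x) <= 1 -> E k g x \is a fin_num.
Proof.
move=> mg g0 g1; have [r r0 rv] := growth_unbounded phiG ((v k)^-1 + 1).
rewrite ge0_fin_numE ?(cond_exp_ge0 qF)//.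
apply: lt_trans (ltry (2 * r)); apply: cond_exp_growth_lt => //.
by apply: lt_le_trans rv; rewrite ltrDl.
Qed.

(** [fine] is harmless where it is used, by [cond_exp_growth_fin]. *)
Definition frac_avg (a : R) k g x : R := (v k `^ a * fine (E k g x))%R.

Lemma frac_avg_ge0 a k g x : (forall x, 0 <= g x) -> (0 <= frac_avg a k g x)%R.
Proof.
move=> g0; rewrite mulr_ge0 ?powR_ge0// fine_ge0//; exact: (cond_exp_ge0 qF).
Qed.

(** The hypothesis relating [phi] and [psi] is used at [s = phi m], [m] being the
    value of the maximal function, when this is the smaller bound for the average,
    and at [s = (v k)^-1], the bound that the size of the cell gives, otherwise. *)
Lemma hedberg (a C : R) p k g x : (0 <= a)%R -> (0 < C)%R ->
  (forall s rho : R, (0 < s)%R -> (0 <= rho)%R -> (phi rho <= s)%R ->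
    (psi (s `^ (- a) * rho / C) <= s)%R) ->
  measurable_fun setT g -> (forall x, 0 <= g x) ->
  \int[mu]_x ext phi (g x) <= 1 -> (p <= k)%N ->
  (psi (frac_avg a k g x / (2 * C)))%:E <= ext phi (M p g x).
Proof.
move=> a0 C0 H mg g0 g1 pk.
have Efin := cond_exp_growth_fin k x mg g0 g1.
have E0 : 0 <= E k g x by exact: (cond_exp_ge0 qF).
have := cond_exp_le_maximal mu q v g x pk.
have := maximal_ge0 qF p x g0.
rewrite /frac_avg; case: (M p g x) => [m|_ _|//]; last by rewrite ext_pinfty leey.
rewrite -(fineK Efin) ext_EFin !lee_fin.
set e := fine _ => m0 em; have e0 : (0 <= e)%R by exact: fine_ge0.
(* In terms of the inverse volume the average has the shape of the hypothesis. *)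
have vE : (v k `^ a = (v k)^-1 `^ (- a))%R.
  by rewrite -(powR_inv1 (ltW (v0 k))) -powRrM mulN1r opprK.
rewrite vE; set s := ((v k)^-1)%R; have s0 : (0 < s)%R by rewrite invr_gt0.
have es : (phi (e / 2) <= s)%R.
  rewrite leNgt; apply/negP => es.
  have e20 : (0 < e / 2)%R.
    rewrite ltNge; apply/negP => /(gr_le0 phiG) e20.
    by move: es; rewrite e20 ltNge (ltW s0).
  have := cond_exp_growth_lt x mg g0 g1 e20 es.
  by rewrite mulrC divfK// -[X in X < _](fineK Efin) ltxx.
(* Here s is the inverse volume of the cell; compare it with the value of phi at the
   maximal function. *)
have [su|us] := leP s (phi m).
  apply: le_trans su; apply: le_trans (H _ _ s0 _ es); last by rewrite divr_ge0.
  apply: (gr_nd psiG).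
  by rewrite invfM !mulrA.
have [m1|m1] := leP m 0%R.
  have -> : e = 0%R by apply/eqP; rewrite eq_le e0 andbT (le_trans em).
  by rewrite mulr0 mul0r (growth0 psiG) (growth_ge0 phiG).
have u0 := gr_gt0 phiG m1.
apply: le_trans (H _ _ u0 m0 (lexx _)); apply: (gr_nd psiG).
apply: (@le_trans _ _ (phi m `^ (- a) * m / (2 * C)))%R.
  rewrite ler_pM2r ?invr_gt0 ?mulr_gt0// ler_pM ?powR_ge0//.
  rewrite !powRN lef_pV2 ?posrE ?powR_gt0//.
  by apply: ge0_ler_powR; rewrite ?nnegrE ?(ltW u0) ?(ltW s0) ?(ltW us).
rewrite invfM mulrA ler_pM2r ?invr_gt0// ler_piMr ?mulr_ge0 ?powR_ge0//.
by rewrite invf_le1// ler1n.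
Qed.

End hedberg.

Lemma integral_scale_indic d (T : measurableType d) (R : realType)
    (mu : {measure set T -> \bar R}) (c : R) (A : set T) :
  (0 <= c)%R -> measurable A ->
  \int[mu]_x (c * \1_A x)%:E = c%:E * mu A.
Proof.
move=> c0 mA; under eq_integral do rewrite EFinM.
rewrite ge0_integralZl//; last exact/measurable_EFinP.
by rewrite integral_indic// setIT.
Qed.

Lemma sum_half_powers (R : realType) (X : \bar R) : 0 <= X ->
  \sum_(j <oo) (2^-1 ^+ j)%:E * X <= 2%:E * X.
Proof.
move=> X0; apply: lime_le.
  by apply: is_cvg_nneseries => n _ _; rewrite mule_ge0 ?lee_fin ?exprn_ge0.
apply: nearW => n; rewrite -ge0_sume_distrl; last first.
  by move=> i _; rewrite lee_fin exprn_ge0.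
apply: lee_wpmul2r => //; rewrite sumEFin lee_fin.
have -> : (\sum_(0 <= j < n) 2^-1 ^+ j = 2 - 2 * 2^-1 ^+ n :> R)%R.
  elim: n => [|n IH]; first by rewrite big_geq// expr0; ring.
  by rewrite big_nat_recr//= IH exprS; field.
by rewrite lerBlDr lerDl mulr_ge0 ?exprn_ge0.
Qed.

Lemma growth_doubling_iter (R : realType) (psi : R -> R) (K s : R) j :
  growth psi -> (forall r : R, (0 < r)%R -> (psi (2 * r) <= K * psi r)%R) ->
  (0 <= K)%R -> (0 < s)%R -> (psi (j.+1%:R * s) <= K ^+ j * psi s)%R.
Proof.
move=> psiG psiK K0 s0; apply: (@le_trans _ _ (psi (2 ^+ j * s)%R)).
  apply: (gr_nd psiG); rewrite ler_pM2r// -natrX ler_nat.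
  exact: ltn_expl.
elim: j => [|j IH]; first by rewrite !expr0 !mul1r.
rewrite exprS -mulrA (le_trans (psiK _ _)) ?mulr_gt0 ?exprn_gt0//.
by rewrite exprS -mulrA ler_wpM2l.
Qed.

Section oscillation_principal.
Context d (T : measurableType d) (R : realType).
Context (mu : {measure set T -> \bar R}) (J : countType) (q : nat -> T -> J).
Context (v : nat -> R) (D : R).
Hypothesis qF : filtration mu q v D.
Local Notation Q := (cell q).
Local Notation E := (cond_exp mu q v).
Local Notation M := (maximal mu q v).
Variable b : T -> R.
Local Notation bavg := (cell_avg mu q v b).
Local Notation osc := (cell_osc mu q v b).
Hypothesis mb : measurable_fun setT b.
Hypothesis ib : forall k x, mu.-integrable (Q k x) (EFin \o b).
Variable beta : R.
Hypothesis beta0 : (0 < beta)%R.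
Hypothesis bmo : forall k x, E k (osc k) x <= beta%:E.
Variables (psi : R -> R) (K : R).
Hypotheses (psiG : growth psi) (K1 : (1 <= K)%R).
Hypothesis psiK : forall r : R, (0 < r)%R -> (psi (2 * r) <= K * psi r)%R.
Local Notation lam := (osc_step D beta (2 * K)).

Let K2 : (2 <= 2 * K)%R. Proof. by rewrite ler_peMr. Qed.
Let lam0 : (0 < lam)%R. Proof. exact: (osc_step_gt0 qF beta0 K2). Qed.

Variables (F : nat -> T -> R) (W : T -> \bar R) (e : R).
Hypothesis F0 : forall k x, (0 <= F k x)%R.
Hypothesis aF : forall k x y, q k x = q k y -> F k x = F k y.
Hypothesis mW : measurable_fun setT W.
Hypothesis W0 : forall x, 0 <= W x.
Hypothesis FW : forall k x, (psi (F k x))%:E <= W x.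
Hypothesis e0 : (0 < e)%R.

Let s (l : nat) : R := (e * 2 ^+ l)%R.
Let s0 l : (0 < s l)%R. Proof. by rewrite mulr_gt0// exprn_gt0. Qed.

(** F plays the role of the fractional averages: it is constant on cells and psi of
   it has the integrable majorant W. *)
Let above l k := [set x | (s l < F k x)%R].

Let above_adapted l k : adapted q k (above l k).
Proof. by move=> x y /aF; rewrite /above/= => ->. Qed.

(** The points of a cell where F first passes s l that have j steps of oscillation
   about the average over that cell. *)
Let stopped l j k :=
  first (above l) k `&` [set x | (j%:R * lam)%:E < M k (osc k) x].

Let H l j := \bigcup_k stopped l j k.

Let mH l j : measurable (H l j).
Proof.
apply: bigcupT_measurable => k; apply: measurableI.
  by apply: (adapted_measurable qF (k := k)); apply: (adapted_first qF); exact: above_adapted.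
rewrite -[X in measurable X]setTI; apply: emeasurable_fun_o_infty => //.
exact: (measurable_maximal qF).
Qed.

(** John-Nirenberg in each of the cells where F first passes s l; the factor 2 K in
   the step yields the fraction (2 K)^-1 at each level. *)
Let mu_H l j : mu (H l j) <= ((2 * K)^-1 ^+ j)%:E * mu (\bigcup_k above l k).
Proof.
have mA : measurable (\bigcup_k above l k).
  by apply: (measurable_bigcup_adapted qF); exact: above_adapted.
have c0 : (0 <= (2 * K)^-1 ^+ j)%R.
  by rewrite exprn_ge0// invr_ge0 (le_trans _ K2).
rewrite -integral_cst//.
have -> : mu (H l j) = \int[mu]_(x in \bigcup_k above l k) (\1_(H l j) x)%:E.
  rewrite integral_indic//; congr (mu _); apply/esym/setIidPl.
  by move=> x [k _ [[xk _] _]]; exists k.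
apply: (stopping_le qF) => //.
  exact/measurable_EFinP.
move=> k x xk; rewrite integral_indic//; last exact: (measurable_cell qF).
rewrite (integral_cell_cst qF) -(fil_vol qF k x).
apply: le_trans (john_nirenberg qF mb ib beta0 bmo K2 j (@adapted_cell _ _ _ q k x)).
apply: le_measure; rewrite ?inE.
- by apply: measurableI => //; exact: (measurable_cell qF).
- exact: (measurable_cell_max_osc qF).
move=> y [[l' _ [yl' yM]] yx].
have kl : l' = k.
  apply: (first_inj yl').
  have aS : adapted q k (first (above l) k) by exact: (adapted_first qF).
  by apply: (aS x) => //; rewrite yx.
by split; [exact: yx|move: yM; rewrite kl].
Qed.

(** [psi (j.+1%:R * s l)] is comparable with [psi] of the product of an oscillation of
    [j.+1] steps with a value of [F] just above [s l]. *)
Definition principal_bound x : \bar R :=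
  \sum_(l <oo) \sum_(j <oo) (psi (j.+1%:R * s l) * \1_(H l j) x)%:E.

Let term0 l j x : 0 <= (psi (j.+1%:R * s l) * \1_(H l j) x)%:E.
Proof. by rewrite lee_fin mulr_ge0// (growth_ge0 psiG). Qed.

Let mterm l j : measurable_fun setT (fun x => (psi (j.+1%:R * s l) * \1_(H l j) x)%:E).
Proof. by apply/measurable_EFinP; apply: measurable_funM. Qed.

Lemma principal_bound_ge0 x : 0 <= principal_bound x.
Proof. by apply: nneseries_ge0 => l _ _; exact: nneseries_ge0. Qed.

Let minner l : measurable_fun setT
  (fun x => \sum_(j <oo) (psi (j.+1%:R * s l) * \1_(H l j) x)%:E).
Proof. by apply: ge0_emeasurable_sum. Qed.

Lemma measurable_principal_bound : measurable_fun setT principal_bound.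
Proof.
by apply: ge0_emeasurable_sum => // l x _ _; exact: nneseries_ge0.
Qed.

(** By doubling, [psi (j.+1%:R * s l) <= K ^+ j * psi (s l)], so the sum over [j] costs
    a factor 2 against the measures [(2 * K) ^- j]. The sum over [l] of [psi (s l)]
    below the supremum of [F] is geometric, and is at most [2 * W]. *)
Lemma integral_principal_bound :
  \int[mu]_x principal_bound x <= 4%:E * \int[mu]_x W x.
Proof.
rewrite /principal_bound integral_nneseries//; last first.
  by move=> l x _; exact: nneseries_ge0.
have mA l : measurable (\bigcup_k above l k).
  by apply: (measurable_bigcup_adapted qF); exact: above_adapted.
pose w l x := (psi (s l) * \1_(\bigcup_k above l k) x)%:E.
have mw l : measurable_fun setT (w l).
  by apply/measurable_EFinP; apply: measurable_funM.
have w0 l x : 0 <= w l x by rewrite lee_fin mulr_ge0// (growth_ge0 psiG).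
apply: (@le_trans _ _ (\sum_(l <oo) 2%:E * \int[mu]_x w l x)).
  apply: lee_nneseries => [l _ _|l _].
    by apply: integral_ge0 => x _; exact: nneseries_ge0.
  rewrite integral_nneseries//.
  apply: le_trans (sum_half_powers _); last exact: integral_ge0.
  apply: lee_nneseries => [j _ _|j _]; first exact: integral_ge0.
  rewrite /w !integral_scale_indic//; try exact: (growth_ge0 psiG).
  have p0 := growth_ge0 psiG (s l).
  apply: (@le_trans _ _ ((K ^+ j * psi (s l))%:E *
      (((2 * K)^-1 ^+ j)%:E * mu (\bigcup_k above l k)))).
    apply: lee_pmul => //; first by rewrite lee_fin (growth_ge0 psiG).
    by rewrite lee_fin; apply: growth_doubling_iter => //; exact: le_trans K1.
  rewrite !muleA -!EFinM lee_wpmul2r// lee_fin le_eqVlt; apply/orP; left; apply/eqP.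
  rewrite mulrAC -exprMn invfM mulrCA mulfV ?mulr1//.
  by rewrite gt_eqF// (lt_le_trans _ K1).
rewrite nneseriesZl//; last by move=> l _; exact: integral_ge0.
rewrite -integral_nneseries//.
have -> : 4%:E = 2%:E * 2%:E :> \bar R by rewrite -EFinM; congr EFin; ring.
rewrite -muleA lee_wpmul2l// -ge0_integralZl//.
apply: ge0_le_integral => //.
- by move=> x _; exact: nneseries_ge0.
- exact: ge0_emeasurable_sum.
- exact: measurable_funeM.
move=> x _; have := W0 x; have := FW ^~ x.
case: (W x) => [r| |]// => [Fr r0|_ _]; last by rewrite gt0_muley ?leey.
pose z := ereal_sup [set (F k x)%:E | k in setT].
have wE l : w l x = (if ((s l)%:E < z)%E then psi (s l) else 0%R)%:E.
  rewrite /w indicE; case: ifPn => [/ereal_sup_gt[_ [k _ <-]]|nz].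
    by rewrite lte_fin => sF; rewrite mem_set ?mulr1//; exists k.
  rewrite memNset ?mulr0// => -[k _ sF]; move/negP: nz; apply.
  apply: (@lt_le_trans _ _ (F k x)%:E); first by rewrite lte_fin.
  by apply: ereal_sup_ubound; exists k.
under eq_eseriesr do rewrite wE.
rewrite -EFinM; rewrite lee_fin in r0; apply: geometric_levels.
- by move=> l; exact: (growth_ge0 psiG).
- move=> l; have -> : s l.+1 = (2 * s l)%R by rewrite /s exprS; ring.
  by apply: (growth_ge1 psiG); [rewrite ler1n|exact: ltW].
- by rewrite mulr_ge0.
- move=> l /ereal_sup_gt[_ [k _ <-]]; rewrite lte_fin => sF.
  have := Fr k; rewrite lee_fin => Fr'; rewrite ler_pM2l//.
  by apply: le_trans Fr'; apply: (gr_nd psiG); exact: ltW.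
Qed.

(** Let [F k x] lie between [s l] and [s l.+1], and let [p] be the first generation
    where [F] passes [s l] at [x]. Since [p <= k], both [b x] and the average of
    generation [k] are within the maximal oscillation [M p (osc p) x] of the average
    of generation [p]. The threshold [e] provides the lowest level. *)
Lemma le_principal_bound : {ae mu, forall x, forall k, (e < F k x)%R ->
  (psi (`|b x - bavg k x| * F k x / (4 * lam)))%:E <= principal_bound x}.
Proof.
have diff : {ae mu, forall x, forall p, osc p x <= M p (osc p) x}.
  apply/ae_foralln => p; apply: (le_maximal_ae qF); first exact: (measurable_osc qF mb).
  by move=> x; exact: osc_ge0.
apply: filterS diff => x xM k eF.
have [l /andP[sl ls]] := geometric_level e0 (lexx 2%R) eF.
have : (\bigcup_k first (above l) k) x by rewrite first_bigcup; exists k.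
move=> [p _ xp].
have pk : (p <= k)%N by rewrite leqNgt; apply/negP => /xp.2.
set c := (`|b x - bavg k x|)%R.
have [c0|c0] := leP c 0%R.
  rewrite (gr_le0 psiG); first exact: principal_bound_ge0.
  apply: mulr_le0_ge0; first by apply: mulr_le0_ge0.
  by rewrite invr_ge0 mulr_ge0// ltW.
have cM : (c / 2)%:E <= M p (osc p) x.
  have h1 := xM p.
  have h2 := le_trans (cell_avg_dist qF ib x pk) (cond_exp_le_maximal mu q v (osc p) x pk).
  have := leeD h1 h2; rewrite /cell_osc -EFinD => h3.
  have : c%:E <= M p (osc p) x + M p (osc p) x.
    apply: le_trans h3; rewrite lee_fin /c.
    have -> : (b x - bavg k x = (b x - bavg p x) - (bavg k x - bavg p x))%R by ring.
    exact: ler_normB.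
  case: (M p (osc p) x) => [r| _|//]; last exact: leey.
  by rewrite -EFinD !lee_fin; lra.
have [j /andP[jc cj]] := arithmetic_level lam0 (divr_gt0 c0 (ltr0n _ 2)).
have xH : H l j x.
  by exists p => //; split => //; rewrite /= (lt_le_trans _ cM)// lte_fin.
apply: (@le_trans _ _ (psi (j.+1%:R * s l) * \1_(H l j) x)%:E).
  rewrite indicE mem_set// mulr1 lee_fin; apply: (gr_nd psiG).
  rewrite ler_pdivrMr; last by rewrite mulr_gt0.
  have -> : (j.+1%:R * s l * (4 * lam) = (2 * (j.+1%:R * lam)) * (2 * s l))%R by ring.
  apply: ler_pM => //; first exact: ltW.
    by move: cj; rewrite ler_pdivrMr// [leRHS]mulrC.
  by apply: le_trans ls _; rewrite /s exprS; lra.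
apply: (@le_trans _ _ (\sum_(i <oo) (psi (i.+1%:R * s l) * \1_(H l i) x)%:E)).
  exact: (@le_nneseries_term _ (fun i => (psi (i.+1%:R * s l) * \1_(H l i) x)%:E)).
apply: (@le_nneseries_term _ (fun m =>
  \sum_(i <oo) (psi (i.+1%:R * s m) * \1_(H m i) x)%:E)) => m.
exact: nneseries_ge0.
Qed.

End oscillation_principal.

(** * The commutator along one filtration *)

Lemma le_integral_ext d (T : measurableType d) (R : realType)
    (mu : {measure set T -> \bar R}) (phi : R -> R) (f g : T -> \bar R) :
  growth phi -> measurable_fun setT f -> measurable_fun setT g ->
  (forall x, f x <= g x) ->
  \int[mu]_x ext phi (f x) <= \int[mu]_x ext phi (g x).
Proof.
move=> phiG mf mg fg; have me := measurable_ext phiG.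
apply: ge0_le_integral => //.
- by move=> x _; exact: (ext_ge0 phiG).
- exact: (measurableT_comp me mf).
- exact: (measurableT_comp me mg).
- by move=> x _; exact: (le_ext phiG).
Qed.

Section filtration_commutator.
Context d (T : measurableType d) (R : realType).
Context (mu : {measure set T -> \bar R}) (J : countType) (q : nat -> T -> J).
Context (v : nat -> R) (D : R).
Hypothesis qF : filtration mu q v D.
Local Notation Q := (cell q).
Local Notation E := (cond_exp mu q v).
Local Notation M := (maximal mu q v).
Variable b : T -> R.
Local Notation bavg := (cell_avg mu q v b).
Local Notation osc := (cell_osc mu q v b).
Hypothesis mb : measurable_fun setT b.
Hypothesis ib : forall k x, mu.-integrable (Q k x) (EFin \o b).
Variable beta : R.
Hypothesis beta0 : (0 < beta)%R.
Hypothesis bmo : forall k x, E k (osc k) x <= beta%:E.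
Variables (phi psi : R -> R) (A K a C : R).
Hypotheses (phiG : growth phi) (psiG : growth psi).
Hypothesis (A2 : (2 <= A)%R).
Hypothesis phiA : forall r : R, (0 <= r)%R -> (2 * A * phi r <= phi (A * r))%R.
Hypothesis (K1 : (1 <= K)%R).
Hypothesis psiK : forall r : R, (0 < r)%R -> (psi (2 * r) <= K * psi r)%R.
Hypotheses (a0 : (0 <= a)%R) (C0 : (0 < C)%R).
Hypothesis phipsi : forall s rho : R, (0 < s)%R -> (0 <= rho)%R ->
  (phi rho <= s)%R -> (psi (s `^ (- a) * rho / C) <= s)%R.
Local Notation lam := (osc_step D beta (2 * K)).

Let K2 : (2 <= 2 * K)%R. Proof. by rewrite ler_peMr. Qed.
Let lam0 : (0 < lam)%R. Proof. exact: (osc_step_gt0 qF beta0 K2). Qed.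
Let v0 k : (0 < v k)%R. Proof. exact: (v_gt0 qF). Qed.

(** Insert the average of [b] over the cell between [b x] and [b y], and bound the
    oscillation of [b y] by [integral_osc_mul]. *)
Lemma cell_commutator_le k g x : measurable_fun setT g -> (forall x, 0 <= g x) ->
  \int[mu]_(y in Q k x) (`|(b x - b y)%R|%:E * g y) <=
  `|(b x - bavg k x)%R|%:E * ((v k)%:E * E k g x) +
  (2 * lam)%:E * ((v k)%:E * E k (M 0 g) x).
Proof.
move=> mg g0.
have mQ : measurable (Q k x) by exact: (measurable_cell qF).
have aQ : adapted q k (Q k x) by exact: adapted_cell.
have mosc : measurable_fun setT (osc k) by exact: (measurable_osc qF).
have mM p : measurable_fun setT (M p g) by exact: (measurable_maximal qF).
set c := (`|b x - bavg k x|)%R; have c0 : (0 <= c)%R by exact: normr_ge0.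
apply: (@le_trans _ _ (\int[mu]_(y in Q k x) (c%:E * g y + osc k y * g y))).
  apply: ge0_le_integral => //.
  - by move=> y _; rewrite mule_ge0 ?lee_fin.
  - apply: measurable_funTS; apply: emeasurable_funM => //; apply/measurable_EFinP.
    by apply: measurableT_comp => //; exact: measurable_funB.
  - apply: measurable_funTS; apply: emeasurable_funD; first exact: measurable_funeM.
    exact: emeasurable_funM.
  move=> y yx; rewrite -ge0_muleDl ?lee_fin// ?osc_ge0//.
  apply: lee_wpmul2r => //; rewrite /c /cell_osc -EFinD lee_fin.
  rewrite (cell_avg_cell mu v b yx).
  have -> : (b x - b y = (b x - bavg k x) - (b y - bavg k x))%R by ring.
  exact: ler_normB.
rewrite ge0_integralD//; last 4 first.
- by move=> y _; rewrite mule_ge0 ?lee_fin.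
- by apply: measurable_funTS; exact: measurable_funeM.
- by move=> y _; rewrite mule_ge0 ?osc_ge0.
- by apply: measurable_funTS; exact: emeasurable_funM.
apply: leeD.
  by rewrite ge0_integralZl ?lee_fin// ?(cond_expK qF)//; exact: measurable_funTS.
apply: le_trans (integral_osc_mul qF mb ib beta0 bmo K2 aQ mg g0) _.
apply: lee_wpmul2l; first by rewrite lee_fin mulr_ge0// ltW.
rewrite (cond_expK qF); apply: ge0_le_integral => //.
- by move=> y _; exact: (maximal_ge0 qF).
- exact: measurable_funTS.
- exact: measurable_funTS.
- by move=> y _; exact: maximal_le.
Qed.

(** The majorant is the sum of [ext phi (M g)], [ext phi (M (M g))] and the principal
    bound for [F k = v k `^ a * E k g / (2 * C)]; the factors 2 * A in the hypothesis
    pay for two applications of the maximal inequality, and 6 = 1 + 1 + 4. Since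
    [psi] is monotone, [psi] of the sum of the two parts of the commutator is at most
    [psi] of twice the larger one. *)
Theorem filtration_commutator g (e : R) :
  measurable_fun setT g -> (forall x, 0 <= g x) -> (0 < e)%R ->
  \int[mu]_x ext phi ((2 * A * (2 * A))%:E * g x) <= 4^-1%:E ->
  exists V : T -> \bar R, [/\ measurable_fun setT V, forall x, 0 <= V x,
    \int[mu]_x V x <= 6%:E &
    {ae mu, forall x, forall k,
      (psi (frac_avg mu q v a k g x / (2 * C)))%:E <= V x /\
      ((e < frac_avg mu q v a k g x / (2 * C))%R ->
       ext psi ((16 * C * lam)^-1%:E * ((v k `^ a / v k)%:E *
         \int[mu]_(y in Q k x) (`|(b x - b y)%R|%:E * g y))) <= V x)}].
Proof.
move=> mg g0 e0 gle.
have A2' := A2; have AA : (1 <= 2 * A)%R by lra.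
have mM : measurable_fun setT (M 0 g) by exact: (measurable_maximal qF).
have M0 x : 0 <= M 0 g x by exact: (maximal_ge0 qF).
have mMM : measurable_fun setT (M 0 (M 0 g)) by exact: (measurable_maximal qF).
have scale (c : R) (y : \bar R) : (1 <= c)%R -> 0 <= y -> y <= c%:E * y.
  by move=> c1 y0; rewrite -[leLHS]mul1e lee_wpmul2r.
have m2A (f : T -> \bar R) : measurable_fun setT f ->
    measurable_fun setT (fun x => (2 * A)%:E * f x).
  exact: measurable_funeM.
have I0 : \int[mu]_x ext phi ((2 * A)%:E * g x) <= 4^-1%:E.
  apply: le_trans gle; apply: le_integral_ext => //; first exact: m2A.
    exact: measurable_funeM.
  move=> x; rewrite [in leRHS]EFinM -muleA; apply: scale => //.
  by rewrite mule_ge0// lee_fin; lra.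
have I1 : \int[mu]_x ext phi (g x) <= 1.
  apply: (@le_trans _ _ 4^-1%:E); last by rewrite lee_fin invf_le1// ler1n.
  apply: le_trans I0; apply: le_integral_ext => //; first exact: m2A.
  by move=> x; exact: scale.
have I2 : \int[mu]_x ext phi (M 0 g x) <= 1.
  apply: le_trans (maximal_modular qF 0 phiG A2 phiA mg g0) _.
  apply: (@le_trans _ _ (2%:E * 4^-1%:E)); first exact: lee_wpmul2l.
  by rewrite -EFinM lee_fin; lra.
have I3 : \int[mu]_x ext phi (M 0 (M 0 g) x) <= 1.
  apply: le_trans (maximal_modular qF 0 phiG A2 phiA mM M0) _.
  have Ag0 x : 0 <= (2 * A)%:E * g x by rewrite mule_ge0// lee_fin; lra.
  apply: (@le_trans _ _ (2%:E * \int[mu]_x ext phi (M 0 (fun x => (2 * A)%:E * g x) x))).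
    apply: lee_wpmul2l => //; apply: le_integral_ext => //; first exact: m2A.
      exact: (measurable_maximal qF).
    by move=> x; apply: (le_maximalZ qF) => //; lra.
  apply: (@le_trans _ _ (2%:E * (2%:E * 4^-1%:E))); last by rewrite -!EFinM lee_fin; lra.
  apply: lee_wpmul2l => //.
  apply: le_trans (maximal_modular qF 0 phiG A2 phiA (m2A _ mg) Ag0) _.
  apply: lee_wpmul2l => //; apply: le_trans gle.
  under eq_integral do rewrite muleA -EFinM.
  by [].
pose W x := ext phi (M 0 g x).
pose W2 x := ext phi (M 0 (M 0 g) x).
have mW : measurable_fun setT W by exact: (measurableT_comp (measurable_ext phiG)).
have mW2 : measurable_fun setT W2 by exact: (measurableT_comp (measurable_ext phiG)).
have W0 x : 0 <= W x by exact: (ext_ge0 phiG).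
have W20 x : 0 <= W2 x by exact: (ext_ge0 phiG).
pose F k x := (frac_avg mu q v a k g x / (2 * C))%R.
have C20 : (0 < 2 * C)%R by rewrite mulr_gt0.
have F0 k x : (0 <= F k x)%R by rewrite divr_ge0 ?(ltW C20)// (frac_avg_ge0 qF).
have aF k x y : q k x = q k y -> F k x = F k y.
  by move=> xy; rewrite /F /frac_avg (cond_exp_cell mu v g xy).
have FW k x : (psi (F k x))%:E <= W x by exact: (hedberg qF phiG psiG).
pose P := principal_bound mu q v D b beta psi K F e.
have mP : measurable_fun setT P by exact: (measurable_principal_bound qF).
have P0 x : 0 <= P x by exact: principal_bound_ge0.
have intP : \int[mu]_x P x <= 4%:E * \int[mu]_x W x.
  exact: (integral_principal_bound qF mb ib beta0 bmo psiG K1 psiK aF mW W0 FW e0).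
have F2W k x : (psi (frac_avg mu q v a k (M 0 g) x / (2 * C)))%:E <= W2 x.
  exact: (hedberg qF phiG psiG).
have aeP : {ae mu, forall x, forall k, (e < F k x)%R ->
    (psi (`|b x - bavg k x| * F k x / (4 * lam)))%:E <= P x}.
  exact: (le_principal_bound qF mb ib beta0 psiG K1 F0 e0).
have I2' := I2.
have {}I2 : \int[mu]_x W x <= 1 by exact: I2.
have {}I3 : \int[mu]_x W2 x <= 1 by exact: I3.
move: W W2 P mW mW2 W0 W20 FW mP P0 intP F2W aeP I2 I3.
move=> W W2 P mW mW2 W0 W20 FW mP P0 intP F2W aeP I2 I3.
exists (fun x => W x + W2 x + P x); split.
- by apply: emeasurable_funD => //; exact: emeasurable_funD.
- by move=> x; rewrite !adde_ge0.
- rewrite ge0_integralD//; last 2 first.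
  + by move=> x _; rewrite adde_ge0.
  + exact: emeasurable_funD.
  rewrite ge0_integralD//.
  apply: (@le_trans _ _ (1 + 1 + 4%:E * 1)).
    apply: leeD; first exact: leeD.
    by apply: (le_trans intP); exact: lee_wpmul2l.
  by rewrite mule1 -!EFinD lee_fin; lra.
apply: filterS aeP => x xP k; split.
  by apply: le_trans (FW k x) _; rewrite -addeA leeDl// adde_ge0.
move=> eF; have {xP}P1 := xP k eF.
have fin1 := cond_exp_growth_fin qF phiG k x mg g0 I1.
have fin2 := cond_exp_growth_fin qF phiG k x mM M0 I2'.
set c := (`|b x - bavg k x|)%R in P1.
pose f2 := frac_avg mu q v a k (M 0 g) x.
have f20 : (0 <= f2)%R by exact: (frac_avg_ge0 qF).
have f2W : (psi (f2 / (2 * C)))%:E <= W2 x by exact: F2W.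
pose f1 := frac_avg mu q v a k g x.
have f10 : (0 <= f1)%R by exact: (frac_avg_ge0 qF).
have c0 : (0 <= c)%R by exact: normr_ge0.
have L0 : (0 < 16 * C * lam)%R by rewrite mulr_gt0// mulr_gt0.
apply: (@le_trans _ _ (psi ((c * f1 + 2 * lam * f2) / (16 * C * lam)))%:E).
  rewrite -ext_EFin; apply: (le_ext psiG).
  rewrite [in leRHS]mulrC [leRHS]EFinM; apply: lee_wpmul2l.
    by rewrite lee_fin invr_ge0 ltW.
  apply: (@le_trans _ _ ((v k `^ a / v k)%:E *
     (c%:E * ((v k)%:E * E k g x) + (2 * lam)%:E * ((v k)%:E * E k (M 0 g) x)))).
    apply: lee_wpmul2l; last exact: cell_commutator_le.
    by rewrite lee_fin divr_ge0 ?powR_ge0// ltW.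
  rewrite /f1 /f2 /frac_avg; move: fin1 fin2.
  case: (E k g x) => // r1 _; case: (E k (M 0 g) x) => // r2 _.
  rewrite -!EFinM -?EFinD -?EFinM lee_fin /=.
  rewrite le_eqVlt; apply/orP; left; apply/eqP; field.
  by rewrite gt_eqF.
have [h|h] := leP (2 * lam * f2)%R (c * f1)%R.
  apply: (@le_trans _ _ (psi (c * F k x / (4 * lam)))%:E).
    rewrite lee_fin; apply: (gr_nd psiG).
    have -> : (c * F k x / (4 * lam) = (2 * (c * f1)) / (16 * C * lam))%R.
      by rewrite /F -/f1; field; rewrite !gt_eqF.
    by rewrite ler_pM2r ?invr_gt0//; lra.
  by apply: (le_trans P1); rewrite /= leeDr// adde_ge0.
apply: (@le_trans _ _ (psi (f2 / (2 * C)))%:E).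
  rewrite lee_fin; apply: (gr_nd psiG).
  have -> : (f2 / (2 * C) = (8 * lam * f2) / (16 * C * lam))%R.
    by field; rewrite !gt_eqF.
  rewrite ler_pM2r ?invr_gt0//.
  have : (0 <= lam * f2)%R by rewrite mulr_ge0// ltW.
  lra.
by apply: (le_trans f2W); rewrite /= -addeA addeCA leeDl// adde_ge0.
Qed.

End filtration_commutator.

(** * Lebesgue measure of boxes *)

Section boxes.
Context (R : realType).
Local Notation tup n := (n.-tuple (measurableTypeR R)).

Definition box n (a b : 'I_n -> R) : set (tup n) :=
  [set x | forall i, (a i <= tnth x i < b i)%R].

Lemma measurable_coord n (i : 'I_n) (Y : set R) : measurable Y ->
  measurable [set x : tup n | Y (tnth x i)].
Proof.
by move=> mY; rewrite -[X in measurable X]setTI; exact: measurable_tnth.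
Qed.

Lemma measurable_box n (a b : 'I_n -> R) : measurable (box a b).
Proof.
rewrite (_ : box a b = \bigcap_(i in [set: 'I_n]) [set x : tup n | `[a i, b i[%classic (tnth x i)]).
  apply: fin_bigcap_measurable => // i _.
  exact: measurable_coord.
apply/seteqP; split => [x xab i _|x xab i]; first by rewrite /= in_itv/=.
by have := xab i I; rewrite /= in_itv.
Qed.

Lemma borel_lebesgue_box n (a b : 'I_n -> R) : (forall i, a i <= b i)%R ->
  borel_lebesgue R n (box a b) = (\prod_(i < n) (b i - a i))%:E.
Proof.
elim: n a b => [|n IH] a b ab /=.
  by rewrite diracE big_ord0 mem_set// => -[].
rewrite /cons_measure /pushforward.
rewrite (_ : _ @^-1` _ = `[a ord0, b ord0[%classic `*`
    box (a \o lift ord0) (b \o lift ord0)).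
  rewrite product_measure1E//; last exact: measurable_box.
  rewrite IH; last by move=> i; exact: ab.
  rewrite big_ord_recl EFinM; congr (_ * _).
  rewrite [LHS](@lebesgue_measure_itv R `[a ord0, b ord0[)/= lte_fin.
  case: ltP => // ba; have -> : b ord0 = a ord0 by apply/eqP; rewrite eq_le ab ba.
  by rewrite subrr.
apply/seteqP; split => [[x t] xt|[x t] [/= xab tab] i]; last first.
  case: (unliftP ord0 i) => [j ->|->]; last by move: xab; rewrite in_itv.
  by rewrite tnthS; exact: tab.
split; first by have := xt ord0; rewrite /= in_itv.
by move=> i; have := xt (lift ord0 i); rewrite tnthS.
Qed.

End boxes.

Section lebesgue_borel.
Context (R : realType) (n : nat).
Local Notation tup := (n.-tuple (measurableTypeR R)).
Local Notation leb := (lebesgue R n).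

Lemma borel_measurable_euclid (A : set tup) :
  measurable A -> measurable (A : set (euclid R n)).
Proof. exact: caratheodory_measurable_mu_ext. Qed.

Lemma lebesgue_borelE (A : set tup) : measurable A ->
  leb (A : set (euclid R n)) = borel_lebesgue R n A.
Proof. exact: measurable_mu_extE. Qed.

(** The Lebesgue measure is the outer measure generated by the Borel one. *)
Lemma lebesgue_borel_cover (A : set (euclid R n)) (e : R) :
  leb A < +oo -> (0 < e)%R ->
  exists B : set tup, [/\ measurable B, A `<=` B &
    borel_lebesgue R n B <= leb A + e%:E].
Proof.
move=> Aoo e0.
have Afin : leb A \is a fin_num by rewrite ge0_fin_numE.
have [_ [F [mF AF] <-] Fe] := lb_ereal_inf_adherent e0 Afin.
exists (\bigcup_k F k); split => //; first exact: bigcupT_measurable.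
apply: le_trans (ltW Fe); apply: measure_sigma_subadditive => //.
exact: bigcupT_measurable.
Qed.

End lebesgue_borel.

(** * Sets that are regular for the cells *)

Section cell_open.
Context d (T : measurableType d) (J : countType) (q : nat -> T -> J).
Hypothesis q_nest : forall k x y, q k.+1 x = q k.+1 y -> q k x = q k y.
Hypothesis mq : forall k x, measurable (cell q k x).

(** Unions of cells. As the cells are countably many, these sets are measurable. *)
Definition cell_open (U : set T) := forall x, U x -> exists k, cell q k x `<=` U.

Let q_mono k l x y : (k <= l)%N -> q l x = q l y -> q k x = q k y.
Proof.
move=> /subnK <-; elim: (l - k)%N => // m IH; rewrite addSn.
by move=> /q_nest/IH.
Qed.

Lemma cell_openI (U V : set T) : cell_open U -> cell_open V -> cell_open (U `&` V).
Proof.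
move=> oU oV x [/oU[k kU] /oV[l lV]]; exists (maxn k l) => y yx; split.
  by apply: kU; exact: (q_mono (leq_maxl k l)).
by apply: lV; exact: (q_mono (leq_maxr k l)).
Qed.

Lemma cell_open_bigcup (U : nat -> set T) :
  (forall i, cell_open (U i)) -> cell_open (\bigcup_i U i).
Proof.
by move=> oU x [i _ /oU[k kU]]; exists k => y /kU Uy; exists i.
Qed.

Lemma cell_openT : cell_open setT.
Proof. by move=> x _; exists 0%N. Qed.

Lemma cell_open_cell k x : cell_open (cell q k x).
Proof. by move=> y yx; exists k => z; rewrite /cell/= => ->. Qed.

Lemma cell_openC_cell k x : cell_open (~` cell q k x).
Proof.
by move=> y yx; exists k => z zy zx; apply: yx; rewrite /cell/= -zx zy.
Qed.

Lemma cell_open_decomp (U : set T) : cell_open U ->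
  exists F : nat -> set T, (forall i, F i = set0 \/ exists k x, F i = cell q k x) /\
    U = \bigcup_i F i.
Proof.
move=> oU; pose F i := [set x | exists k, pickle (k, q k x) = i /\ cell q k x `<=` U].
exists F; split.
  move=> i; have [|/set0P[x [k [<- kU]]]] := eqVneq (F i) set0; [by left|right].
  exists k, x; apply/seteqP; split => y.
    by move=> [l [/(pcan_inj pickleK)[-> qe _]]].
  by move=> yx; exists k; rewrite /cell yx.
apply/seteqP; split => x.
  by move=> /oU[k kU]; exists (pickle (k, q k x)) => //; exists k.
by move=> [i _ [k [_ kU]]]; exact: kU.
Qed.

Lemma cell_open_measurable (U : set T) : cell_open U -> measurable U.
Proof.
move=> /cell_open_decomp[F [FE ->]]; apply: bigcupT_measurable => i.
by have [->//|[k [x ->]]] := FE i.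
Qed.

Context (R : realType) (mu : {measure set T -> \bar R}) (P : set T).
Hypotheses (mP : measurable P) (Poo : mu P < +oo).

(** Sets that differ little inside [P] from a union of cells containing them, stated
    symmetrically in the set and its complement. The symmetry makes the stability
    under complements obvious, so that these sets form a sigma-algebra. *)
Definition cell_regular (B : set T) := forall e : R, (0 < e)%R ->
  exists UV : set T * set T, [/\ cell_open UV.1, cell_open UV.2,
    B `<=` UV.1, ~` B `<=` UV.2 & mu (UV.1 `&` UV.2 `&` P) <= e%:E].

Lemma cell_regular_setC B : cell_regular B -> cell_regular (~` B).
Proof.
move=> rB e /rB[[U V] [oU oV BU BV UV]]; exists (V, U); split => //=.
  by rewrite setCK.
by rewrite (setIC V).
Qed.

(** The covers of the sets are united. Those of the complements are intersected, but
    only finitely many of them, because an infinite intersection need not be a union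
    of cells; the tail is small by continuity of the measure, [P] having finite
    measure. *)
Lemma cell_regular_bigcup (F : nat -> set T) :
  (forall i, cell_regular (F i)) -> cell_regular (\bigcup_i F i).
Proof.
move=> rF e e0.
have /choice[UV UVP] : forall i, exists UV : set T * set T,
    [/\ cell_open UV.1, cell_open UV.2, F i `<=` UV.1, ~` F i `<=` UV.2 &
        mu (UV.1 `&` UV.2 `&` P) <= (e / 2 / (2 ^ i.+1)%:R)%:E].
  by move=> i; apply: rF; rewrite !divr_gt0// ltr0n expn_gt0.
pose U := \bigcup_i (UV i).1.
have oU : cell_open U by apply: cell_open_bigcup => i; have [] := UVP i.
have mUi i : measurable (UV i).1.
  by apply: cell_open_measurable; have [] := UVP i.
have mVi i : measurable (UV i).2.
  by apply: cell_open_measurable; have [] := UVP i.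
pose W m := P `&` \big[setU/set0]_(i < m.+1) (UV i).1.
have mW m : measurable (W m).
  by apply: measurableI => //; exact: bigsetU_measurable.
have WE : \bigcup_m W m = P `&` U.
  by rewrite /W -setI_bigcupr; congr (_ `&` _);
      exact: (bigcup_bigsetU_bigcup (fun i => (UV i).1)).
have mPU : measurable (P `&` U) by apply: measurableI => //; exact: cell_open_measurable.
have ndW : nondecreasing_seq W.
  apply/nondecreasing_seqP => m; rewrite subsetEset /W (big_ord_recr m.+1)/=.
  by apply: setIS => x ?; left.
have PUfin : mu (P `&` U) \is a fin_num.
  rewrite ge0_fin_numE//; apply: le_lt_trans Poo.
  by apply: le_measure; rewrite ?inE.
have [m Wm] : exists m, mu (P `&` U) <= mu (W m) + (e / 2)%:E.
  apply/not_existsP => H.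
  have : mu (P `&` U) <= mu (P `&` U) - (e / 2)%:E.
    have := nondecreasing_cvg_mu (mu := mu) mW (bigcupT_measurable _ mW) ndW.
    rewrite WE => C; set c := (X in _ <= X).
    apply: (closed_cvg (fun y => y <= c)) C; first exact: closed_ereal_ge_ereal.
    apply: nearW => m /=; rewrite /c leeBrDr//; apply: ltW.
    by rewrite ltNge; apply/negP; exact: H.
  rewrite -(fineK PUfin) -EFinB lee_fin.
  have : (0 < e / 2)%R by rewrite divr_gt0.
  lra.
pose V := \big[setI/setT]_(i < m.+1) (UV i).2.
have oV : cell_open V.
  apply: (big_ind cell_open); [exact: cell_openT|exact: cell_openI|].
  by move=> i _; have [] := UVP i.
exists (U, V); split => //=.
- by move=> x [i _ Fx]; exists i => //; have [_ _ + _ _] := UVP i; exact.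
- move=> x Fx; rewrite /V -(bigcap_mkord m.+1 (fun i => (UV i).2)) => i im.
  by have [_ _ _ + _] := UVP i; apply => Fix; apply: Fx; exists i.
have mV : measurable V by exact: cell_open_measurable.
pose G i := (UV i).1 `&` (UV i).2 `&` P.
have mG i : measurable (G i) by do 2 apply: measurableI => //.
have sub : U `&` V `&` P `<=` (P `&` U `\` W m) `|` \bigcup_i G i.
  move=> x [[Ux Vx] Px].
  have [[_ Wx]|nW] := pselect (W m x); last by left.
  right; move: Wx; rewrite -(bigcup_mkord m.+1 (fun i => (UV i).1)) => -[i /= im Uix]; exists i => //.
  split => //; split => //.
  by move: Vx; rewrite /V -(bigcap_mkord m.+1 (fun i => (UV i).2)) => /(_ i im).
apply: (@le_trans _ _ (mu ((P `&` U `\` W m) `|` \bigcup_i G i))).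
  apply: le_measure; rewrite ?inE.
  - apply: measurableI => //; apply: measurableI => //; exact: cell_open_measurable.
  - apply: measurableU; first exact: measurableD.
    exact: bigcupT_measurable.
  - exact: sub.
apply: (@le_trans _ _ (mu (P `&` U `\` W m) + mu (\bigcup_i G i))).
  by apply: measureU2; [exact: measurableD|exact: bigcupT_measurable].
have -> : e%:E = (e / 2)%:E + (e / 2)%:E by rewrite -EFinD; congr EFin; lra.
apply: leeD.
  rewrite measureD//; last by rewrite -ge0_fin_numE.
  rewrite (_ : P `&` U `&` W m = W m); last first.
    by apply/setIidPr; rewrite -WE; exact: bigcup_sup.
  have Wfin : mu (W m) \is a fin_num.
    rewrite ge0_fin_numE//; apply: le_lt_trans Poo.
    by apply: le_measure; rewrite ?inE//; exact: subIsetl.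
  by rewrite leeBlDl.
apply: le_trans (epsilon_trick0 xpredT (_ : 0 <= e / 2)%R); last by rewrite divr_ge0// ltW.
apply: (@le_trans _ _ (\sum_(i <oo) mu (G i))).
  by apply: measure_sigma_subadditive => //; exact: bigcupT_measurable.
by apply: lee_nneseries => // i _; have [] := UVP i.
Qed.

Lemma cell_regular_cell k x : cell_regular (cell q k x).
Proof.
move=> e e0; exists (cell q k x, ~` cell q k x); split => //=.
- exact: cell_open_cell.
- exact: cell_openC_cell.
- by rewrite setICr set0I measure0 lee_fin ltW.
Qed.

Lemma cell_regular0 : cell_regular set0.
Proof.
move=> e e0; exists (set0, setT).
split => /=; [by move=> x []|exact: cell_openT|by []|by []|].
by rewrite set0I set0I measure0 lee_fin ltW.
Qed.

Lemma cell_regular_open U : cell_open U -> cell_regular U.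
Proof.
move=> /cell_open_decomp[F [FE ->]]; apply: cell_regular_bigcup => i.
by have [->|[k [x ->]]] := FE i; [exact: cell_regular0|exact: cell_regular_cell].
Qed.

Lemma cell_regular_sigma_algebra : sigma_algebra setT cell_regular.
Proof.
split; first exact: cell_regular0.
- by move=> A rA; rewrite setTD; exact: cell_regular_setC.
- exact: cell_regular_bigcup.
Qed.

End cell_open.

(** * Shifted dyadic grids *)

Section grid.
Context (R : realType) (n : nat).
Local Notation tup := (n.-tuple (measurableTypeR R)).
Local Notation leb := (lebesgue R n).
Variables (N : nat) (t : 'I_n -> bool).

Definition side k : R := (2 ^+ N / 2 ^+ k)%R.

(** In the coordinates marked by [t] the grid is shifted by a third of the side of a
    cube of generation 0. In units of the side of generation [k] this is
    [2 ^+ k / 3], so the generations stay nested. *)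
Definition grid_pos k (x : tup) i : R :=
  (tnth x i / side k + 2 ^+ k * (if t i then 3^-1 else 0))%R.

Definition grid k (x : tup) : {ffun 'I_n -> int} :=
  [ffun i => Num.floor (grid_pos k x i)].

Local Notation Q := (@cell _ tup {ffun 'I_n -> int} grid).

Lemma side_gt0 k : (0 < side k)%R.
Proof. by rewrite divr_gt0 ?exprn_gt0. Qed.

Lemma sideS k : side k = (2 * side k.+1)%R.
Proof. by rewrite /side exprS; field; rewrite gt_eqF// exprn_gt0. Qed.

Lemma grid_posS k x i : grid_pos k.+1 x i = (2 * grid_pos k x i)%R.
Proof.
rewrite /grid_pos (sideS k) exprS; case: ifP => _; field;
  by rewrite gt_eqF// side_gt0.
Qed.

Lemma floor_half (y z : R) :
  Num.floor (2 * y)%R = Num.floor (2 * z)%R -> Num.floor y = Num.floor z.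
Proof.
move=> yz; apply/esym/floor_def.
have /andP[m1 m2] := floor_itv y; set m := Num.floor y in m1 m2 *.
have h1 : (2 * m <= Num.floor (2 * z))%R.
  by rewrite -yz floor_ge_int intrM; lra.
have h2 : (Num.floor (2 * z) < 2 * (m + 1))%R.
  by rewrite -yz floor_lt_int intrM; lra.
rewrite floor_ge_int intrM in h1; rewrite floor_lt_int intrM in h2.
by apply/andP; split; lra.
Qed.

Lemma grid_nest k x y : grid k.+1 x = grid k.+1 y -> grid k x = grid k y.
Proof.
move=> /ffunP xy; apply/ffunP => i; have := xy i; rewrite !ffunE !grid_posS.
exact: floor_half.
Qed.

Definition grid_lo k (x : tup) i : R :=
  (side k * ((grid k x i)%:~R - 2 ^+ k * (if t i then 3^-1 else 0)))%R.

Lemma grid_cell k x :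
  Q k x = box (grid_lo k x) (fun i => grid_lo k x i + side k)%R.
Proof.
have s0 := side_gt0 k.
have key (m : int) (y : tup) i : (Num.floor (grid_pos k y i) == m) =
  (side k * (m%:~R - 2 ^+ k * (if t i then 3^-1 else 0)) <= tnth y i <
   side k * (m%:~R - 2 ^+ k * (if t i then 3^-1 else 0)) + side k)%R.
  rewrite floor_eq /grid_pos; congr (_ && _).
    by rewrite -lerBlDr ler_pdivlMr// mulrC.
  by rewrite -ltrBrDr ltr_pdivrMr//; congr (_ < _)%R; rewrite intrD; ring.
apply/seteqP; split => [y yx i|y yx].
  by rewrite -key -yx ffunE.
by apply/ffunP => i; rewrite ffunE; apply/eqP; rewrite key; exact: yx.
Qed.

Lemma measurable_grid_cell k x : measurable (Q k x).
Proof. by rewrite grid_cell; exact: measurable_box. Qed.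

Lemma grid_cell_close k x y i : Q k x y -> (`|tnth y i - tnth x i| < side k)%R.
Proof.
have : Q k x x by [].
rewrite grid_cell => /(_ i) /andP[x1 x2] /(_ i) /andP[y1 y2].
by rewrite ltr_norml; apply/andP; split; lra.
Qed.

Lemma side_small (e : R) : (0 < e)%R -> exists k, (side k < e)%R.
Proof.
move=> e0; have [k hk] := geometric_unbounded (2 * 2 ^+ N)%R e0 (lexx 2%R).
exists k; rewrite /side ltr_pdivrMr ?exprn_gt0//; apply: lt_le_trans hk.
by rewrite ltr_pMl ?exprn_gt0// ltr1n.
Qed.

Lemma lebesgue_grid_cell k x : leb (Q k x) = (side k ^+ n)%:E.
Proof.
rewrite lebesgue_borelE; last exact: measurable_grid_cell.
rewrite grid_cell borel_lebesgue_box; last by move=> i; rewrite lerDl ltW ?side_gt0.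
rewrite (eq_bigr (fun=> side k)); last by move=> i _; rewrite addrAC subrr add0r.
by rewrite prodr_const card_ord.
Qed.

Lemma grid_open_coord (a : R) i :
  @cell_open _ tup _ grid [set x | (a < tnth x i)%R].
Proof.
move=> x /= ax; have xa : (0 < (tnth x i : R) - a)%R by rewrite subr_gt0.
have [k xk] := side_small xa; exists k => y /grid_cell_close => /(_ i); rewrite /= ltr_norml => /andP[].
by lra.
Qed.

(** The half-spaces generate the Borel sets and are unions of cells. *)
Lemma borel_grid_regular (x0 : tup) (B : set tup) : measurable B ->
  @cell_regular _ tup _ grid R (borel_lebesgue R n) (Q 0 x0) B.
Proof.
have Qoo : borel_lebesgue R n (Q 0 x0) < +oo.
  apply: le_lt_trans (ltry (side 0 ^+ n)%R); rewrite -(lebesgue_grid_cell 0 x0).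
  by rewrite lebesgue_borelE; [exact: lexx|exact: measurable_grid_cell].
have mQ := measurable_grid_cell 0 x0.
have SG : sigma_algebra setT
    (@cell_regular _ tup _ grid R (borel_lebesgue R n) (Q 0 x0)).
  by apply: cell_regular_sigma_algebra => //;
    [exact: grid_nest|exact: measurable_grid_cell].
have open U : @cell_open _ tup _ grid U ->
    @cell_regular _ tup _ grid R (borel_lebesgue R n) (Q 0 x0) U.
  by apply: cell_regular_open => //; [exact: grid_nest|exact: measurable_grid_cell].
apply: (smallest_sub SG).
apply: (big_ind (fun S : set (set tup) => S `<=` _)) => [//|S1 S2 h1 h2|i _].
  by rewrite subUset.
move=> _ [Y mY <-].
have SG' := sigma_algebra_image (fun x : tup => tnth x i) SG.
have ME : @measurable _ (measurableTypeR R) = <<s @RGenOInfty.G R >>.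
  exact: RGenOInfty.measurableE.
rewrite ME in mY; apply: (smallest_sub SG') mY => _ [c ->].
rewrite /image_set_system/= setTI; apply: open.
rewrite (_ : _ @^-1` _ = [set x : tup | (c < tnth x i)%R]); first exact: grid_open_coord.
by apply/seteqP; split => x; rewrite /= in_itv/= andbT.
Qed.

(** Regularity: first pass to a Borel set of almost the same measure, then cover its
    part in the cube of generation 0 by cells. *)
Lemma grid_filtration : filtration leb grid (fun k => side k ^+ n)%R (2 ^+ n)%R.
Proof.
split.
- exact: grid_nest.
- by move=> k x; apply: borel_measurable_euclid; exact: measurable_grid_cell.
- exact: lebesgue_grid_cell.
- by move=> k; rewrite exprn_gt0// side_gt0.
- by move=> k; rewrite (sideS k) exprMn.
move=> A x0 mA AQ e e0.
have e20 : (0 < e / 2)%R by rewrite divr_gt0.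
have mQ : measurable (Q 0 x0) by exact: measurable_grid_cell.
have mQ' : measurable (Q 0 x0 : set (euclid R n)) by exact: borel_measurable_euclid.
have Aoo : leb A < +oo.
  apply: (@le_lt_trans _ _ (leb (Q 0 x0))); last by rewrite lebesgue_grid_cell ltry.
  by apply: le_measure; rewrite ?inE.
have [B [mB AB Be]] := lebesgue_borel_cover Aoo e20.
have mBQ : measurable (B `&` Q 0 x0) by exact: measurableI.
have [[U V] /= [oU oV BU BV UVe]] := borel_grid_regular x0 mBQ e20.
have mU : measurable U by exact: (cell_open_measurable measurable_grid_cell oU).
have mV : measurable V by exact: (cell_open_measurable measurable_grid_cell oV).
exists (U `&` Q 0 x0); split.
- by move=> x Ax; split; [apply: BU; split; [exact: AB|exact: AQ]|exact: AQ].
- have mUQ : measurable (U `&` Q 0 x0) by exact: measurableI.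
  rewrite (lebesgue_borelE mUQ).
  have sub : U `&` Q 0 x0 `<=` B `|` (U `&` V `&` Q 0 x0).
    move=> x [Ux Qx]; have [Bx|nBx] := pselect (B x); [by left|right].
    by split => //; split => //; apply: BV => -[].
  apply: (@le_trans _ _ (borel_lebesgue R n (B `|` (U `&` V `&` Q 0 x0)))).
    apply: le_measure; rewrite ?inE//; apply: measurableU => //.
    by apply: measurableI => //; exact: measurableI.
  apply: (@le_trans _ _ (borel_lebesgue R n B + borel_lebesgue R n (U `&` V `&` Q 0 x0))).
    apply: measureU2 => //.
    by apply: measurableI => //; exact: measurableI.
  have -> : e%:E = (e / 2)%:E + (e / 2)%:E by rewrite -EFinD; congr EFin; lra.
  by rewrite addeA; exact: leeD.
- apply: (cell_openI grid_nest oU).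
  by move=> y yx; exists 0%N => z; rewrite /cell/= => ->.
Qed.

End grid.

(** * Balls and grid cells *)

Section balls.
Context (R : realType) (n : nat).
Hypothesis n0 : (0 < n)%N.
Local Notation tup := (n.-tuple (measurableTypeR R)).
Local Notation Rn := (euclid R n).
Local Notation leb := (lebesgue R n).
Implicit Types (x y z : Rn).

Let nR : (1 <= n%:R :> R)%R. Proof. by rewrite ler1n. Qed.
Let nR0 : (0 < n%:R :> R)%R. Proof. by rewrite ltr0n. Qed.

Let sq x y : R := (\sum_(i < n) ((tnth x i : R) - (tnth y i : R)) ^+ 2)%R.

Let edist_lt x y (r : R) : (0 < r)%R -> (edist x y < r)%R = (sq x y < r ^+ 2)%R.
Proof.
move=> r0; have e : Num.sqrt (r ^+ 2) = r.
  by rewrite sqrtr_sqr ger0_norm// ltW.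
by rewrite -{1}e /edist ltr_sqrt// exprn_gt0.
Qed.

Lemma edistC x y : edist x y = edist y x.
Proof.
rewrite /edist; congr Num.sqrt; apply: eq_bigr => i _.
by rewrite -sqrrN opprB.
Qed.

Lemma edist_ge0 x y : (0 <= edist x y)%R. Proof. exact: sqrtr_ge0. Qed.

Lemma edist_coord x y (r : R) : (edist x y < r)%R ->
  forall i, (`|(tnth x i : R) - tnth y i| < r)%R.
Proof.
move=> xyr i; have r0 : (0 < r)%R := le_lt_trans (edist_ge0 x y) xyr.
rewrite edist_lt// in xyr.
rewrite -(@ltr_pXn2r _ 2)// ?nnegrE ?(ltW r0)// real_normK ?num_real//.
apply: le_lt_trans xyr; rewrite /sq (bigD1 i)//= lerDl.
by apply: sumr_ge0 => j _; exact: sqr_ge0.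
Qed.

Lemma edist_box x y (e r : R) : (0 <= e)%R -> (n%:R * e < r)%R ->
  (forall i, `|(tnth x i : R) - tnth y i| <= e)%R -> (edist x y < r)%R.
Proof.
move=> e0 er xye; have r0 : (0 < r)%R.
  by apply: le_lt_trans er; rewrite mulr_ge0// ltW.
rewrite edist_lt//; apply: (@le_lt_trans _ _ ((n%:R * e) ^+ 2)%R); last first.
  by rewrite ltr_pXn2r// nnegrE ?mulr_ge0// ltW.
apply: (@le_trans _ _ (\sum_(i < n) e ^+ 2)%R).
  apply: ler_sum => i _; rewrite -[X in (X <= _)%R]real_normK ?num_real//.
  by rewrite lerXn2r// nnegrE.
rewrite sumr_const card_ord -[leLHS]mulr_natl exprMn ler_wpM2r ?sqr_ge0//.
by rewrite expr2 ler_peMl// ltW.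
Qed.

(** Openness of balls in the product topology, uniformly in the centre. *)
Lemma edist_perturb (s r : R) : (0 < s)%R -> (s < r)%R ->
  exists2 e : R, (0 < e)%R & forall x y z,
    (forall i, `|(tnth y i : R) - tnth x i| < e)%R ->
    (edist x z < s)%R -> (edist y z < r)%R.
Proof.
move=> s0 sr; have r0 : (0 < r)%R by exact: lt_trans sr.
have d0 : (0 < r ^+ 2 - s ^+ 2)%R.
  by rewrite subr_gt0 ltr_pXn2r// nnegrE ltW.
have c0 : (0 < n%:R * (2 * s + 1) :> R)%R by rewrite mulr_gt0//; lra.
pose e := (Num.min 1 ((r ^+ 2 - s ^+ 2) / (n%:R * (2 * s + 1))))%R.
(* With e <= 1, moving each coordinate by e changes the squared distance by at most
   n * (2 * s + 1) * e. *)
exists e => [|x y z yx xz]; first by rewrite lt_min ltr01 divr_gt0.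
have e1 : (e <= 1)%R by rewrite ge_min lexx.
have e2 : (e * (n%:R * (2 * s + 1)) <= r ^+ 2 - s ^+ 2)%R.
  by rewrite -ler_pdivlMr// ge_min lexx orbT.
have xzi := edist_coord xz; rewrite edist_lt// in xz; rewrite edist_lt//.
suff : (sq y z <= sq x z + \sum_(i < n) e * (2 * s + 1))%R.
  by rewrite sumr_const card_ord -[X in (_ + X)%R]mulr_natl mulrCA; lra.
rewrite /sq -big_split; apply: ler_sum => i _ /=.
have := xzi i; have := yx i; rewrite !ltr_norml => /andP[a1 a2] /andP[b1 b2].
set u := (tnth y i : R) in a1 a2 *; set v := (tnth x i : R) in a1 a2 b1 b2 *.
set w := (tnth z i : R) in b1 b2 *.
have h1 : ((u - v) * (v - w) <= e * s)%R.
  apply: le_trans (ler_norm _) _; rewrite normrM ler_pM//.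
    by rewrite ler_norml; apply/andP; split; lra.
  by rewrite ler_norml; apply/andP; split; lra.
have h2 : ((u - v) ^+ 2 <= e * 1)%R.
  rewrite expr2; apply: le_trans (ler_norm _) _; rewrite normrM ler_pM//.
    by rewrite ler_norml; apply/andP; split; lra.
  by rewrite ler_norml; apply/andP; split; lra.
have -> : (u - w = (u - v) + (v - w))%R by ring.
by rewrite sqrrD; lra.
Qed.

Let open_measurable (U : set tup) :
  (forall x, U x -> exists2 e : R, (0 < e)%R &
     forall y, (forall i, `|(tnth y i : R) - tnth x i| < e)%R -> U y) ->
  measurable U.
Proof.
move=> oU; apply: (cell_open_measurable (q := grid 0 (fun=> false))).
  exact: measurable_grid_cell.
move=> x /oU[e e0 eU]; have [k ke] := side_small 0 e0.
exists k => y yx; apply: eU => i; apply: lt_trans ke.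
exact: (grid_cell_close i yx).
Qed.

Lemma euclid_open_measurable (U : set Rn) :
  (forall x, U x -> exists2 e : R, (0 < e)%R &
     forall y, (forall i, `|(tnth y i : R) - tnth x i| < e)%R -> U y) ->
  measurable U.
Proof. by move=> oU; apply: borel_measurable_euclid; exact: open_measurable. Qed.

Lemma borel_measurable_eball x (r : R) : measurable (eball x r : set tup).
Proof.
apply: open_measurable => y; rewrite /eball/= edistC => yr.
have [r0|r0] := ltP 0%R r; last first.
  by have := le_lt_trans (edist_ge0 y x) yr; rewrite ltNge r0.
have [s0 sr] : (0 < Num.max (edist y x) (r / 2) + (r - Num.max (edist y x) (r / 2)) / 2 /\
   Num.max (edist y x) (r / 2) + (r - Num.max (edist y x) (r / 2)) / 2 < r)%R.
  have : (r / 2 <= Num.max (edist y x) (r / 2))%R by rewrite le_max lexx orbT.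
  have : (Num.max (edist y x) (r / 2) < r)%R by rewrite gt_max yr; lra.
  by move=> ? ?; split; lra.
have [e e0 eP] := edist_perturb s0 sr; exists e => // z zy.
rewrite /= edistC; apply: eP zy _.
have : (edist y x <= Num.max (edist y x) (r / 2))%R by rewrite le_max lexx.
have : (Num.max (edist y x) (r / 2) < r)%R by rewrite gt_max yr; lra.
lra.
Qed.

Lemma measurable_eball x (r : R) : measurable (eball x r).
Proof. by apply: borel_measurable_euclid; exact: borel_measurable_eball. Qed.

Lemma lebesgue_box (a b : 'I_n -> R) : (forall i, a i <= b i)%R ->
  leb (box a b) = (\prod_(i < n) (b i - a i))%:E.
Proof.
move=> ab; rewrite lebesgue_borelE; last exact: measurable_box.
exact: borel_lebesgue_box.
Qed.

Lemma lebesgue_cube (a : 'I_n -> R) (r : R) : (0 <= r)%R ->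
  leb (box a (fun i => a i + r)%R) = (r ^+ n)%:E.
Proof.
move=> r0; rewrite lebesgue_box; last by move=> i; rewrite lerDl.
rewrite (eq_bigr (fun=> r)); last by move=> i _; rewrite addrAC subrr add0r.
by rewrite prodr_const card_ord.
Qed.

Lemma lebesgue_eball_le x (r : R) : (0 < r)%R ->
  leb (eball x r) <= ((2 * r) ^+ n)%:E.
Proof.
move=> r0; rewrite -(lebesgue_cube (fun i => tnth x i - r)%R); last first.
  by rewrite mulr_ge0// ltW.
apply: le_measure; rewrite ?inE.
- exact: measurable_eball.
- by apply: borel_measurable_euclid; exact: measurable_box.
move=> y xy i; have := edist_coord xy i; rewrite ltr_norml => /andP[? ?].
by apply/andP; split; lra.
Qed.

Lemma lebesgue_eball_ge x (r : R) : (0 < r)%R ->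
  ((r / n%:R) ^+ n)%:E <= leb (eball x r).
Proof.
move=> r0; have c0 : (0 < r / (2 * n%:R))%R by rewrite divr_gt0// mulr_gt0.
rewrite -(lebesgue_cube (fun i => tnth x i - r / (2 * n%:R))%R); last first.
  by rewrite divr_ge0// ltW.
apply: le_measure; rewrite ?inE.
- by apply: borel_measurable_euclid; exact: measurable_box.
- exact: measurable_eball.
move=> y xy; apply: (@edist_box _ _ (r / (2 * n%:R))%R); first exact: ltW.
  have -> : (n%:R * (r / (2 * n%:R)) = r / 2)%R by field; rewrite gt_eqF.
  lra.
move=> i; have := xy i.
have -> : (r / n%:R = 2 * (r / (2 * n%:R)))%R by field; rewrite gt_eqF.
move=> /andP[? ?].
by rewrite ler_norml; apply/andP; split; lra.
Qed.

Lemma lebesgue_eball_fin x (r : R) : leb (eball x r) \is a fin_num.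
Proof.
have [r0|r0] := ltP 0%R r.
  by rewrite ge0_fin_numE// (le_lt_trans (lebesgue_eball_le x r0))// ltry.
rewrite (_ : eball x r = set0) ?measure0//; apply/seteqP; split => y // yr.
by have := le_lt_trans (edist_ge0 x y) yr; rewrite ltNge r0.
Qed.

Lemma volE x (r : R) : leb (eball x r) = (vol x r)%:E.
Proof. by rewrite /vol fineK// lebesgue_eball_fin. Qed.

Lemma vol_ge x (r : R) : (0 < r)%R -> ((r / n%:R) ^+ n <= vol x r)%R.
Proof. by move=> r0; rewrite -lee_fin -volE; exact: lebesgue_eball_ge. Qed.

Lemma vol_le x (r : R) : (0 < r)%R -> (vol x r <= (2 * r) ^+ n)%R.
Proof. by move=> r0; rewrite -lee_fin -volE; exact: lebesgue_eball_le. Qed.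

Lemma vol_gt0 x (r : R) : (0 < r)%R -> (0 < vol x r)%R.
Proof.
by move=> r0; apply: lt_le_trans (vol_ge x r0); rewrite exprn_gt0// divr_gt0.
Qed.

Lemma vol_homo x (r s : R) : (r <= s)%R -> (vol x r <= vol x s)%R.
Proof.
move=> rs; rewrite -lee_fin -!volE; apply: le_measure; rewrite ?inE;
  try exact: measurable_eball.
by move=> y; rewrite /eball/= => /lt_le_trans; exact.
Qed.

Lemma grid_cell_sub_eball N t k x (y : tup) :
  cell (T := tup) (grid N t) k x y -> (edist (x : Rn) y < 2 * n%:R * side R N k)%R.
Proof.
move=> yx; have s0 := side_gt0 R N k.
apply: (@edist_box _ _ (side R N k)); first exact: ltW.
  by rewrite ltr_pM2r// ltr_pMl// ltr1n.
by move=> i; rewrite distrC; exact: (ltW (grid_cell_close i yx)).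
Qed.

End balls.

Lemma floor_gap (R : realType) (u y rho : R) : (`|y - u| < rho)%R ->
  Num.floor y <> Num.floor u -> exists m : int, (`|u - m%:~R| < rho)%R.
Proof.
move=> yu fyu; have /andP[a1 a2] := floor_itv y; have /andP[b1 b2] := floor_itv u.
move: yu; rewrite ltr_norml => /andP[c1 c2].
case: (ltgtP (Num.floor y) (Num.floor u)) => [lt|gt|//].
  exists (Num.floor u); move: lt; rewrite floor_lt_int => lt.
  by rewrite ltr_norml; apply/andP; split; lra.
exists (Num.floor y); move: gt; rewrite floor_lt_int => gt.
by rewrite ltr_norml; apply/andP; split; lra.
Qed.

Lemma pow2_not_mul3 k (m : int) : (2 ^+ k <> 3 * m)%R.
Proof.
move=> /(congr1 absz); rewrite abszX abszM => /eqP; apply/negP/eqP => h.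
have : (3 %| 2 ^ k)%N by rewrite (_ : 2 ^ k = `|2%:Z| ^ k)%N// h dvdn_mulr.
by rewrite Euclid_dvdX// => /andP[].
Qed.

Section ball_in_cell.
Context (R : realType) (n : nat).
Hypothesis n0 : (0 < n)%N.
Local Notation tup := (n.-tuple (measurableTypeR R)).

(** If the interval of radius [rho] about [u] met a boundary point both in the original
    and in the shifted grid, then [2 ^+ k / 3] would be within [2 * rho <= 1 / 3] of
    an integer, hence [2 ^+ k] would be a multiple of 3. *)
Lemma third_shift (u rho : R) k : (rho <= 6^-1)%R ->
  exists t : bool, forall y : R, (`|y - u| < rho)%R ->
    Num.floor (y + 2 ^+ k * (if t then 3^-1 else 0))%R =
    Num.floor (u + 2 ^+ k * (if t then 3^-1 else 0))%R.
Proof.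
move=> rho6; set s := (2 ^+ k * 3^-1 : R)%R.
apply: contrapT => /forallNP H.
have gap (w y : R) : (`|y - u| < rho)%R ->
    Num.floor (y + w)%R <> Num.floor (u + w)%R ->
    exists m : int, (`|u + w - m%:~R| < rho)%R.
  move=> yu fy; apply: floor_gap fy.
  by have -> : (y + w - (u + w) = y - u)%R by ring.
have [m0 um0] : exists m : int, (`|u + 0 - m%:~R| < rho)%R.
  have /existsNP[y /not_implyP[yu fy]] := H false.
  by apply: (gap _ y) => //; move: fy; rewrite mulr0.
have [m1 um1] : exists m : int, (`|u + s - m%:~R| < rho)%R.
  have /existsNP[y /not_implyP[yu fy]] := H true.
  exact: (gap _ y).
apply: (@pow2_not_mul3 k (m1 - m0)).
have e : (`|(2 ^+ k - 3 * (m1 - m0))%:~R : R| < 1)%R.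
  have -> : ((2 ^+ k - 3 * (m1 - m0))%:~R =
      3 * ((u + s - m1%:~R) - (u + 0 - m0%:~R)) :> R)%R.
    by rewrite /s rmorphB rmorphXn rmorphM rmorphB/=; field.
  rewrite normrM (ger0_norm (_ : 0 <= 3)%R)//.
  by have := ler_normB (u + s - m1%:~R)%R (u + 0 - m0%:~R)%R; lra.
apply/eqP; rewrite -subr_eq0; move: e; rewrite -intr_norm (ltr_int R _ 1).
by rewrite -[X in (_ < X)%R]add0r ltzD1 normr_le0.
Qed.

(** Take the generation whose side is between [6 * r] and [12 * r] and choose the shift
    in each coordinate separately. *)
Lemma eball_sub_grid_cell (x : euclid R n) (r : R) N : (0 < r)%R ->
  (6 * r < 2 ^+ N)%R -> exists (t : {ffun 'I_n -> bool}) k,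
    eball x r `<=` cell (T := tup) (grid N t) k x /\
    (side R N k ^+ n <= (12 * n%:R) ^+ n * vol x r)%R.
Proof.
move=> r0 rN; have r6 : (0 < 6 * r)%R by rewrite mulr_gt0.
have lt1 : (1 < 2 ^+ N / (6 * r))%R by rewrite ltr_pdivlMr// mul1r.
have [k /andP[k1 k2]] := geometric_level ltr01 (lexx 2%R) lt1.
rewrite !mul1r in k1 k2.
have p0 : (0 < 2 ^+ k :> R)%R by rewrite exprn_gt0.
have sk1 : (6 * r < side R N k)%R.
  by rewrite /side ltr_pdivlMr// mulrC -ltr_pdivlMr.
have sk2 : (side R N k <= 12 * r)%R.
  rewrite /side ler_pdivrMr//; move: k2; rewrite ler_pdivrMr// exprS.
  by have -> : (2 * 2 ^+ k * (6 * r) = 12 * r * 2 ^+ k)%R by ring.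
have s0 : (0 < side R N k)%R by exact: side_gt0.
have rho6 : (r / side R N k <= 6^-1)%R.
  by rewrite ler_pdivrMr// ler_pdivlMl// ltW.
have /choice[t tP] := fun i : 'I_n => third_shift (tnth x i / side R N k)%R k rho6.
exists [ffun i => t i], k; split.
  move=> y xy; apply/ffunP => i; rewrite !ffunE /grid_pos !ffunE.
  apply: tP; rewrite -mulrBl normrM normfV (gtr0_norm s0) ltr_pM2r ?invr_gt0//.
  by rewrite distrC; exact: (edist_coord xy).
have nn0 : (0 < n%:R :> R)%R by rewrite ltr0n.
apply: (@le_trans _ _ ((12 * n%:R) ^+ n * (r / n%:R) ^+ n)%R); last first.
  by rewrite ler_pM2l ?exprn_gt0 ?mulr_gt0//; exact: vol_ge.
rewrite -exprMn lerXn2r ?nnegrE ?(ltW s0)//.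
  by rewrite mulr_ge0 ?divr_ge0 ?mulr_ge0 ?(ltW r0) ?(ltW nn0).
have -> : (12 * n%:R * (r / n%:R) = 12 * r)%R by field; rewrite gt_eqF.
exact: sk2.
Qed.

End ball_in_cell.

(** * Young functions *)

Section young.
Context (R : realType).
Variable Phi : R -> \bar R.
Hypotheses (PhiY : young_function Phi) (PhiD : Delta2 Phi).

(** The Delta_2 condition makes [Phi] finite on [[0, +oo[] ([young_fin_num]), so that [fine]
    loses nothing. *)
Definition young_real (r : R) : R := fine (Phi (Num.max r 0%R)).
Local Notation phi := young_real.

Lemma young_star (t r : R) : (0 <= t <= 1)%R -> (0 <= r)%R ->
  Phi (t * r)%R <= t%:E * Phi r.
Proof.
move=> t01 r0; have := young_convex PhiY r0 (lexx 0%R) t01.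
by rewrite mulr0 addr0 (young0 PhiY) mule0 adde0.
Qed.

Lemma young_homo (r s : R) : (0 <= r)%R -> (r <= s)%R -> Phi r <= Phi s.
Proof.
rewrite le_eqVlt => /predU1P[<-|r0] rs; first by rewrite (young0 PhiY) (young_ge0 PhiY).
have s0 : (0 < s)%R by exact: lt_le_trans rs.
have rs01 : (0 <= r / s <= 1)%R.
  by apply/andP; split; [rewrite divr_ge0// ltW|rewrite ler_pdivrMr// mul1r].
have := young_star rs01 (ltW s0); rewrite divfK ?gt_eqF// => /le_trans; apply.
rewrite -[leRHS]mul1e; apply: lee_wpmul2r; first by rewrite (young_ge0 PhiY)// ltW.
by rewrite lee_fin; case/andP: rs01.
Qed.

Lemma young_doubling_iter : exists2 C : R, (1 < C)%R &
  forall (k : nat) (r : R), (0 < r)%R -> Phi (2 ^+ k * r)%R <= (C ^+ k)%:E * Phi r.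
Proof.
have [C C1 CP] := PhiD; exists C => // k r r0; elim: k => [|k IH].
  by rewrite !expr0 mul1r mul1e.
rewrite exprS -mulrA; apply: (le_trans (CP _ _)); first by rewrite mulr_gt0// exprn_gt0.
rewrite exprS EFinM -muleA; apply: lee_wpmul2l => //.
by rewrite lee_fin (le_trans _ (ltW C1)).
Qed.

(** Phi is finite near 0 because it tends to 0 there, and doubling propagates this. *)
Lemma young_fin_num (r : R) : (0 <= r)%R -> Phi r \is a fin_num.
Proof.
move=> r0; have [r1 [r10 r1P]] : exists r1 : R, (0 < r1)%R /\ Phi r1 < +oo.
  have h : (Phi @ 0%R^'+) [set y | y < 1].
    by apply: (young_right0 PhiY); apply: open_ereal_lt'; exact: lte01.
  have H : \forall x \near 0%R^'+, Phi x < 1 by exact: h.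
  have [x [Px x0]] := @filter_ex _ _ (at_right_proper_filter (0%R : R)) _
    (filterI H (nbhs_right_gt (0%R : R))).
  by exists x; split => //; apply: lt_trans Px _; exact: ltry.
have [C C1 CP] := young_doubling_iter.
have [k rk] := geometric_unbounded r r10 (lexx 2%R).
rewrite ge0_fin_numE ?(young_ge0 PhiY)//.
rewrite mulrC in rk.
apply: (le_lt_trans (young_homo r0 rk)); apply: (le_lt_trans (CP k _ r10)).
by rewrite lte_mul_pinfty// ?lee_fin ?exprn_ge0// (le_trans _ (ltW C1)).
Qed.

(** If Phi vanished at a positive point, doubling would make it vanish everywhere. *)
Lemma young_gt0 (r : R) : (0 < r)%R -> 0 < Phi r.
Proof.
move=> r0; rewrite lt_neqAle (young_ge0 PhiY (ltW r0)) andbT; apply/eqP => P0.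
have [C C1 CP] := young_doubling_iter.
have Z (x : R) : (0 <= x)%R -> Phi x <= 0.
  move=> x0; have [k xk] := geometric_unbounded x r0 (lexx 2%R).
  rewrite mulrC in xk; apply: (le_trans (young_homo x0 xk)).
  by apply: (le_trans (CP k _ r0)); rewrite -P0 mule0.
have h : (Phi x @[x --> +oo%R]) [set y | 1 < y].
  by apply: (young_pinfty PhiY); exists 1%R; split => // y.
have H : \forall x \near +oo%R, 1 < Phi x by exact: h.
have [x [x1 x0]] := @filter_ex _ _ proper_pinfty_nbhs _
  (filterI H (nbhs_pinfty_ge (num_real (0%R : R)))).
by move: x1; rewrite ltNge (le_trans (Z _ x0)).
Qed.

Lemma young_realE (r : R) : (0 <= r)%R -> (phi r)%:E = Phi r.
Proof. by move=> r0; rewrite /phi max_l// fineK// young_fin_num. Qed.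

Lemma young_growth : growth phi.
Proof.
split.
- move=> r s rs; rewrite -lee_fin /phi !fineK ?young_fin_num ?le_max ?lexx ?orbT//.
  apply: young_homo; first by rewrite le_max lexx orbT.
  by rewrite ge_max le_max rs /= le_max lexx orbT.
- move=> t r t01 r0; have tr0 : (0 <= t * r)%R by rewrite mulr_ge0//; case/andP: t01.
  by rewrite -lee_fin EFinM !young_realE//; exact: young_star.
- by move=> r r0; rewrite -lte_fin young_realE ?ltW//; exact: young_gt0.
- by move=> r r0; rewrite /phi max_r// (young0 PhiY).
Qed.

Lemma young_extE (y : \bar R) : 0 <= y -> young_ext Phi y = ext phi y.
Proof. by case: y => // r; rewrite lee_fin => r0; rewrite ext_EFin young_realE. Qed.

Lemma young_real_doubling : exists2 K : R, (1 <= K)%R &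
  forall r : R, (0 < r)%R -> (phi (2 * r) <= K * phi r)%R.
Proof.
have [C C1 CP] := PhiD; exists C; first exact: ltW.
by move=> r r0; rewrite -lee_fin EFinM !young_realE ?CP ?mulr_ge0// ltW.
Qed.

(** The constant is enlarged to be at least 2, which star-shapedness permits. *)
Lemma young_real_nabla2 : nabla2 Phi -> exists2 A : R, (2 <= A)%R &
  forall r : R, (0 <= r)%R -> (2 * A * phi r <= phi (A * r))%R.
Proof.
move=> [C C1 CP]; pose A := (Num.max 2 C)%R.
have C0 : (0 < C)%R by exact: lt_trans C1.
exists A => [|r r0]; first by rewrite le_max lexx.
have AC : (1 <= A / C)%R by rewrite ler_pdivlMr// mul1r le_max lexx orbT.
have Cr0 : (0 <= C * r)%R by rewrite mulr_ge0// ltW.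
have := CP _ r0; rewrite -!young_realE// -EFinM lee_fin ler_pdivlMl ?mulr_gt0// => h.
have := growth_ge1 young_growth AC Cr0.
have -> : (A / C * (C * r) = A * r)%R by field; rewrite gt_eqF.
apply: le_trans.
have -> : (2 * A * phi r = A / C * (2 * C * phi r))%R by field; rewrite gt_eqF.
by rewrite ler_wpM2l// (le_trans _ AC).
Qed.

End young.

(** The inequality between the inverses, read on the functions. The factor 2 gives
    strict inequalities, which pass between a function and its generalized inverse
    without a detour through continuity. *)
Lemma young_inv_compare (R : realType) (Phi Psi : R -> \bar R) (a C : R) :
  young_function Phi -> Delta2 Phi -> young_function Psi -> Delta2 Psi ->
  (0 < C)%R ->
  (forall r : R, (0 < r)%R ->
     (r `^ (- a))%:E * young_inv Phi r%:E <= C%:E * young_inv Psi r%:E) ->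
  forall s rho : R, (0 < s)%R -> (0 <= rho)%R -> (young_real Phi rho <= s)%R ->
    (young_real Psi (s `^ (- a) * rho / (2 * C)) <= s)%R.
Proof.
move=> PhiY PhiD PsiY PsiD C0 H s rho s0 rho0 Prho.
have PsiG := young_growth PsiY PsiD.
set w := (s `^ (- a))%R; have w0 : (0 < w)%R by exact: powR_gt0.
rewrite leNgt; apply/negP => sPsi.
set tau := (w * rho / (2 * C))%R in sPsi.
have tau0 : (0 < tau)%R.
  rewrite ltNge; apply/negP => /(gr_le0 PsiG) t0.
  by move: sPsi; rewrite t0 ltNge (ltW s0).
have h1 : rho%:E <= young_inv Phi s%:E.
  apply: le_ereal_inf_tmp => _ [r [r0 sr] <-]; rewrite lee_fin leNgt; apply/negP => rrho.
  have := young_homo PhiY r0 (ltW rrho).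
  rewrite leNgt => /negP; apply; apply: le_lt_trans sr.
  by rewrite -(young_realE PhiY PhiD).
have h2 : young_inv Psi s%:E <= tau%:E.
  apply: ereal_inf_lbound; exists tau => //; split; first exact: ltW.
  by rewrite -(young_realE PsiY PsiD) ?lte_fin// ltW.
have : (w * rho <= C * tau)%R.
  rewrite -lee_fin !EFinM; apply: (@le_trans _ _ (w%:E * young_inv Phi s%:E)).
    by apply: lee_wpmul2l => //; rewrite lee_fin ltW.
  apply: (le_trans (H s s0)); apply: lee_wpmul2l => //.
  by rewrite lee_fin ltW.
have -> : (w * rho = 2 * (C * tau))%R by rewrite /tau; field; rewrite gt_eqF.
have : (0 < C * tau)%R by rewrite mulr_gt0.
lra.
Qed.

(** * Oscillation on grids and measurability of maximal functions *)

Section grid_oscillation.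
Context (R : realType) (n : nat).
Hypothesis n0 : (0 < n)%N.
Local Notation tup := (n.-tuple (measurableTypeR R)).
Local Notation Rn := (euclid R n).
Local Notation leb := (lebesgue R n).
Local Notation gv N := (fun k => (side R N k ^+ n)%R).
Variable b : Rn -> R.
Hypothesis bL : L1loc b.

Let radius N k : R := (2 * n%:R * side R N k)%R.

Let radius_gt0 N k : (0 < radius N k)%R.
Proof. by rewrite !mulr_gt0 ?ltr0n// side_gt0. Qed.

Let sub_ball N t k (x : Rn) :
  cell (T := Rn) (@grid R n N t) k x `<=` eball x (radius N k).
Proof. by move=> y yx; exact: (grid_cell_sub_eball n0 yx). Qed.

Let mcell N t k (x : Rn) : measurable (cell (T := Rn) (@grid R n N t) k x).
Proof. exact: (measurable_cell (grid_filtration R N t)). Qed.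

Lemma integrable_grid_cell N t k (x : Rn) :
  leb.-integrable (cell (T := Rn) (@grid R n N t) k x) (EFin \o b).
Proof.
apply: (integrableS (E := eball x (radius N k))) => //.
- exact: measurable_eball.
- exact: (bL.2 x _ (radius_gt0 N k)).
Qed.

(** The bound does not depend on the grid, since a cell lies in a ball of comparable
    volume about each of its points. *)
Lemma bmo_grid : bmo_norm b < +oo -> exists2 beta : R, (0 < beta)%R &
  forall N t k x, cond_exp leb (@grid R n N t) (gv N) k
    (cell_osc leb (@grid R n N t) (gv N) b k) x <= beta%:E.
Proof.
move=> bfin; have mb := bL.1.
have bball (x : Rn) (r : R) : (0 < r)%R -> (vol x r)^-1%:E *
    \int[leb]_(y in eball x r) `|(b y - avg b x r)%R|%:E <= bmo_norm b.
  by move=> r0; apply: ereal_sup_ubound; exists x, r.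
have [B0 [B B_ge0 BE]] : 0 <= bmo_norm b /\ exists2 B : R, (0 <= B)%R & bmo_norm b = B%:E.
  have b0 : 0 <= bmo_norm b.
    apply: le_trans (bball point 1%R ltr01); rewrite mule_ge0//.
      by rewrite lee_fin invr_ge0 ltW// vol_gt0.
    exact: integral_ge0.
  by split => //; move: b0 bfin; case: (bmo_norm b) => // r r0 _; exists r.
pose c := ((2 * (2 * n%:R)) ^+ n : R)%R.
have c0 : (0 < c)%R by rewrite exprn_gt0// !mulr_gt0// ltr0n.
exists (2 * (c * B) + 1)%R; first by rewrite ltr_wpDl// !mulr_ge0// ltW.
move=> N t k x; have s0 := side_gt0 R N k.
have v0 : (0 < side R N k ^+ n)%R by rewrite exprn_gt0.
set r := radius N k; have := bball x r (radius_gt0 N k); rewrite BE.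
move: (avg b x r) => a bballr.
have gF := grid_filtration R N t.
apply: le_trans (cond_exp_osc_le gF mb (integrable_grid_cell N t) k x a) _.
apply: (@le_trans _ _ (2%:E * (c * B)%:E)); last first.
  by rewrite -EFinM lee_fin lerDl.
apply: lee_wpmul2l => //; rewrite /cond_exp.
have mh : measurable_fun setT (fun y => `|(b y - a)%R|%:E).
  exact: measurable_dist.
apply: (@le_trans _ _ ((side R N k ^+ n)^-1%:E *
    \int[leb]_(y in eball x r) `|(b y - a)%R|%:E)).
  apply: lee_wpmul2l; first by rewrite lee_fin invr_ge0 ltW.
  apply: ge0_subset_integral; [exact: mcell|exact: measurable_eball|
    exact: measurable_funTS|by move=> y _; rewrite lee_fin|exact: sub_ball].
have vr0 : (0 < vol x r)%R by apply: vol_gt0 => //; exact: radius_gt0.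
move: bballr; rewrite lee_pdivrMl// => h.
rewrite lee_pdivrMl//; apply: (le_trans h); rewrite -!EFinM lee_fin.
rewrite mulrA ler_wpM2r// mulrC /c -exprMn.
have -> : (2 * (2 * n%:R) * side R N k = 2 * r)%R by rewrite /r /radius; ring.
by apply: vol_le => //; exact: radius_gt0.
Qed.

End grid_oscillation.

Section frac_max_measurable.
Context (R : realType) (n : nat).
Hypothesis n0 : (0 < n)%N.
Local Notation Rn := (euclid R n).
Local Notation leb := (lebesgue R n).
Variable g : Rn -> \bar R.
Hypotheses (mg : measurable_fun setT g) (g0 : forall x, 0 <= g x).

Let I (x : Rn) (t : R) := \int[leb]_(y in eball x t) g y.

(** The balls are open, so a ball is the union of the smaller concentric ones. *)
Lemma ball_integral_left x (t : R) (c : \bar R) : (0 < t)%R -> c < I x t ->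
  exists2 s : R, (0 < s < t)%R & c < I x s.
Proof.
move=> t0 cI; pose r (m : nat) : R := (t - t / m.+2%:R)%R.
have r0 m : (0 < r m < t)%R.
  rewrite /r subr_gt0 ltr_pdivrMr// ltr_pMr// ltr1n/=.
  by rewrite ltrBlDr ltrDl divr_gt0.
apply: contrapT => H.
have Ic m : I x (r m) <= c.
  by rewrite leNgt; apply/negP => cm; apply: H; exists (r m).
have ndF : nondecreasing_seq (fun m => eball x (r m)).
  apply/nondecreasing_seqP => m; rewrite subsetEset => y; rewrite /eball/=.
  move=> /lt_le_trans; apply; rewrite /r lerD2l lerN2 ler_pM2l//.
  by rewrite lef_pV2 ?posrE// ler_nat.
have UF : \bigcup_m eball x (r m) = eball x t.
  apply/seteqP; split => [y [m _]|y yt]; rewrite /eball/=.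
    by move=> /lt_trans; apply; case/andP: (r0 m).
  pose e := edist x y; have et : (0 < t - e)%R by rewrite subr_gt0.
  exists (Num.bound (t / (t - e))) => //.
  have := archi_boundP (divr_ge0 (ltW t0) (ltW et)).
  set m := Num.bound _ => hm; rewrite /= -/e /r ltrBrDr -ltrBrDl.
  rewrite ltr_pdivrMr// mulrC -ltr_pdivrMr//; apply: (lt_trans hm).
  by rewrite ltr_nat ltnS leqnSn.
have C := @ge0_nondecreasing_set_cvg_integral _ _ _ _ g leb ndF
  (fun m => measurable_eball n0 x (r m)) (fun m => measurable_funTS mg)
  (fun m y _ => g0 y).
rewrite UF in C.
have : I x t <= c.
  apply: (closed_cvg (fun y => y <= c)) C; first exact: closed_ereal_ge_ereal.
  by apply: nearW => m; exact: Ic.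
by rewrite leNgt cI.
Qed.

(** The integral over a ball of fixed radius is lower semicontinuous in the centre: its
    strict superlevel sets are open. *)
Lemma measurable_ball_integral (t : R) : (0 < t)%R ->
  measurable_fun setT (fun x => I x t).
Proof.
move=> t0; apply: (measurability _ (ErealGenOInfty.measurableE R)).
move=> _ [_ [r ->] <-]; rewrite setTI; apply: euclid_open_measurable => //.
move=> x /=; rewrite in_itv/= andbT => rI.
have [s /andP[s0 st] rs] := ball_integral_left t0 rI.
have [e e0 eP] := edist_perturb n0 s0 st; exists e => // y yx.
rewrite /= in_itv/= andbT; apply: (lt_le_trans rs).
apply: ge0_subset_integral => //; try exact: measurable_eball.
  exact: measurable_funTS.
by move=> z; rewrite /eball/=; exact: eP.
Qed.

End frac_max_measurable.

Section frac_max.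
Context (R : realType) (n : nat).
Hypothesis n0 : (0 < n)%N.
Local Notation Rn := (euclid R n).
Local Notation leb := (lebesgue R n).

Lemma measurable_vol (t : R) : (0 < t)%R ->
  measurable_fun setT (fun x : Rn => vol x t).
Proof.
move=> t0; apply/measurable_EFinP.
rewrite (_ : _ \o _ = fun x => \int[leb]_(y in eball x t) (cst 1 y)).
  exact: measurable_ball_integral.
apply/funext => x /=; rewrite integral_cst; last exact: measurable_eball.
by rewrite mul1e volE.
Qed.

(** Shrinking the radius increases the nonpositive power of the volume. *)
Lemma ball_mean_rational (e : R) (g : Rn -> \bar R) x (t : R) (c : \bar R) :
  (e <= 0)%R -> measurable_fun setT g -> (forall y, 0 <= g y) -> (0 < t)%R ->
  c < (vol x t `^ e)%:E * \int[leb]_(y in eball x t) g y ->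
  exists2 q : rat, (0 < q)%R &
    c < (vol x (ratr q) `^ e)%:E * \int[leb]_(y in eball x (ratr q)) g y.
Proof.
move=> e0 mg g0 t0.
have w0 : (0 < vol x t `^ e)%R by rewrite powR_gt0// vol_gt0.
move=> cwI; have cI : c * (vol x t `^ e)^-1%:E < \int[leb]_(y in eball x t) g y.
  by move: (\int[leb]_(y in _) _) cwI => J; rewrite (lte_pdivrMr _ _ w0) muleC.
have [u /andP[u0 ut] cu] := ball_integral_left n0 mg g0 t0 cI.
have [q] := rat_in_itvoo ut; rewrite in_itv/= => /andP[uq qt].
have q0 : (0 < ratr q :> R)%R by exact: lt_trans uq.
exists q; first by rewrite -(ltr0q R).
rewrite (lte_pdivrMr _ _ w0) muleC in cu.
apply: (lt_le_trans cu); apply: lee_pmul.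
- by rewrite lee_fin powR_ge0.
- by apply: integral_ge0 => y _; exact: g0.
- rewrite lee_fin -[e]opprK !(powRN _ (- e)) lef_pV2 ?posrE ?powR_gt0 ?vol_gt0//.
  apply: ge0_ler_powR; rewrite ?nnegrE ?oppr_ge0//.
  + exact: (ltW (vol_gt0 _ _ q0)).
  + exact: (ltW (vol_gt0 _ _ t0)).
  + exact: vol_homo (ltW qt).
- apply: ge0_subset_integral => //; try exact: measurable_eball.
    exact: measurable_funTS.
  by move=> y; rewrite /eball/= => /lt_trans; apply.
Qed.

(** The supremum may be restricted to rational radii. *)
Lemma measurable_frac_max (alpha : R) (f : Rn -> \bar R) :
  (alpha <= n%:R)%R -> measurable_fun setT f ->
  measurable_fun setT (frac_max alpha f).
Proof.
move=> an mf.
have nn0 : (0 < n%:R :> R)%R by rewrite ltr0n.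
have e0 : (-1 + alpha / n%:R <= 0)%R.
  by rewrite addrC subr_le0 ler_pdivrMr// mul1r.
have mabs : measurable_fun setT (fun x => `|f x|) by exact: measurableT_comp.
(* An enumeration of the positive rationals; 1 is a default value. *)
pose s m : R := if (unpickle m : option rat) is Some q then
  (if (0 < q)%R then ratr q else 1%R) else 1%R.
have s0 m : (0 < s m)%R.
  by rewrite /s; case: unpickle => // q; case: ifP => // q0; rewrite ltr0q.
have sP (q : rat) : (0 < q)%R -> exists m, s m = ratr q.
  by move=> q0; exists (pickle q); rewrite /s pickleK q0.
move: s s0 sP => s s0 sP.
rewrite (_ : frac_max alpha f = fun x => esups (fun m =>
    (vol x (s m) `^ (-1 + alpha / n%:R))%:E *
    \int[leb]_(y in eball x (s m)) `|f y|) 0%N).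
  apply: measurable_fun_esups => m; apply: emeasurable_funM.
    apply/measurable_EFinP.
    exact: (measurableT_comp (measurable_powR _) (measurable_vol (s0 m))).
  exact: measurable_ball_integral.
apply/funext => x; apply/eqP; rewrite eq_le; apply/andP; split; last first.
  apply: ge_ereal_sup => _ [m _ <-]; apply: ereal_sup_ubound.
  by exists (s m) => //; exact: s0.
apply: ge_ereal_sup => _ [t /= t0 <-]; rewrite leNgt; apply/negP => lt.
have [q q0] := ball_mean_rational e0 mabs (fun=> abse_ge0 _) t0 lt.
have [m <-] := sP q q0; rewrite ltNge => /negP; apply.
by apply: ereal_sup_ubound; exists m.
Qed.

End frac_max.

(** * Lower limits and suprema *)

Lemma limn_einf_ge (R : realType) (u : (\bar R)^nat) (c : \bar R) N0 :
  (forall N, (N0 <= N)%N -> c <= u N) -> c <= limn_einf u.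
Proof.
move=> cu; rewrite limn_einf_lim; apply: lime_ge; first exact: is_cvg_einfs.
near=> N; apply: le_ereal_inf_tmp => _ [M /= NM <-]; apply: cu.
by apply: leq_trans NM; near: N; exact: nbhs_infty_ge.
Unshelve. all: by end_near. Qed.

Lemma limn_einf_le (R : realType) (u : (\bar R)^nat) (c : \bar R) :
  (forall N, u N <= c) -> limn_einf u <= c.
Proof.
move=> uc; rewrite limn_einf_lim; apply: lime_le; first exact: is_cvg_einfs.
apply: nearW => N; apply: le_trans (uc N).
by apply: ereal_inf_lbound; exists N => /=.
Qed.

Lemma measurable_fun_limn_einf d (T : measurableType d) (R : realType)
    (f : (T -> \bar R)^nat) : (forall N, measurable_fun setT (f N)) ->
  measurable_fun setT (fun x => limn_einf (f^~ x)).
Proof.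
move=> mf; apply: measurableT_comp => //.
apply: (measurable_fun_limn_esup (f := fun N x => - f N x)) => N.
exact: measurableT_comp.
Qed.

Section sup_half.
Context (R : realType) (psi : R -> R).
Hypothesis psiG : growth psi.

(** [psi] need not be continuous, so the bound passes to the supremum only after
    halving. *)
Lemma ext_sup_half (S : set (\bar R)) (c : R) (z : \bar R) :
  (0 < c)%R -> z < +oo -> S !=set0 -> (forall y, S y -> 0 <= y) ->
  (forall y, S y -> ext psi (c^-1%:E * y) <= z) ->
  exists m : R, [/\ (0 <= m)%R, ereal_sup S = m%:E &
    ext psi ((2 * c)^-1 * m)%:E <= z].
Proof.
move=> c0 zoo [y0 Sy0] S0 Sz.
have z0 : 0 <= z := le_trans (ext_ge0 psiG _) (Sz _ Sy0).
have [X X0 Xz] := growth_unbounded psiG (fine z + 1).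
have zX : z < (psi X)%:E.
  rewrite -(@fineK _ z) ?ge0_fin_numE// lte_fin.
  by apply: lt_le_trans Xz; rewrite ltrDl.
have bound y : S y -> y <= (c * X)%:E.
  move=> Sy; rewrite leNgt; apply/negP => Xy; have := Sz _ Sy.
  rewrite leNgt => /negP; apply; apply: (lt_le_trans zX).
  rewrite -ext_EFin; apply: (le_ext psiG).
  by rewrite muleC lee_pdivlMr// -EFinM mulrC ltW.
have sup0 : 0 <= ereal_sup S by apply: le_trans (S0 _ Sy0) (ereal_sup_ubound Sy0).
have : ereal_sup S <= (c * X)%:E by apply: ge_ereal_sup => y; exact: bound.
case E: (ereal_sup S) sup0 => [m|//|//]; rewrite lee_fin => m0 _.
exists m; split => //; move: m0; rewrite le_eqVlt => /predU1P[<-|m0].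
  by rewrite mulr0 ext_EFin (growth0 psiG).
have : (m / 2)%:E < ereal_sup S by rewrite E lte_fin; lra.
move=> /ereal_sup_gt[y Sy my]; apply: le_trans (Sz _ Sy).
apply: (le_ext psiG); rewrite muleC lee_pdivlMr// -EFinM.
apply: le_trans (ltW my); rewrite lee_fin le_eqVlt; apply/orP; left; apply/eqP.
by field; rewrite gt_eqF.
Qed.

End sup_half.

(** * From cells to balls *)

Lemma powR_ratio_le (R : realType) (v V c a : R) :
  (a <= 1)%R -> (0 < v)%R -> (0 < V)%R -> (0 < c)%R -> (v <= c * V)%R ->
  (V `^ (-1 + a) <= c `^ (1 - a) * (v `^ a / v))%R.
Proof.
move=> a1 v0 V0 c0 vcV.
have -> : (-1 + a = - (1 - a))%R by ring.
have -> : (v `^ a / v = v `^ (- (1 - a)))%R.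
  rewrite (_ : - (1 - a) = a - 1)%R; last by ring.
  by rewrite powRD ?(gt_eqF v0) ?implybT// powR_inv1 ?ltW.
rewrite !powRN ler_pdivlMr ?powR_gt0// ler_pdivrMl ?powR_gt0// -powRM; [|exact: ltW..].
apply: ge0_ler_powR; rewrite ?nnegrE ?subr_ge0 ?(ltW v0)// 1?mulrC//.
by rewrite mulr_ge0// ltW.
Qed.

Section grid_commutator.
Context (R : realType) (n : nat).
Hypothesis n0 : (0 < n)%N.
Local Notation tup := (n.-tuple (measurableTypeR R)).
Local Notation Rn := (euclid R n).
Local Notation leb := (lebesgue R n).
Local Notation gv N := (fun k => (side R N k ^+ n)%R).
Local Notation Q N t k x := (cell (T := Rn) (@grid R n N t) k x).
Local Notation c0 := ((12 * n%:R) ^+ n : R)%R.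

Lemma ball_mean_le_grid (a : R) (x : Rn) (r : R) N :
  (a <= 1)%R -> (0 < r)%R -> (6 * r < 2 ^+ N)%R ->
  exists (t : {ffun 'I_n -> bool}) k, forall h : Rn -> \bar R,
    measurable_fun setT h -> (forall y, 0 <= h y) ->
    (vol x r `^ (-1 + a))%:E * \int[leb]_(y in eball x r) h y <=
    (c0 `^ (1 - a))%:E *
      ((gv N k `^ a / gv N k)%:E * \int[leb]_(y in Q N t k x) h y).
Proof.
move=> a1 r0 rN; have [t [k [sub vv]]] := eball_sub_grid_cell n0 x r0 rN.
exists t, k => h mh h0; rewrite muleA -EFinM; apply: lee_pmul.
- by rewrite lee_fin powR_ge0.
- by apply: integral_ge0 => y _; exact: h0.
- rewrite lee_fin; apply: powR_ratio_le => //.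
  + by rewrite exprn_gt0// side_gt0.
  + exact: vol_gt0.
  + by rewrite exprn_gt0// mulr_gt0// ltr0n.
- apply: ge0_subset_integral => //.
  + exact: measurable_eball.
  + exact: (measurable_cell (grid_filtration R N t)).
  + exact: measurable_funTS.
Qed.

Variable b : Rn -> R.
Hypotheses (bL : L1loc b) (bfin : bmo_norm b < +oo).
Variables (phi psi : R -> R) (A K a C : R).
Hypotheses (phiG : growth phi) (psiG : growth psi).
Hypothesis (A2 : (2 <= A)%R).
Hypothesis phiA : forall r : R, (0 <= r)%R -> (2 * A * phi r <= phi (A * r))%R.
Hypothesis (K1 : (1 <= K)%R).
Hypothesis psiK : forall r : R, (0 < r)%R -> (psi (2 * r) <= K * psi r)%R.
Hypotheses (a0 : (0 <= a)%R) (a1 : (a <= 1)%R) (C0 : (0 < C)%R).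
Hypothesis phipsi : forall s rho : R, (0 < s)%R -> (0 <= rho)%R ->
  (phi rho <= s)%R -> (psi (s `^ (- a) * rho / C) <= s)%R.

Definition cell_bound N t (e lam : R) (g V : Rn -> \bar R) x :=
  forall k, let w := (gv N k `^ a / gv N k)%:E in
    ext psi ((2 * C)^-1%:E * (w * \int[leb]_(y in Q N t k x) g y)) <= V x /\
    (e%:E < (2 * C)^-1%:E * (w * \int[leb]_(y in Q N t k x) g y) ->
     ext psi ((16 * C * lam)^-1%:E *
       (w * \int[leb]_(y in Q N t k x) (`|(b x - b y)%R|%:E * g y))) <= V x).

(** The constant [lam] is common to all grids because the mean oscillation on cells is
    bounded uniformly in the grid. *)
Lemma grid_commutator : exists2 lam : R, (0 < lam)%R &
  forall N t e g, measurable_fun setT g -> (forall x, 0 <= g x) -> (0 < e)%R ->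
  \int[leb]_x ext phi ((2 * A * (2 * A))%:E * g x) <= 4^-1%:E ->
  exists V : Rn -> \bar R, [/\ measurable_fun setT V, forall x, 0 <= V x,
    \int[leb]_x V x <= 6%:E & {ae leb, forall x, cell_bound N t e lam g V x}].
Proof.
have [beta beta0 betaP] := bmo_grid n0 bL bfin.
have K2 : (2 <= 2 * K)%R by rewrite ler_peMr.
exists (osc_step (2 ^+ n) beta (2 * K)).
  exact: (osc_step_gt0 (grid_filtration R 0%N (fun=> false)) beta0 K2).
move=> N t e g mg g0 e0 gle; have qF := grid_filtration R N t.
have I1 : \int[leb]_x ext phi (g x) <= 1.
  apply: (@le_trans _ _ 4^-1%:E); last by rewrite lee_fin invf_le1// ler1n.
  apply: le_trans gle; apply: (le_integral_ext _ phiG mg (measurable_funeM _ mg)).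
  move=> x; rewrite -[leLHS]mul1e lee_wpmul2r// lee_fin.
  by have A2' := A2; nra.
have [V [mV V0 V6 VP]] := filtration_commutator qF bL.1
  (integrable_grid_cell n0 bL N t) beta0 (betaP N t) phiG psiG A2 phiA K1 psiK
  a0 C0 phipsi mg g0 e0 gle.
exists V; split => //; apply: filterS VP => x Vx k w; have := Vx k.
have Efin := cond_exp_growth_fin qF phiG k x mg g0 I1.
have fE : (frac_avg leb (@grid R n N t) (gv N) a k g x / (2 * C))%:E =
    (2 * C)^-1%:E * (w * \int[leb]_(y in Q N t k x) g y).
  rewrite /frac_avg mulrC EFinM EFinM fineK// /cond_exp /w; clear.
  by rewrite [in RHS]EFinM -[in RHS]muleA.
by rewrite -fE -ext_EFin lte_fin.
Qed.

End grid_commutator.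

Lemma ge0_integral_mul_eq0 d (T : measurableType d) (R : realType)
    (mu : {measure set T -> \bar R}) (B : set T) (g h : T -> \bar R) :
  measurable B -> measurable_fun setT g -> measurable_fun setT h ->
  (forall x, 0 <= g x) -> \int[mu]_(x in B) g x = 0 ->
  \int[mu]_(x in B) (h x * g x) = 0.
Proof.
move=> mB mg mh g0 gB.
have mgB : measurable_fun B g by exact: measurable_funTS.
have : \int[mu]_(x in B) `|g x| = 0.
  by rewrite -[RHS]gB; apply: eq_integral => x _; rewrite gee0_abs.
move=> /(ae_eq_integral_abs mu mB mgB) gz.
have mhg : measurable_fun B (fun x => h x * g x).
  by apply: measurable_funTS; exact: emeasurable_funM.
rewrite -(integral0 mu B); apply: ae_eq_integral => //.
by apply: filterS gz => x gx Bx; rewrite gx// mule0.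
Qed.

Lemma exp_half_lt (R : realType) (y : \bar R) : 0 < y ->
  exists N0, forall N, (N0 <= N)%N -> ((2 ^+ N)^-1)%:E < y.
Proof.
case: y => [y|_|//]; last by exists 0%N => N _; exact: ltry.
rewrite lte_fin => y0; have [N0 yN] := geometric_unbounded (y^-1 + 1) ltr01 (lexx 2%R).
exists N0 => N NN; rewrite lte_fin -[ltRHS]invrK ltf_pV2 ?posrE ?invr_gt0 ?exprn_gt0//.
rewrite mul1r in yN; apply: (@lt_le_trans _ _ (2 ^+ N0)%R).
  by apply: lt_le_trans yN; rewrite ltrDl.
by rewrite ler_weXn2l// ler1n.
Qed.

Section ball_commutator.
Context (R : realType) (n : nat).
Hypothesis n0 : (0 < n)%N.
Local Notation Rn := (euclid R n).
Local Notation leb := (lebesgue R n).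
Variable b : Rn -> R.
Hypotheses (bL : L1loc b) (bfin : bmo_norm b < +oo).
Variables (phi psi : R -> R) (A K a C : R).
Hypotheses (phiG : growth phi) (psiG : growth psi).
Hypothesis (A2 : (2 <= A)%R).
Hypothesis phiA : forall r : R, (0 <= r)%R -> (2 * A * phi r <= phi (A * r))%R.
Hypothesis (K1 : (1 <= K)%R).
Hypothesis psiK : forall r : R, (0 < r)%R -> (psi (2 * r) <= K * psi r)%R.
Hypotheses (a0 : (0 <= a)%R) (a1 : (a <= 1)%R) (C0 : (0 < C)%R).
Hypothesis phipsi : forall s rho : R, (0 < s)%R -> (0 <= rho)%R ->
  (phi rho <= s)%R -> (psi (s `^ (- a) * rho / C) <= s)%R.

(** The majorants of the [2 ^ n] shifts of the grid with cubes of side [2 ^+ N] are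
    added, with threshold [2 ^- N] for the fractional averages. A given ball lies in
    a cube of one of these grids and is above the threshold for all large [N], unless
    [g] vanishes almost everywhere on it; so the lower limit in [N] dominates. *)
Lemma ball_commutator : exists2 kap : R, (0 < kap)%R &
  forall g : Rn -> \bar R, measurable_fun setT g -> (forall x, 0 <= g x) ->
  \int[leb]_x ext phi ((2 * A * (2 * A))%:E * g x) <= 4^-1%:E ->
  exists V : Rn -> \bar R, [/\ measurable_fun setT V, forall x, 0 <= V x,
    \int[leb]_x V x <= (6 * 2 ^+ n)%:E &
    {ae leb, forall x, forall r : R, (0 < r)%R ->
      let w := (vol x r `^ (-1 + a))%:E in
      ext psi (kap^-1%:E * (w * \int[leb]_(y in eball x r) g y)) <= V x /\
      ext psi (kap^-1%:E *
        (w * \int[leb]_(y in eball x r) (`|(b x - b y)%R|%:E * g y))) <= V x}].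
Proof.
have [lam lam0 H] := grid_commutator n0 bL bfin phiG psiG A2 phiA K1 psiK a0 C0 phipsi.
have grid_le x r N := @ball_mean_le_grid R n n0 a x r N a1.
set c1 := (((12 * n%:R) ^+ n) `^ (1 - a) : R)%R in grid_le.
have c10 : (0 < c1)%R by rewrite powR_gt0// exprn_gt0// mulr_gt0// ltr0n.
set m := Num.max (2 * C)%R (16 * C * lam)%R.
have m1 : (2 * C <= m)%R by rewrite le_max lexx.
have m2 : (16 * C * lam <= m)%R by rewrite le_max lexx orbT.
have C20 : (0 < 2 * C)%R by rewrite mulr_gt0.
have Cl0 : (0 < 16 * C * lam)%R by rewrite !mulr_gt0.
have m0 : (0 < m)%R by exact: lt_le_trans m1.
clearbody m.
have kap0 : (0 < c1 * m)%R by rewrite mulr_gt0.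
have shrink (X Y : \bar R) (c : R) : (0 < c)%R -> (c <= m)%R -> 0 <= Y ->
    X <= c1%:E * Y -> (c1 * m)^-1%:E * X <= c^-1%:E * Y.
  move=> c0 cm Y0 XY; apply: (@le_trans _ _ ((c1 * m)^-1%:E * (c1%:E * Y))).
    by rewrite lee_wpmul2l// lee_fin invr_ge0 ltW.
  rewrite muleA -EFinM invfM mulrAC mulVf ?gt_eqF// mul1r lee_wpmul2r//.
  by rewrite lee_fin lef_pV2.
clearbody c1.
exists (c1 * m)%R => // g mg g0 gle.
have e0 N : (0 < (2 ^+ N)^-1 :> R)%R by rewrite invr_gt0 exprn_gt0.
have /choice[V VP] (p : nat * {ffun 'I_n -> bool}) := H p.1 p.2 _ g mg g0 (e0 p.1) gle.
have V0 p x : 0 <= V p x by have [_ + _ _] := VP p; apply.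
have mV p : measurable_fun setT (V p) by have [] := VP p.
pose U N x := \sum_(t : {ffun 'I_n -> bool}) V (N, t) x.
have U0 N x : 0 <= U N x by apply: sume_ge0 => t _; exact: V0.
have mU N : measurable_fun setT (U N) by apply: emeasurable_sum => t; exact: mV.
have VU N t x : V (N, t) x <= U N x.
  by rewrite /U (bigD1 t)//= leeDl// sume_ge0.
have U6 N : \int[leb]_x U N x <= (6 * 2 ^+ n)%:E.
  rewrite ge0_integral_sum//.
  apply: (@le_trans _ _ (\sum_(t : {ffun 'I_n -> bool}) 6%:E)).
    by apply: lee_sum => t _; have [_ _ + _] := VP (N, t); apply.
  by rewrite sumEFin sumr_const card_ffun card_bool card_ord -[X in X%:E <= _]mulr_natr natrX.
exists (fun x => limn_einf (U^~ x)); split.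
- exact: measurable_fun_limn_einf.
- by move=> x; apply: (limn_einf_ge (N0 := 0%N)) => N _; exact: U0.
- apply: le_trans (fatou leb measurableT _ _) _ => //.
  exact: limn_einf_le.
pose P j x := if (unpickle j : option (nat * {ffun 'I_n -> bool})) is Some p then
  cell_bound b psi a C p.1 p.2 ((2 ^+ p.1)^-1)%R lam g (V p) x else True.
have aeP : {ae leb, forall x, forall j, P j x}.
  apply: ae_foralln => j; rewrite /P; case: unpickle => [p|]; last exact: aeW.
  by have [] := VP p.
apply: filterS aeP => x Px.
have {}Px (p : nat * {ffun 'I_n -> bool}) : cell_bound b psi a C p.1 p.2 ((2 ^+ p.1)^-1)%R lam g (V p) x.
  by have := Px (pickle p); rewrite /P pickleK.
clear P.
move=> r r0.
have [N0 N0P] : exists N0, forall N, (N0 <= N)%N -> (6 * r < 2 ^+ N)%R.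
  have r60 : 0 < ((6 * r)^-1)%:E by rewrite lte_fin invr_gt0 mulr_gt0.
  have [N0 N0P] := exp_half_lt r60.
  exists N0 => N /N0P; rewrite lte_fin ltf_pV2 ?posrE ?exprn_gt0//.
  by rewrite mulr_gt0.
have md : measurable_fun setT (fun y => `|(b x - b y)%R|%:E).
  by apply/measurable_EFinP; exact: (measurable_normB _ bL.1).
have mh : measurable_fun setT (fun y => `|(b x - b y)%R|%:E * g y).
  exact: emeasurable_funM.
have h0 y : 0 <= `|(b x - b y)%R|%:E * g y by rewrite mule_ge0// lee_fin.
have Q0 N t k (h : Rn -> \bar R) : (forall y, 0 <= h y) ->
    0 <= ((side R N k ^+ n) `^ a / (side R N k ^+ n))%:E *
      \int[leb]_(y in cell (T := Rn) (@grid R n N t) k x) h y.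
  move=> hh; rewrite mule_ge0 ?lee_fin ?divr_ge0 ?powR_ge0//.
    by rewrite exprn_ge0// ltW// side_gt0.
  by apply: integral_ge0 => y _; exact: hh.
split.
  apply: (limn_einf_ge (N0 := N0)) => N /N0P rN.
  have [t [k tkP]] := grid_le x r N r0 rN.
  apply: le_trans (VU N t x); have [+ _] := Px (N, t) k; apply: le_trans.
  apply: (le_ext psiG); apply: shrink => //; first exact: Q0.
  exact: tkP.
(* The bound for the differences holds only above the threshold, so the case where the
   average of g over the ball is 0 is treated apart. *)
have [gz|gn0] := eqVneq (\int[leb]_(y in eball x r) g y) 0.
  rewrite (ge0_integral_mul_eq0 (measurable_eball n0 x r) mg md g0 gz) !mule0.
  rewrite ext_EFin (growth0 psiG); apply: (limn_einf_ge (N0 := 0%N)) => N _.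
  exact: U0.
have pos : 0 < (c1 * m)^-1%:E *
    ((vol x r `^ (-1 + a))%:E * \int[leb]_(y in eball x r) g y).
  apply: mule_gt0; first by rewrite lte_fin invr_gt0.
  apply: mule_gt0; first by rewrite lte_fin powR_gt0// vol_gt0.
  by rewrite lt_neqAle eq_sym gn0 integral_ge0.
have [N1 N1P] := exp_half_lt pos.
apply: (limn_einf_ge (N0 := maxn N0 N1)) => N; rewrite geq_max => /andP[/N0P rN /N1P eN].
have [t [k tkP]] := grid_le x r N r0 rN.
apply: le_trans (VU N t x); have [_ Vx] := Px (N, t) k.
apply: (le_trans _ (Vx _)).
  apply: (le_ext psiG); apply: shrink => //; first exact: Q0.
  exact: tkP.
apply: (lt_le_trans eN); apply: shrink => //; first exact: Q0.
exact: tkP.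
Qed.

End ball_commutator.

(** * The commutator at a point *)

Lemma weighted_integral_le d (T : measurableType d) (R : realType)
    (mu : {measure set T -> \bar R}) (B : set T) (w : \bar R) (c : R)
    (g1 g2 g3 : T -> \bar R) : measurable B -> 0 <= w -> (0 <= c)%R ->
  measurable_fun setT g1 -> measurable_fun setT g2 -> measurable_fun setT g3 ->
  (forall y, 0 <= g1 y) -> (forall y, 0 <= g2 y) -> (forall y, 0 <= g3 y) ->
  (forall y, g1 y <= c%:E * g2 y + g3 y) ->
  w * \int[mu]_(y in B) g1 y <=
  c%:E * (w * \int[mu]_(y in B) g2 y) + w * \int[mu]_(y in B) g3 y.
Proof.
move=> mB w0 c0 m1 m2 m3 p1 p2 p3 H.
rewrite muleCA -ge0_muleDr ?mule_ge0 ?integral_ge0 ?lee_fin//.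
apply: lee_wpmul2l => //.
rewrite -ge0_integralZl_EFin//; last exact: measurable_funTS.
rewrite -ge0_integralD//.
- apply: ge0_le_integral => //.
  + exact: measurable_funTS.
  + by apply: measurable_funTS; apply: emeasurable_funD => //; exact: measurable_funeM.
- by move=> y _; rewrite mule_ge0// lee_fin.
- by apply: measurable_funTS; exact: measurable_funeM.
- exact: measurable_funTS.
Qed.

(** In the notation of the commutator at x: u = b x, m and q are the maximal functions of
   f and b f, and s is that of the differences. *)
Lemma commutator_real_bound (R : realType) (u m s q cb : R) :
  (0 <= cb)%R -> (- u <= cb)%R -> (0 <= m)%R -> (0 <= s)%R -> (0 <= q)%R ->
  (q <= `|u| * m + s)%R -> (`|u| * m <= q + s)%R ->
  (`|u * m - q| <= (1 + 2 * cb) * Num.max m s)%R.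
Proof.
move=> cb0 ucb m0 s0 q0 h1 h2; apply: (@le_trans _ _ (2 * cb * m + s)%R).
  move: h1 h2; rewrite ler_norml; have [u0|u0] := leP 0%R u.
    by rewrite (ger0_norm u0) => h1 h2; apply/andP; split; nra.
  by rewrite (ltr0_norm u0) => h1 h2; apply/andP; split; nra.
have : (m <= Num.max m s)%R by rewrite le_max lexx.
have : (s <= Num.max m s)%R by rewrite le_max lexx orbT.
nra.
Qed.

Section commutator_pointwise.
Context d (T : measurableType d) (R : realType) (mu : {measure set T -> \bar R}).
Context (I : Type) (D : set I) (w : I -> R) (B : I -> set T).
Hypotheses (w0 : forall i, (0 <= w i)%R) (mB : forall i, measurable (B i)).
Variables (b : T -> R) (f : T -> \bar R) (u : R).
Hypotheses (mb : measurable_fun setT b) (mf : measurable_fun setT f).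

Let avgf i := (w i)%:E * \int[mu]_(y in B i) `|f y|.
Let avgbf i := (w i)%:E * \int[mu]_(y in B i) `|(b y)%:E * f y|.
Let avgd i := (w i)%:E * \int[mu]_(y in B i) (`|(u - b y)%R|%:E * `|f y|).

Let maf : measurable_fun setT (fun y => `|f y|).
Proof. exact: measurableT_comp. Qed.

Let mbf : measurable_fun setT (fun y => `|(b y)%:E * f y|).
Proof.
by apply: measurableT_comp => //; apply: emeasurable_funM => //; exact/measurable_EFinP.
Qed.

Let mdf : measurable_fun setT (fun y => `|(u - b y)%R|%:E * `|f y|).
Proof.
by apply: emeasurable_funM => //; apply/measurable_EFinP; exact: measurable_normB.
Qed.

Let avgf_ge0 i : 0 <= avgf i.
Proof. by rewrite mule_ge0 ?lee_fin ?integral_ge0. Qed.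

Let avgd_ge0 i : 0 <= avgd i.
Proof. by rewrite mule_ge0 ?lee_fin// integral_ge0// => y _; rewrite mule_ge0 ?lee_fin. Qed.

Let avgbf_le i : avgbf i <= `|u|%:E * avgf i + avgd i.
Proof.
apply: (weighted_integral_le mu (mB i)) => //; first by rewrite lee_fin.
move=> y; rewrite abseM -ge0_muleDl ?lee_fin//; apply: lee_wpmul2r => //.
rewrite -EFinD lee_fin -lerBlDl distrC.
exact: lerB_dist.
Qed.

Let avgf_le i : `|u|%:E * avgf i <= avgbf i + avgd i.
Proof.
rewrite -[avgbf i]mul1e /avgf muleCA -ge0_integralZl_EFin//; last exact: measurable_funTS.
apply: (weighted_integral_le mu (mB i)) => //; first by rewrite lee_fin.
  exact: measurable_funeM.
move=> y; rewrite mul1e abseM -ge0_muleDl ?lee_fin//; apply: lee_wpmul2r => //.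
by rewrite -EFinD lee_fin -lerBlDl lerB_dist.
Qed.

Variables (psi : R -> R) (c cb : R) (z : \bar R).
Hypotheses (psiG : growth psi) (c0 : (0 < c)%R) (cb0 : (0 <= cb)%R) (ucb : (- u <= cb)%R).

(** Replacing [b y] by [u] in the averages of [b * f] changes them by at most the averages
    of [`|u - b y| * `|f y|], so the two suprema differ by at most the supremum of the
    latter, up to the sign of [u]. *)
Lemma commutator_sup_bound : D !=set0 ->
  (forall i, D i -> ext psi (c^-1%:E * avgf i) <= z /\ ext psi (c^-1%:E * avgd i) <= z) ->
  ext psi ((2 * c * (1 + 2 * cb))^-1%:E *
    `|u%:E * ereal_sup [set avgf i | i in D] - ereal_sup [set avgbf i | i in D]|) <= z.
Proof.
move=> [i0 Di0] H; have [zoo|] := ltP z +oo; last by rewrite leye_eq => /eqP ->; exact: leey.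
have nonempty (F : I -> \bar R) : [set F i | i in D] !=set0 by exists (F i0), i0.
have [m [m0 mE mz]] : exists m : R, [/\ (0 <= m)%R,
    ereal_sup [set avgf i | i in D] = m%:E & ext psi ((2 * c)^-1 * m)%:E <= z].
  apply: (ext_sup_half psiG c0 zoo (nonempty _)) => y [i Di <-//].
  by have [] := H i Di.
have [s [s0 sE sz]] : exists s : R, [/\ (0 <= s)%R,
    ereal_sup [set avgd i | i in D] = s%:E & ext psi ((2 * c)^-1 * s)%:E <= z].
  apply: (ext_sup_half psiG c0 zoo (nonempty _)) => y [i Di <-//].
  by have [] := H i Di.
have fm i : D i -> avgf i <= m%:E by move=> Di; rewrite -mE; apply: ereal_sup_ubound; exists i.
have ds i : D i -> avgd i <= s%:E by move=> Di; rewrite -sE; apply: ereal_sup_ubound; exists i.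
have qle : ereal_sup [set avgbf i | i in D] <= (`|u| * m + s)%:E.
  apply: ge_ereal_sup => _ [i Di <-]; apply: (le_trans (avgbf_le i)).
  rewrite EFinD EFinM; apply: leeD; last exact: ds.
  by apply: lee_wpmul2l; [rewrite lee_fin|exact: fm].
have qge0 : 0 <= ereal_sup [set avgbf i | i in D].
  apply: (@le_trans _ _ (avgbf i0)); last by apply: ereal_sup_ubound; exists i0.
  by rewrite mule_ge0 ?lee_fin ?integral_ge0.
have [q qE] : exists q : R, ereal_sup [set avgbf i | i in D] = q%:E.
  by move: qle qge0; case: (ereal_sup _) => // q _ _; exists q.
have bfq i : D i -> avgbf i <= q%:E by move=> Di; rewrite -qE; apply: ereal_sup_ubound; exists i.
have umqs : (`|u| * m <= q + s)%R.
  have [->|u0] := eqVneq u 0%R.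
    by rewrite normr0 mul0r addr_ge0// -lee_fin -qE.
  have u0' : (0 < `|u|)%R by rewrite normr_gt0.
  rewrite -ler_pdivlMl// -lee_fin -mE; apply: ge_ereal_sup => _ [i Di <-].
  rewrite EFinM -lee_pdivrMl ?invr_gt0// invrK; apply: (le_trans (avgf_le i)).
  by rewrite EFinD; apply: leeD; [exact: bfq|exact: ds].
rewrite mE qE (_ : `|_| = `|(u * m - q)%R|%:E)// -EFinM; rewrite qE lee_fin in qle.
have q0 : (0 <= q)%R by rewrite -lee_fin -qE.
have key := commutator_real_bound cb0 ucb m0 s0 q0 qle umqs.
have cb2 : (0 < 1 + 2 * cb)%R by rewrite ltr_pwDl// mulr_ge0.
have maxz : ext psi ((2 * c)^-1 * Num.max m s)%:E <= z.
  by have [ms|ms] := leP m s.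
apply: le_trans maxz; apply: (le_ext psiG); rewrite lee_fin invfM -mulrA.
rewrite ler_pM2l ?invr_gt0 ?mulr_gt0// ler_pdivrMl//.
Qed.

End commutator_pointwise.

(** * Modular bounds and norms *)

Lemma Lfun_funrneg_bound d (T : measurableType d) (R : realType)
    (mu : {measure set T -> \bar R}) (b : T -> R) : 0 < mu setT ->
  (b^\-)%R \in Lfun mu +oo -> exists2 c : R, (0 <= c)%R &
    {ae mu, forall x, (- b x <= c)%R}.
Proof.
move=> muT /sub_Lfun_finLfun; rewrite inE /= /finite_norm unlock muT => fin.
have : 0 <= ess_sup mu (abse \o (EFin \o (b^\-)%R)) by apply: ess_sup_gee => //; apply: aeW => x; exact: abse_ge0.
move: fin (ess_sup_ge mu (abse \o (EFin \o (b^\-)%R))).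
case: (ess_sup _ _) => // c _ cP; rewrite lee_fin => c0; exists c => //.
apply: filterS cP => x /=; rewrite lee_fin; apply: le_trans.
apply: le_trans (ler_norm _); rewrite /funrneg le_max lexx//.
Qed.

Lemma weighted_integralZ d (T : measurableType d) (R : realType)
    (mu : {measure set T -> \bar R}) (B : set T) (w : \bar R) (s : R) (f : T -> \bar R)
    (h : T -> R) : measurable B -> (0 <= s)%R -> measurable_fun setT f ->
  measurable_fun setT h -> (forall x, 0 <= h x)%R ->
  w * \int[mu]_(y in B) (s%:E * `|f y|) = s%:E * (w * \int[mu]_(y in B) `|f y|) /\
  w * \int[mu]_(y in B) ((h y)%:E * (s%:E * `|f y|)) =
  s%:E * (w * \int[mu]_(y in B) ((h y)%:E * `|f y|)).
Proof.
move=> mB s0 mf mh h0.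
have maf : measurable_fun setT (fun y => `|f y|) by exact: measurableT_comp.
split.
  by rewrite [RHS]muleCA ge0_integralZl_EFin//; exact: measurable_funTS.
rewrite [RHS]muleCA; congr (_ * _).
have mhf : measurable_fun B (fun y => (h y)%:E * `|f y|).
  by apply: measurable_funTS; apply: emeasurable_funM => //; exact/measurable_EFinP.
have hf0 y : B y -> 0 <= (h y)%:E * `|f y| by move=> _; rewrite mule_ge0 ?lee_fin.
rewrite -(ge0_integralZl_EFin mu mB hf0 mhf s0).
by apply: eq_integral => y _; rewrite muleCA.
Qed.

Lemma measurable_EFin_mul d (T : measurableType d) (R : realType) (b : T -> R)
    (F : T -> \bar R) : measurable_fun setT b -> measurable_fun setT F ->
  measurable_fun setT (fun x => (b x)%:E * F x).
Proof. by move=> mb mF; apply: emeasurable_funM => //; exact/measurable_EFinP. Qed.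

Lemma measurable_commutator d (T : measurableType d) (R : realType) (b : T -> R)
    (F G : T -> \bar R) : measurable_fun setT b -> measurable_fun setT F ->
  measurable_fun setT G -> measurable_fun setT (fun x => (b x)%:E * F x - G x).
Proof.
by move=> mb mF mG; apply: emeasurable_funB => //; exact: measurable_EFin_mul.
Qed.

Lemma integral_ext_scale d (T : measurableType d) (R : realType)
    (mu : {measure set T -> \bar R}) (phi : R -> R) (s : R) (f : T -> \bar R) :
  growth phi -> (0 <= s <= 1)%R -> measurable_fun setT f -> (forall x, 0 <= f x) ->
  \int[mu]_x ext phi (s%:E * f x) <= s%:E * \int[mu]_x ext phi (f x).
Proof.
move=> phiG s01 mf f0; have [s0 _] := andP s01; have me := measurable_ext phiG.
have mef : measurable_fun setT (fun x => ext phi (f x)) by exact: (measurableT_comp me).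
rewrite -ge0_integralZl_EFin//; last by move=> x _; exact: (ext_ge0 phiG).
apply: ge0_le_integral => //.
- by move=> x _; exact: (ext_ge0 phiG).
- by apply: (measurableT_comp me); exact: measurable_funeM.
- exact: measurable_funeM.
- by move=> x _; exact: (ext_scale phiG).
Qed.

Lemma integral_ext_scale_le1 d (T : measurableType d) (R : realType)
    (mu : {measure set T -> \bar R}) (psi : R -> R) (c M : R) (f V : T -> \bar R) :
  growth psi -> (0 < c)%R -> (1 <= M)%R ->
  measurable_fun setT f -> measurable_fun setT V -> (forall x, 0 <= V x) ->
  {ae mu, forall x, ext psi (c^-1%:E * `|f x|) <= V x} ->
  \int[mu]_x V x <= M%:E ->
  \int[mu]_x ext psi (`|f x| * (M * c)^-1%:E) <= 1.
Proof.
move=> psiG c0 M1 mf mV V0 fV VM; have M0 : (0 < M)%R by exact: lt_le_trans M1.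
have maf : measurable_fun setT (fun y => c^-1%:E * `|f y|).
  by apply: measurable_funeM; exact: measurableT_comp.
have I0 : \int[mu]_x ext psi (c^-1%:E * `|f x|) <= M%:E.
  apply: le_trans VM; apply: ae_ge0_le_integral => //.
  - by move=> x _; exact: (ext_ge0 psiG).
  - exact: (measurableT_comp (measurable_ext psiG)).
  - by apply: filterS fV => x H _.
apply: (@le_trans _ _ (\int[mu]_x ext psi (M^-1%:E * (c^-1%:E * `|f x|)))).
  by rewrite le_eqVlt; apply/orP; left; apply/eqP; apply: eq_integral => x _;
     rewrite muleC muleA -EFinM invfM.
apply: (le_trans (integral_ext_scale mu psiG _ maf _)).
- by rewrite invr_ge0 ltW//= invf_le1.
- by move=> x; rewrite mule_ge0// lee_fin invr_ge0 ltW.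
- apply: (@le_trans _ _ (M^-1%:E * M%:E)).
    by apply: lee_wpmul2l => //; rewrite lee_fin invr_ge0 ltW.
  by rewrite -EFinM mulVf// gt_eqF.
Qed.

Lemma Orlicz_admissible (R : realType) (n : nat) (Phi : R -> \bar R)
    (f : euclid R n -> \bar R) : young_function Phi -> Delta2 Phi -> Orlicz Phi f ->
  exists2 l : R, (0 < l)%R &
    \int[lebesgue R n]_x ext (young_real Phi) (`|f x| * l^-1%:E) <= 1.
Proof.
move=> PhiY PhiD [mf [k k0 Ik]]; have phiG := young_growth PhiY PhiD.
set J := \int[_]_x _ in Ik.
have JE : J = \int[lebesgue R n]_x ext (young_real Phi) (k%:E * `|f x|).
  apply: eq_integral => x _; rewrite (young_extE PhiY PhiD)//.
  by rewrite mule_ge0// lee_fin ltW.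
have J0 : 0 <= J by rewrite JE integral_ge0// => x _; exact: (ext_ge0 phiG).
clearbody J.
case: J J0 Ik JE => // j; rewrite lee_fin => j0 _ JE.
(* Dividing by j + 1 brings the finite modular j below 1. *)
exists ((j + 1) * k^-1)%R; first by rewrite mulr_gt0 ?invr_gt0// ltr_wpDl.
apply: (integral_ext_scale_le1 phiG (V := fun x => ext (young_real Phi) (k%:E * `|f x|))).
- by rewrite invr_gt0.
- by rewrite lerDr.
- exact: mf.
- apply: (measurableT_comp (measurable_ext phiG)).
  by apply: measurable_funeM; exact: measurableT_comp.
- by move=> x; exact: (ext_ge0 phiG).
- by apply: aeW => x; rewrite invrK.
- by rewrite -JE lee_fin lerDl.
Qed.

Section commutator_modular.
Context (R : realType) (n : nat).
Hypothesis n0 : (0 < n)%N.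
Local Notation Rn := (euclid R n).
Local Notation leb := (lebesgue R n).

Lemma lebesgue_setT_gt0 : 0 < leb setT.
Proof.
have x0 : Rn := [tuple of nseq n 0%R].
apply: (@lt_le_trans _ _ (leb (eball x0 1%R))).
  by rewrite volE// lte_fin vol_gt0.
by apply: le_measure; rewrite ?inE//; exact: measurable_eball.
Qed.

Variable b : Rn -> R.
Hypotheses (bL : L1loc b) (bfin : bmo_norm b < +oo).
Hypothesis bneg : (b^\-)%R \in Lfun leb +oo.
Variables (phi psi : R -> R) (A K alpha C : R).
Hypotheses (phiG : growth phi) (psiG : growth psi).
Hypothesis (A2 : (2 <= A)%R).
Hypothesis phiA : forall r : R, (0 <= r)%R -> (2 * A * phi r <= phi (A * r))%R.
Hypothesis (K1 : (1 <= K)%R).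
Hypothesis psiK : forall r : R, (0 < r)%R -> (psi (2 * r) <= K * psi r)%R.
Hypotheses (alpha0 : (0 <= alpha)%R) (alphan : (alpha <= n%:R)%R) (C0 : (0 < C)%R).
Hypothesis phipsi : forall s rho : R, (0 < s)%R -> (0 <= rho)%R ->
  (phi rho <= s)%R -> (psi (s `^ (- (alpha / n%:R)) * rho / C) <= s)%R.

Lemma measurable_commutator_max (f : Rn -> \bar R) : measurable_fun setT f ->
  measurable_fun setT (commutator_max b alpha f).
Proof.
move=> mf; apply: measurable_commutator; first exact: bL.1.
  exact: measurable_frac_max.
exact: (measurable_frac_max n0 alphan (measurable_EFin_mul bL.1 mf)).
Qed.

(** Apply [ball_commutator] to a multiple of [f] whose modular is at most 1 / 4; star
    shapedness provides the multiple and, at the end, turns the bound [M] for the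
    integral of the majorant into 1. *)
Lemma commutator_max_modular : exists2 kap : R, (0 < kap)%R &
  forall (f : Rn -> \bar R) (l : R), measurable_fun setT f -> (0 < l)%R ->
  \int[leb]_x ext phi (`|f x| * l^-1%:E) <= 1 ->
  \int[leb]_x ext psi (`|commutator_max b alpha f x| * (kap * l)^-1%:E) <= 1.
Proof.
have nn0 : (0 < n%:R :> R)%R by rewrite ltr0n.
have a0 : (0 <= alpha / n%:R)%R by rewrite divr_ge0// ltW.
have a1 : (alpha / n%:R <= 1)%R by rewrite ler_pdivrMr// mul1r.
have [k k0 H] := ball_commutator n0 bL bfin phiG psiG A2 phiA K1 psiK a0 a1 C0 phipsi.
have [cb cb0 bcb] := Lfun_funrneg_bound lebesgue_setT_gt0 bneg.
have A0 : (0 < A)%R by exact: lt_le_trans A2.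
pose M := (6 * 2 ^+ n : R)%R.
have M1 : (1 <= M)%R.
  have : (1 <= 2 ^+ n :> R)%R by rewrite exprn_ege1// ler1n.
  by rewrite /M; lra.
(* For s = (16 * A^2 * l)^-1 the modular hypothesis reads 4 * A^2 * s = (4 * l)^-1; c l is
   the constant of commutator_sup_bound for k / s in place of its c. *)
pose c (l : R) := (2 * (k * (16 * A * A * l)) * (1 + 2 * cb))%R.
have cb2 : (0 < 1 + 2 * cb)%R by rewrite ltr_pwDl// mulr_ge0.
have c0 l : (0 < l)%R -> (0 < c l)%R by move=> l0; rewrite !mulr_gt0.
exists (M * c 1%R)%R => [|f l mf l0 fl].
  by rewrite mulr_gt0 ?c0// (lt_le_trans ltr01).
have -> : (M * c 1 * l = M * c l)%R by rewrite /c; ring.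
set s := ((16 * A * A * l)^-1)%R.
have s0 : (0 < s)%R by rewrite invr_gt0 !mulr_gt0.
have maf : measurable_fun setT (fun x => `|f x|) by exact: measurableT_comp.
have mg : measurable_fun setT (fun x => s%:E * `|f x|) by exact: (measurable_funeM _ maf).
have g0 x : 0 <= s%:E * `|f x| by rewrite mule_ge0// lee_fin ltW.
have gle : \int[leb]_x ext phi ((2 * A * (2 * A))%:E * (s%:E * `|f x|)) <= 4^-1%:E.
  rewrite (eq_integral (fun x => ext phi (4^-1%:E * (`|f x| * l^-1%:E)))); last first.
    move=> x _; rewrite muleA -EFinM [`|f x| * _]muleC muleA -EFinM.
    congr (ext phi (_%:E * _)); rewrite /s; field.
    by rewrite !gt_eqF.
  apply: (le_trans (integral_ext_scale leb phiG _ _ _)).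
  - by rewrite invr_ge0 ler0n/= invf_le1// ler1n.
  - rewrite (_ : (fun x => _) = (fun x => l^-1%:E * `|f x|)).
      exact: (measurable_funeM _ maf).
    by apply/funext => x; rewrite muleC.
  - by move=> x; rewrite mule_ge0// lee_fin invr_ge0 ltW.
  - by rewrite -[leRHS]mule1; apply: lee_wpmul2l => //; rewrite lee_fin invr_ge0.
have [V [mV V0 VM VP]] := H _ mg g0 gle.
apply: (integral_ext_scale_le1 psiG (c0 l l0) M1 (measurable_commutator_max mf) mV V0 _ VM).
apply: filterS2 bcb VP => x bx Vx.
have kE : (k * (16 * A * A * l) = k / s)%R by rewrite /s invrK.
rewrite /c kE /commutator_max /frac_max.
apply: (commutator_sup_bound (mu := leb) (D := [set t : R | (0 < t)%R])
  (w := fun t => (vol x t `^ (-1 + alpha / n%:R))%R) (B := eball x) _ _ bL.1 mf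
  psiG _ cb0 bx).
- by move=> t; exact: powR_ge0.
- by move=> t; exact: measurable_eball.
- by rewrite divr_gt0.
- by exists 1%R => /=.
move=> t t0; have := Vx t t0.
have mdb : measurable_fun setT (fun y => `|b x - b y|%R).
  exact: (measurable_normB _ bL.1).
have [-> ->] := weighted_integralZ leb (vol x t `^ (-1 + alpha / n%:R))%:E
  (measurable_eball n0 x t) (ltW s0) mf mdb (fun y => normr_ge0 _).
have sE (J : \bar R) : k^-1%:E * (s%:E * J) = (k / s)^-1%:E * J.
  by rewrite muleA -EFinM invf_div mulrC.
by rewrite !sE.
Qed.

End commutator_modular.

Theorem corollary3p15 (R : realType) (n : nat) (alpha : R)
    (b : euclid R n -> R) (Phi Psi : R -> \bar R) :
  (0 < alpha < n%:R)%R ->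
  BMO b ->
  (b^\-)%R \in Lfun (lebesgue R n) +oo%E ->
  young_function Phi -> young_function Psi ->
  Delta2 Phi -> nabla2 Phi ->
  Delta2 Psi -> nabla2 Psi ->
  (exists2 C : R, (0 < C)%R &
     forall r : R, (0 < r)%R ->
       ((r `^ (- (alpha / n%:R)))%:E * young_inv Phi r%:E
          <= C%:E * young_inv Psi r%:E)%E) ->
  Orlicz_bounded Phi Psi (commutator_max b alpha).
Proof.
move=> /andP[alpha0 alphan] [bL bfin] bneg PhiY PsiY PhiD PhiN PsiD _ [C C0 HC].
have n0 : (0 < n)%N by rewrite -(ltr0n R) (lt_trans alpha0).
have phiG := young_growth PhiY PhiD; have psiG := young_growth PsiY PsiD.
have [A A2 phiA] := young_real_nabla2 PhiY PhiD PhiN.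
have [K K1 psiK] := young_real_doubling PsiY PsiD.
have C20 : (0 < 2 * C)%R by rewrite mulr_gt0.
have [kap kap0 H] := commutator_max_modular n0 bL bfin bneg phiG psiG A2 phiA K1
  psiK (ltW alpha0) (ltW alphan) C20 (young_inv_compare PhiY PhiD PsiY PsiD C0 HC).
have extT (l : R) f : (0 < l)%R ->
    \int[lebesgue R n]_x ext (young_real Phi) (`|f x| * l^-1%:E) <= 1 ->
    measurable_fun setT f ->
    \int[lebesgue R n]_x young_ext Psi (`|commutator_max b alpha f x| * (kap * l)^-1%:E) <= 1.
  move=> l0 fl mf; apply: le_trans (H f l mf l0 fl).
  rewrite le_eqVlt; apply/orP; left; apply/eqP; apply: eq_integral => x _.
  rewrite (young_extE PsiY PsiD)// mule_ge0// lee_fin invr_ge0 ltW// mulr_gt0//.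
exists kap; first exact: kap0.
move=> f fO; have mf := fO.1.
have [l l0 fl] := Orlicz_admissible PhiY PhiD fO.
split; [split|].
- exact: (measurable_commutator_max n0 bL (ltW alphan) mf).
- exists (kap * l)^-1%R; first by rewrite invr_gt0 mulr_gt0.
  rewrite (eq_integral (fun x => young_ext Psi
    (`|commutator_max b alpha f x| * (kap * l)^-1%:E))); last by move=> x _; rewrite muleC.
  by apply: (le_lt_trans (extT l f l0 fl mf)); exact: ltry.
- rewrite -lee_pdivrMl//; apply: le_ereal_inf_tmp => _ [r [r0 fr] <-].
  rewrite lee_pdivrMl// -EFinM; apply: ereal_inf_lbound; exists (kap * r)%R => //.
  split; first by rewrite mulr_gt0.
  apply: (extT _ _ r0 _ mf); apply: le_trans fr.
  rewrite le_eqVlt; apply/orP; left; apply/eqP; apply: eq_integral => x _.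
  by rewrite (young_extE PhiY PhiD)// mule_ge0// lee_fin invr_ge0 ltW.
Qed.
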